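(* Consider the contextual search problem in dimension $d$ with the symmetric loss $\ell(\theta,p)=|\theta-p|$, and let the learner use SymmetricSearch as described in the context (with any admissible choices of $p_i$ and $j$). Then the total loss $\sum_{t=1}^T|\langle u_t,v\rangle-p_t|$ is $O(d^4)$: there is an absolute constant $C$ such that for every $d\ge1$, every $T$, every $v\in[0,1]^d$ and every adversary, the total loss is at most $Cd^4$.
   Context: Contextual search problem in dimension $d$: an adversary fixes $v\in[0,1]^d$. In each round $t=1,\dots,T$ the adversary chooses a unit vector $u_t\in\mathbb{R}^d$, the learner chooses $p_t\in\mathbb{R}$, incurs loss $\ell(\langle u_t,v\rangle,p_t)$ and learns the sign of $\langle u_t,v\rangle-p_t$. Knowledge sets: $S_1=[0,1]^d$, $S_{t+1}=S_t^+(p_t;u_t):=\{x\in S_t:\langle u_t,x\rangle\ge p_t\}$ if $p_t\le\langle u_t,v\rangle$ was learned, else $S_{t+1}=S_t^-(p_t;u_t):=\{x\in S_t:\langle u_t,x\rangle\le p_t\}$. Intrinsic volumes: for a compact convex $K\subset\mathbb{R}^d$ and the unit ball $B$, $\mathrm{Vol}(K+\varepsilon B)=\sum_{j=0}^d\kappa_{d-j}V_j(K)\varepsilon^{d-j}$ for all $\varepsilon\ge0$, where $\kappa_m$ is the volume of the $m$-dimensional unit ball; this defines $V_0(K),\dots,V_d(K)$ (they do not depend on the ambient dimension in which $K$ is embedded). Let $c_i=\frac{1}{2^{i-1}i!}$ for $i\ge 1$ ($c_0=1$). SymmetricSearch in round $t$: let $w=\frac12\mathrm{width}(S_t;u_t)$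 where $\mathrm{width}(S;u)=\max_{x\in S}\langle u,x\rangle-\min_{x\in S}\langle u,x\rangle$. For $i=1,\dots,d$ choose $p_i\in\mathbb{R}$ with $V_i(S_t^+(p_i;u_t))=V_i(S_t^-(p_i;u_t))$, let $K_i=\{x\in S_t:\langle u_t,x\rangle=p_i\}$ and $L_i=(V_i(K_i)/c_i)^{1/i}$; set $L_0=\infty$. Choose $j\in\{1,\dots,d\}$ with $L_{j-1}\ge w\ge L_j$ and guess $p_t=p_j$. *)

(* Defs.v *)
From HB Require Import structures.
From mathcomp Require Import all_boot all_order all_algebra.
From mathcomp Require Import all_classical all_reals all_analysis.
Set Implicit Arguments.
Unset Strict Implicit.
Unset Printing Implicit Defensive.
Import Order.TTheory GRing.Theory Num.Theory.
Import numFieldNormedType.Exports.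
Local Open Scope classical_set_scope.
Local Open Scope ring_scope.

Section IntrinsicVolumes.
Variable R : realType.

Definition dot d (x y : 'rV[R]_d) : R := \sum_(i < d) x 0 i * y 0 i.

(* The library norm on 'rV[R]_d is the sup norm, hence the explicit use of the
   Euclidean scalar product. *)
Definition unit_ball d : set 'rV[R]_d := [set x | dot x x <= 1].

(* K + eps B *)
Definition parallel_body d (K : set 'rV[R]_d) (eps : R) : set 'rV[R]_d :=
  [set x + eps *: b | x in K & b in @unit_ball d].

(* d-dimensional Lebesgue measure, as the iterated product of d copies of
   [lebesgue_measure]: the successor case is the defining formula
   (\int[m1]_x m2 (xsection A x)) of the library's product measure [m1 \x m2],
   with R^(d+1) read as R * R^d.  It is only meant for Borel sets. *)
Fixpoint volume d : set 'rV[R]_d -> \bar R :=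
  match d with
  | 0 => fun A => (\1_A 0)%:E
  | n.+1 => fun A => (\int[lebesgue_measure]_x
      volume [set y : 'rV[R]_n | A (row_mx (x%:M : 'rV[R]_1) y)])%E
  end.

Definition kappa (m : nat) : R := fine (volume (@unit_ball m)).

(* [V 0], ..., [V d] are the coefficients of the Steiner polynomial of K;
   [V j] is irrelevant for j > d. *)
Definition steiner_coefficients d (K : set 'rV[R]_d) (V : nat -> R) : Prop :=
  forall eps : R, 0 <= eps ->
    volume (parallel_body K eps) =
    (\sum_(j < d.+1) kappa (d - j) * V j * eps ^+ (d - j))%:E.

(* V_j(K), for K compact convex and j <= d.  The empty set, which may occur as
   one side of a cut, has V_j = 0 for all j. *)
Definition intrinsic_volume d (j : nat) (K : set 'rV[R]_d) : R :=
  xget (fun=> 0) [set V | steiner_coefficients K V] j.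

End IntrinsicVolumes.

Section ContextualSearch.
Variables (R : realType) (d : nat).
Implicit Types (S : set 'rV[R]_d) (v x : 'rV[R]_d) (u : nat -> 'rV[R]_d).

Definition unit_cube : set 'rV[R]_d := [set x | forall i, 0 <= x 0 i <= 1].

Definition unit_vector (w : 'rV[R]_d) : Prop := dot w w = 1.

Definition cut_ge S (p : R) (w : 'rV[R]_d) := [set x | S x /\ p <= dot w x].
Definition cut_le S (p : R) (w : 'rV[R]_d) := [set x | S x /\ dot w x <= p].
Definition cut_eq S (p : R) (w : 'rV[R]_d) := [set x | S x /\ dot w x = p].

Definition width S (w : 'rV[R]_d) : R :=
  sup [set dot w x | x in S] - inf [set dot w x | x in S].

Definition cone_const (i : nat) : R :=
  if i is 0 then 1 else (2 ^+ i.-1 * i`!%:R)^-1.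

(* L_i, computed from the section K of the knowledge set at the i-th candidate
   guess *)
Definition section_scale (i : nat) (K : set 'rV[R]_d) : \bar R :=
  if i is 0 then +oo%E
  else ((intrinsic_volume i K / cone_const i) `^ (i%:R^-1))%:E.

(* [symmetric_search_guess S w p]: SymmetricSearch may guess p when the
   knowledge set is S and the direction is w; [q] lists the candidates
   p_1, ..., p_d. *)
Definition symmetric_search_guess S (w : 'rV[R]_d) (p : R) : Prop :=
  exists (q : nat -> R) (j : nat),
    let L i := section_scale i (cut_eq S (q i) w) in
    let h := (width S w / 2)%:E in
    [/\ forall i, (1 <= i <= d)%N ->
          intrinsic_volume i (cut_ge S (q i) w) =
          intrinsic_volume i (cut_le S (q i) w),
        (1 <= j <= d)%N,
        (h <= L j.-1)%E,
        (L j <= h)%E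
      & p = q j].

(* The knowledge set at the start of round t (rounds are numbered from 0). *)
Fixpoint knowledge_set v u (p : nat -> R) (t : nat) : set 'rV[R]_d :=
  if t is s.+1 then
    let S := knowledge_set v u p s in
    if p s <= dot (u s) v then cut_ge S (p s) (u s) else cut_le S (p s) (u s)
  else unit_cube.

(* The loss bound below is over all sequences u, so it covers every adaptive
   adversary: against a given one, u is the sequence of directions played. *)
Definition symmetric_search_run v u (p : nat -> R) (T : nat) : Prop :=
  forall t, (t < T)%N ->
    unit_vector (u t) /\
    symmetric_search_guess (knowledge_set v u p t) (u t) (p t).

Definition symmetric_loss (theta p : R) : R := `|theta - p|.

Definition total_loss v u (p : nat -> R) (T : nat) : R :=
  \sum_(t < T) symmetric_loss (dot (u t) v) (p t).

End ContextualSearch.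

Arguments unit_cube {R d}.

(* Main.v *)
(* With h half the width of the knowledge set S and j the chosen index, the cone
   inequality V_j(S) >= (h / j) V_{j-1}(K) for the larger side of the section K at
   p_{j-1} gives V_j(S) >= 2 c_j h^j, whereas V_j of the section at p_j is at most
   c_j h^j.  As V_j is a valuation, cutting at p_j multiplies V_j(S) by at most 3/4.
   By monotonicity the potential sum_j (V_j(S) / c_j)^(1/j) thus drops by at least
   h / (4 d), a fixed fraction of the loss over d, and it is at most 2 d^2 for the cube.

   Intrinsic volumes of arbitrary convex bodies are obtained without polytopes.
   Adding a segment [-t s, t s] changes the volume affinely in t, so that the volume
   of K + e Z, for a zonotope Z, is a polynomial in e whose coefficients are
   nonnegative and monotone in K.  The unit ball is a limit of zonotopes, and
   interpolation at 0, ..., d turns the limit polynomials into Steiner's formula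
   with monotone coefficients.  The cone inequality follows from the formula for
   right cylinders, a reflection argument for oblique ones, and the self-similarity
   of cones. *)
Require Import Defs.
From mathcomp Require Import all_boot all_order all_algebra.
From mathcomp Require Import all_classical all_reals all_analysis.
From mathcomp Require Import measurable_realfun ring lra.
Set Implicit Arguments.
Unset Strict Implicit.
Unset Printing Implicit Defensive.
Import Order.TTheory GRing.Theory Num.Theory.
Import numFieldNormedType.Exports.
Local Open Scope classical_set_scope.
Local Open Scope ring_scope.

(** * Row vectors and sections *)

Section RowVectors.
Variable R : realType.

(** [volume] is an iterated integral, so every argument by sections needs their volumes to be
    measurable. All is therefore proved for compact sets, where upper semicontinuity provides this.
    Invariance under isometries, invisible in a coordinatewise definition, comes from uniqueness: a
    translation-invariant content on compact sets is a multiple of the volume, and the ball fixes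
    the multiple.

    The obstacle is monotonicity of intrinsic volumes. Steiner's formula expresses them through
    volumes of parallel bodies with weights of both signs, so monotonicity of the volume is not
    enough; hence the detour through zonotopes.

    The constants satisfy c_(j-1) = 2 j c_j for j >= 2, so that the cone inequality yields its lower
    bound with a factor 2. The section at p_j then has at most half of V_j(S), and balance gives (1
    + 1/2) / 2 = 3/4.

    The argument also needs h > 0 in every round. Balance forces p_j strictly between the extreme
    values on S, so both parts keep positive width in all directions. The loss of a round is at most
    2 h, and the total is at most 8 d times 2 d^2. *)

Lemma mx_continuous (T : topologicalType) m n (f : T -> 'M[R]_(m, n)) :
  (forall i j, continuous (fun x => f x i j)) -> continuous f.
Proof.
move=> cf x; apply/cvgrPdist_lt => e e0.
have : \forall t \near x, forall ij : 'I_m * 'I_n,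
    `|f x ij.1 ij.2 - f t ij.1 ij.2| < e.
  apply: filter_forall => -[i j] /=.
  by have /cvgrPdist_lt := cf i j x; apply.
apply: filterS => t H.
rewrite [ltLHS](mx_normrE _); apply/bigmax_ltP; split => // ij _.
by rewrite !mxE.
Qed.

Lemma coord_cts n (i : 'I_n) : continuous (fun x : 'rV[R]_n => x 0 i).
Proof. exact: coord_continuous. Qed.

Lemma compact_rowP n (A : set 'rV[R]_n) :
  compact A <->
  closed A /\ exists2 r, 0 <= r & forall x, A x -> forall i, `|x 0 i| <= r.
Proof.
split=> [cA|[clA [r r0 Ar]]].
- split; first exact: compact_closed (@norm_hausdorff _ _) cA.
  have /compact_bounded [M [_ AM']] := cA.
  have /AM' AM : M < `|M| + 1 by rewrite (le_lt_trans (ler_norm M))// ltrDl.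
  exists (`|M| + 1); first by rewrite addr_ge0.
  move=> x /AM /= xM i; apply: le_trans xM.
  rewrite [leRHS](mx_normrE _); apply/bigmax_geP; right => /=.
  by exists (0, i).
- apply: bounded_closed_compact clA; exists r; split; first exact: num_real.
  move=> M rM x /Ar xr /=; rewrite [leLHS](mx_normrE _).
  apply/bigmax_leP; split; first by rewrite (le_trans r0)// ltW.
  by move=> [i j] _ /=; rewrite ord1 (le_trans (xr _))// ltW.
Qed.

Lemma compact_row_closed n (A : set 'rV[R]_n) : compact A -> closed A.
Proof. by case/compact_rowP. Qed.

Lemma compact_sub n (A B : set 'rV[R]_n) :
  compact B -> closed A -> A `<=` B -> compact A.
Proof. by move=> cB clA AB; exact: subclosed_compact clA cB AB. Qed.

Lemma compactI n (A B : set 'rV[R]_n) :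
  compact A -> compact B -> compact (A `&` B).
Proof. by move=> cA /compact_row_closed; exact: compact_closedI. Qed.

Lemma preimage_closedT (T U : topologicalType) (f : T -> U) (D : set U) :
  continuous f -> closed D -> closed (f @^-1` D).
Proof. by move=> cf; apply: preimage_closed => x _; exact: cf. Qed.

Lemma compact_image (T U : topologicalType) (f : T -> U) (A : set T) :
  continuous f -> compact A -> compact (f @` A).
Proof. by move=> cf; apply: continuous_compact; exact: continuous_subspaceT. Qed.

(** Spelled as in the recursion of [volume], so that [volumeS] holds by conversion. *)
Definition scons n (x : R) (y : 'rV[R]_n) : 'rV[R]_n.+1 :=
  row_mx (x%:M : 'rV[R]_1) y.

Definition sbehead n (z : 'rV[R]_n.+1) : 'rV[R]_n := \row_i z 0 (lift ord0 i).

Definition slice n (A : set 'rV[R]_n.+1) (x : R) : set 'rV[R]_n :=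
  [set y | A (scons x y)].

Lemma scons0 n x (y : 'rV[R]_n) : scons x y 0 ord0 = x.
Proof.
rewrite /scons; have -> : (ord0 : 'I_n.+1) = lshift n (0 : 'I_1) by exact/val_inj.
by rewrite (row_mxEl (x%:M : 'rV[R]_1) y) mxE eqxx mulr1n.
Qed.

Lemma sconsS n x (y : 'rV[R]_n) i : scons x y 0 (lift ord0 i) = y 0 i.
Proof.
rewrite /scons; have -> : lift ord0 i = rshift 1 i by exact/val_inj.
by rewrite (row_mxEr (x%:M : 'rV[R]_1) y).
Qed.

Lemma sconsK n x (y : 'rV[R]_n) : sbehead (scons x y) = y.
Proof. by apply/rowP => i; rewrite mxE sconsS. Qed.

Lemma sconsE n (z : 'rV[R]_n.+1) : scons (z 0 ord0) (sbehead z) = z.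
Proof.
apply/rowP => i; case: (unliftP ord0 i) => [j ->|->]; last by rewrite scons0.
by rewrite sconsS mxE.
Qed.

Lemma scons_continuous_r n x : continuous (@scons n x).
Proof.
apply: mx_continuous => i j; rewrite (ord1 i).
case: (unliftP ord0 j) => [k ->|->].
- rewrite (_ : (fun _ => _) = fun y : 'rV[R]_n => y 0 k); first exact: coord_cts.
  by apply/funext => y; rewrite sconsS.
- rewrite (_ : (fun _ => _) = fun=> x); first exact: cst_continuous.
  by apply/funext => y; rewrite scons0.
Qed.

Lemma scons_continuous_l n (y : 'rV[R]_n) : continuous (fun x => scons x y).
Proof.
apply: mx_continuous => i j; rewrite (ord1 i).
case: (unliftP ord0 j) => [k ->|->].
- rewrite (_ : (fun _ => _) = fun=> y 0 k); first exact: cst_continuous.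
  by apply/funext => x; rewrite sconsS.
- rewrite (_ : (fun _ => _) = id); first by move=> x; exact: cvg_id.
  by apply/funext => x; rewrite scons0.
Qed.

Lemma sbehead_continuous n : continuous (@sbehead n).
Proof.
apply: mx_continuous => i j.
rewrite (_ : (fun _ => _) = fun z : 'rV[R]_n.+1 => z 0 (lift ord0 j)).
  exact: coord_cts.
by apply/funext => z; rewrite mxE.
Qed.

Lemma compact_slice n (A : set 'rV[R]_n.+1) x : compact A -> compact (slice A x).
Proof.
move=> /compact_rowP [clA [r r0 Ar]]; apply/compact_rowP; split.
  exact: preimage_closedT (@scons_continuous_r _ _) clA.
by exists r => // y /Ar Ay i; rewrite -(sconsS x).
Qed.

End RowVectors.

(** * Monotonicity, continuity from above and bounds for the volume of compact sets *)

Section Volume.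
Variable R : realType.
Local Notation mu := (@lebesgue_measure R).

Lemma volume_ge0 n (A : set 'rV[R]_n) : (0 <= volume A)%E.
Proof.
elim: n A => [A|n IH A] /=; first by rewrite lee_fin.
by apply: integral_ge0 => x _; exact: IH.
Qed.

Lemma volume0 n : volume (set0 : set 'rV[R]_n) = 0%E.
Proof.
elim: n => [|n IH] /=; first by rewrite indic0.
by rewrite (eq_integral (cst 0%E)) ?integral0.
Qed.

Lemma volumeS n (A : set 'rV[R]_n.+1) :
  volume A = (\int[mu]_x volume (slice A x))%E.
Proof. by []. Qed.

Lemma bigcap_compact n (A : nat -> set 'rV[R]_n) :
  (forall k, compact (A k)) -> compact (\bigcap_k A k).
Proof.
move=> cA; apply: (compact_sub (cA 0)); last by move=> x; apply.
by apply: closed_bigI => k _; exact: compact_row_closed.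
Qed.

Lemma slice_out n (A : set 'rV[R]_n.+1) r x :
  (forall x, A x -> forall i, `|x 0 i| <= r) -> ~ (- r <= x <= r) ->
  slice A x = set0.
Proof.
move=> Ar xr; rewrite -subset0 => y /Ar /(_ ord0).
by rewrite scons0 ler_norml => /xr.
Qed.

Section Step.
Variable n : nat.
Hypothesis le_volume : forall A B : set 'rV[R]_n, compact A -> compact B ->
  A `<=` B -> (volume A <= volume B)%E.
Hypothesis cvg_volume : forall A : nat -> set 'rV[R]_n,
  (forall k, compact (A k)) -> (forall k, A k.+1 `<=` A k) ->
  volume (A k) @[k --> \oo] --> volume (\bigcap_k A k).

(* The volume of the sections of a compact set is upper semicontinuous. *)
Lemma measurable_volume_slice_step (A : set 'rV[R]_n.+1) : compact A ->
  measurable_fun setT ((fun x => volume (slice A x)) : R -> \bar R).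
Proof.
move=> cA; pose g x := volume (slice A x).
suff lsc : lower_semicontinuous (fun x : R => - g x)%E.
  rewrite (_ : (fun _ => _) = (fun x => - - g x)%E); last first.
    by apply/funext => x; rewrite oppeK.
  by apply: measurableT_comp => //; exact: lower_semicontinuous_measurable lsc.
move=> x a ax.
(* The union of the sections at distance at most 1/(k+1) from [x], a compact set. It decreases to
   the section at [x], so by continuity from above its volume falls below any bound exceeding that
   of the section, and it contains all nearby sections. *)
pose E k := @sbehead R n @` (A `&` [set z | `|x - z 0 ord0| <= k.+1%:R^-1]).
have cE k : compact (E k).
  apply: compact_image; first exact: sbehead_continuous.
  apply: compact_closedI => //.
  rewrite [X in closed X](_ : _ = (fun z : 'rV[R]_n.+1 => z 0 ord0) @^-1`
     `[x - k.+1%:R^-1, x + k.+1%:R^-1]); last first.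
    by apply/funext => z /=; rewrite in_itv /= -ler_distlC.
  have clI : closed (`[x - k.+1%:R^-1, x + k.+1%:R^-1] : set R) by exact: itv_closed.
  exact: preimage_closedT (@coord_cts _ _ _) clI.
have ndE k : E k.+1 `<=` E k.
  move=> _ [z [Az /= zk] <-]; exists z => //; split=> //=.
  by rewrite (le_trans zk)// lef_pV2 ?posrE// ler_nat.
have capE : \bigcap_k E k = slice A x.
  apply/seteqP; split => [y Ey|y Ay k _]; last first.
    exists (scons x y); last exact: sconsK.
    by split=> //=; rewrite scons0 subrr normr0.
  have clA : closed [set r | A (scons r y)].
    exact: (@preimage_closedT _ _ (fun r => scons r y) A
      (@scons_continuous_l _ _ _) (compact_row_closed cA)).
  apply: clA => /= B /nbhs_ballP[e /= e0 eB].
  near \oo => k.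
  have [z [Az /= zk] zy] := Ey k I.
  exists (z 0 ord0); split; first by rewrite /= -zy sconsE.
  apply: eB; rewrite /ball/= (le_lt_trans zk)//.
  near: k; exact: near_infty_natSinv_lt (PosNum e0).
have lt : (volume (\bigcap_k E k) < - a%:E)%E by rewrite capE lteNr.
have : \forall k \near \oo, (volume (E k) < - a%:E)%E.
  exact: (cvg_volume cE ndE) _ (open_ereal_lt' lt).
move=> [k _ /(_ k (leqnn k)) /= Ek].
exists (ball x k.+1%:R^-1); first by apply: nbhsx_ballx; rewrite invr_gt0.
move=> y; rewrite /ball /= => xy; rewrite lteNr.
apply: le_lt_trans Ek; apply: le_volume => //; first exact: compact_slice.
move=> t At; exists (scons y t); last exact: sconsK.
by split=> //=; rewrite scons0 ltW.
Unshelve. all: by end_near. Qed.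

End Step.

(** The induction carries monotonicity and continuity from above together, because measurability of
    the section volumes in dimension n+1 needs both in dimension n. Continuity from above is
    dominated convergence; the third property makes the dominating section volumes integrable. *)
Lemma volume_compact n :
  [/\ forall A B : set 'rV[R]_n, compact A -> compact B ->
        A `<=` B -> (volume A <= volume B)%E,
      forall A : nat -> set 'rV[R]_n,
        (forall k, compact (A k)) -> (forall k, A k.+1 `<=` A k) ->
        volume (A k) @[k --> \oo] --> volume (\bigcap_k A k) &
      forall (A : set 'rV[R]_n) (r : R), compact A -> 0 <= r ->
        (forall x, A x -> forall i, `|x 0 i| <= r) ->
        (volume A <= ((2 * r) ^+ n)%:E)%E].
Proof.
elim: n => [|n [IHle IHcvg IHb]].
  split=> [A B _ _ AB|A _ ndA|A r _ r0 _] /=.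
  - rewrite lee_fin !indicE ler_nat.
    case: (boolP (0 \in A)) => //; rewrite inE => /AB; rewrite -inE => ->//.
  - have [A0|A0] := pselect (forall k, A k 0).
      apply: cvg_near_cst; exists 0 => // k _ /=.
      by rewrite !indicE !mem_set.
    have /existsNP[k nAk] := A0.
    apply: cvg_near_cst; exists k => // m /= km.
    congr EFin; rewrite !indicE !memNset//; first by move=> /(_ k I).
    move=> Am; apply: nAk; move: km Am => /subnK <-.
    elim: (m - k)%N => //= i IH; rewrite addSn => /ndA /IH; apply.
  - by rewrite expr0 lee_fin indicE; case: (_ \in _).
have mS A := @measurable_volume_slice_step n IHle IHcvg A.
have bound (A : set 'rV[R]_n.+1) (r : R) : compact A -> 0 <= r ->
    (forall x, A x -> forall i, `|x 0 i| <= r) ->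
    (volume A <= ((2 * r) ^+ n.+1)%:E)%E.
  move=> cA r0 Ar; rewrite volumeS.
  have c0 : 0 <= (2 * r) ^+ n by rewrite exprn_ge0// mulr_ge0.
  pose D : set (measurableTypeR R) := `[- r, r]%classic.
  rewrite [leLHS](_ : _ = (\int[mu]_(x in D) volume (slice A x))%E); last first.
    rewrite [RHS]integral_mkcond; apply: eq_integral => x _.
    rewrite patchE; case: ifPn => // /negP xr.
    rewrite (slice_out Ar) ?volume0// => xr'; apply: xr.
    by rewrite /D inE /= in_itv /= xr'.
  have mD : measurable D by exact: measurable_itv.
  apply: le_trans (@ge0_le_integral _ _ _ mu D _ _
     (cst ((2 * r) ^+ n)%:E) _ _ _ _) _ => //.
  + by move=> x _; exact: volume_ge0.
  + by apply: measurable_funS (mS _ cA).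
  + move=> x _; apply: IHb => //; first exact: compact_slice.
    by move=> y Ay i; rewrite -(sconsS x); exact: Ar.
  + rewrite integral_cst//= lebesgue_measure_itv /= lte_fin.
    case: ifPn => rr; last by rewrite mule0 lee_fin exprn_ge0// mulr_ge0.
    by rewrite -EFinB -EFinM lee_fin exprSr opprK -mulr2n mulr_natl.
split.
- move=> A B cA cB AB; rewrite !volumeS; apply: ge0_le_integral => //.
  + by move=> x _; exact: volume_ge0.
  + exact: mS.
  + exact: mS.
  + move=> x _; apply: IHle; [exact: compact_slice..|by move=> y /AB].
- move=> A cA ndA; rewrite volumeS.
  have [M M0 AM] : exists2 r : R, 0 <= r & forall x, A 0 x -> forall i, `|x 0 i| <= r.
    by case/compact_rowP: (cA 0).
  have AA0 k : A k `<=` A 0 by elim: k => // k IH x /ndA /IH.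
  have cap x : slice (\bigcap_k A k) x = \bigcap_k slice (A k) x by [].
  have [| | |_ _ //] := @dominated_convergence _ _ _ mu setT measurableT
    (fun k x => volume (slice (A k) x)) (fun x => volume (slice (\bigcap_k A k) x))
    (fun x => volume (slice (A 0) x)) (fun k => mS _ (cA k)) (mS _ (bigcap_compact cA)).
  + apply: aeW => x _; rewrite cap; apply: IHcvg => [k|k y].
      exact: compact_slice.
    exact: ndA.
  + apply/integrableP; split; first exact: mS.
    under eq_integral do rewrite gee0_abs ?volume_ge0//.
    by apply: le_lt_trans (bound _ _ (cA 0) M0 AM) _; rewrite ltry.
  + apply: aeW => x k _; rewrite gee0_abs ?volume_ge0//.
    by apply: IHle; [exact: compact_slice..|move=> y /AA0].
- exact: bound.
Qed.
End Volume.

(** * Volume of compact sets *)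

Section CompactVolume.
Variable R : realType.
Local Notation mu := (@lebesgue_measure R).
Implicit Types n : nat.

Definition vol n (A : set 'rV[R]_n) : R := fine (volume A).

Definition nonincr n (A : nat -> set 'rV[R]_n) := forall k, A k.+1 `<=` A k.

Lemma vol_ge0 n (A : set 'rV[R]_n) : 0 <= vol A.
Proof. exact/fine_ge0/volume_ge0. Qed.

Lemma vol0 n : vol (set0 : set 'rV[R]_n) = 0.
Proof. by rewrite /vol volume0. Qed.

Lemma volE n (A : set 'rV[R]_n) : compact A -> volume A = (vol A)%:E.
Proof.
move=> cA; have [_ [r r0 Ar]] := (compact_rowP A).1 cA.
have [_ _ /(_ A r cA r0 Ar) le] := @volume_compact R n.
rewrite /vol fineK// fin_numE; apply/andP; split.
  by rewrite gt_eqF// (lt_le_trans _ (volume_ge0 A))// ltNyr.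
by rewrite lt_eqF// (le_lt_trans le)// ltry.
Qed.

Lemma vol_bound n (A : set 'rV[R]_n) (r : R) : compact A -> 0 <= r ->
  (forall x, A x -> forall i, `|x 0 i| <= r) -> vol A <= (2 * r) ^+ n.
Proof.
move=> cA r0 Ar; rewrite -lee_fin -volE//.
by have [_ _] := @volume_compact R n; apply.
Qed.

Lemma vol_le n (A B : set 'rV[R]_n) : compact A -> compact B -> A `<=` B ->
  vol A <= vol B.
Proof.
move=> cA cB AB; rewrite -lee_fin -!volE//.
by have [+ _ _] := @volume_compact R n; apply.
Qed.

Lemma vol_cvg n (A : nat -> set 'rV[R]_n) : (forall k, compact (A k)) ->
  nonincr A -> vol (A k) @[k --> \oo] --> vol (\bigcap_k A k).
Proof.
move=> cA ndA; have [_ /(_ A cA ndA) H _] := @volume_compact R n.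
rewrite (volE (bigcap_compact cA)) in H.
exact: (fine_cvg H).
Qed.

Lemma measurable_volume_slice n (A : set 'rV[R]_n.+1) : compact A ->
  measurable_fun setT ((fun x => volume (slice A x)) : R -> \bar R).
Proof.
by have [le cvg _] := @volume_compact R n; exact: measurable_volume_slice_step.
Qed.

Lemma compactU_row n (A B : set 'rV[R]_n) :
  compact A -> compact B -> compact (A `|` B).
Proof. exact: compactU. Qed.

Lemma volume_modular n (A B : set 'rV[R]_n) : compact A -> compact B ->
  (volume A + volume B = volume (A `|` B) + volume (A `&` B))%E.
Proof.
elim: n A B => [A B _ _|n IH A B cA cB].
  rewrite /= -!EFinD; congr EFin; rewrite !indicE in_setU in_setI.
  by do 2 case: (_ \in _) => /=; rewrite ?addr0 ?add0r.
have cU := compactU_row cA cB; have cI := compactI cA cB.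
rewrite !volumeS.
rewrite -ge0_integralD//; [|by move=> *; exact: volume_ge0|exact: measurable_volume_slice
  |by move=> *; exact: volume_ge0|exact: measurable_volume_slice].
rewrite -ge0_integralD//; [|by move=> *; exact: volume_ge0|exact: measurable_volume_slice
  |by move=> *; exact: volume_ge0|exact: measurable_volume_slice].
apply: eq_integral => x _.
exact: (IH _ _ (@compact_slice _ _ _ x cA) (@compact_slice _ _ _ x cB)).
Qed.

Lemma vol_modular n (A B : set 'rV[R]_n) : compact A -> compact B ->
  vol A + vol B = vol (A `|` B) + vol (A `&` B).
Proof.
move=> cA cB; have := volume_modular cA cB.
by rewrite !volE//; [rewrite -!EFinD => -[]|exact: compactI|exact: compactU_row].
Qed.

(** The pushforward of Lebesgue measure under a translation is compared with it on half-open
    intervals; uniqueness does the rest. *)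
Lemma ge0_integral_shift (f : R -> \bar R) (c : R) : measurable_fun setT f ->
  (forall x, 0 <= f x)%E -> (\int[mu]_x f (x - c)%R = \int[mu]_x f x)%E.
Proof.
move=> mf f0.
pose phi : measurableTypeR R -> measurableTypeR R := fun x => x - c.
have mphi : measurable_fun setT phi.
  by apply: continuous_measurable_fun => x; apply: cvgB; [exact: cvg_id|exact: cvg_cst].
have := @ge0_integral_pushforward _ _ _ _ _ phi mphi mu setT f measurableT mf.
rewrite preimage_setT => <-; last by move=> y _; exact: f0.
apply: eq_measure_integral => A mA _; apply/esym.
apply: lebesgue_measure_unique mA => _ [[a b]] _ <-.
transitivity (mu (phi @^-1` `]a, b]%classic)) => //.
rewrite (_ : phi @^-1` _ = `]a + c, b + c]%classic); last first.
  by apply/seteqP; split => x; rewrite /= !in_itv /= /phi ltrBrDr lerBlDr.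
rewrite /= !lebesgue_measure_itv/= !lte_fin ltrD2r -!EFinB.
by case: ifP => // _; congr EFin; ring.
Qed.

Lemma rowD n (x y : 'rV[R]_n) i : (x + y) 0 i = x 0 i + y 0 i.
Proof. by rewrite mxE. Qed.

Lemma rowN n (x : 'rV[R]_n) i : (- x) 0 i = - x 0 i.
Proof. by rewrite mxE. Qed.

Lemma rowB n (x y : 'rV[R]_n) i : (x - y) 0 i = x 0 i - y 0 i.
Proof. by rewrite rowD rowN. Qed.

Lemma rowZ n c (x : 'rV[R]_n) i : (c *: x) 0 i = c * x 0 i.
Proof. by rewrite mxE. Qed.

Lemma sbeheadE n (z : 'rV[R]_n.+1) i : sbehead z 0 i = z 0 (lift ord0 i).
Proof. by rewrite mxE. Qed.

Definition shift n (a : 'rV[R]_n) (A : set 'rV[R]_n) : set 'rV[R]_n :=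
  [set x | A (x - a)].

Lemma slice_shift n a (A : set 'rV[R]_n.+1) x :
  slice (shift a A) x = shift (sbehead a) (slice A (x - a 0 ord0)).
Proof.
apply/funext => y; rewrite /slice /shift /=; congr (A _).
apply/rowP => i; case: (unliftP ord0 i) => [j ->|->].
  by rewrite rowB !sconsS rowB sbeheadE.
by rewrite rowB !scons0.
Qed.

Lemma shift_image n a (A : set 'rV[R]_n) : shift a A = [set x + a | x in A].
Proof.
apply/seteqP; split => [x Ax|_ [x Ax <-]]; last by rewrite /shift /= addrK.
by exists (x - a) => //; rewrite subrK.
Qed.

Lemma addr_continuous n (a : 'rV[R]_n) : continuous (fun x : 'rV[R]_n => x + a).
Proof.
apply: mx_continuous => i j; under eq_fun do rewrite mxE.
have c1 : continuous (fun x : 'rV[R]_n => x i j : R) by exact: coord_continuous.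
by move=> x; exact: (cvgD (c1 x) (cvg_cst (a i j))).
Qed.

Lemma compact_shift n a (A : set 'rV[R]_n) : compact A -> compact (shift a A).
Proof. by move=> cA; rewrite shift_image; apply: compact_image cA; exact: addr_continuous. Qed.

Lemma volume_shift n a (A : set 'rV[R]_n) : compact A ->
  volume (shift a A) = volume A.
Proof.
elim: n a A => [a A _|n IH a A cA].
  by rewrite /= !indicE /shift; congr ((_ _)%:R%:E); congr (_ \in _); apply/funext => x; rewrite /=; congr (A _); rewrite [LHS]thinmx0 [RHS]thinmx0.
rewrite !volumeS.
rewrite (eq_integral (fun x : measurableTypeR R => volume (slice A ((x : R) - a 0 ord0)))); last first.
  by move=> x _; rewrite slice_shift IH//; exact: compact_slice.
rewrite (ge0_integral_shift (f := fun x => volume (slice A x)))//.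
  exact: measurable_volume_slice.
by move=> x; exact: volume_ge0.
Qed.

Lemma vol_shift n a (A : set 'rV[R]_n) : compact A -> vol (shift a A) = vol A.
Proof. by move=> cA; rewrite /vol volume_shift. Qed.

Definition cube n (s : R) : set 'rV[R]_n := [set x | forall i, 0 <= x 0 i <= s].

Lemma compact_cube n s : compact (@cube n s).
Proof.
have [s0|s0] := leP 0 s; last first.
  case: n => [|n]; last first.
    rewrite (_ : cube s = set0); first exact: compact0.
    rewrite -subset0 => x /(_ ord0) /andP[a /(le_trans a)].
    by rewrite leNgt s0.
  apply/compact_rowP; split; last by exists 0 => // x _ [].
  rewrite (_ : cube s = setT); first exact: closedT.
  by apply/seteqP; split => // x _ [].
have := @rV_compact R n (fun=> `[0, s]%classic) (fun=> @segment_compact R 0 s).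
congr compact; apply/funext => x /=.
Qed.

Lemma volume_cube n s : 0 <= s -> volume (@cube n s) = (s ^+ n)%:E.
Proof.
move=> s0; elim: n => [|n IH].
  by rewrite /= indicE mem_set//= => -[].
pose D : set (measurableTypeR R) := `[0, s]%classic.
have mD : measurable D by exact: measurable_itv.
rewrite volumeS (eq_integral (fun x => (s ^+ n)%:E * (\1_D x)%:E)%E); last first.
  move=> x _; rewrite indicE; case: (boolP (x \in D)) => [|/negP] xD.
    rewrite mule1 -IH; congr volume.
    move: xD; rewrite inE /D /= in_itv /= => xD.
    apply/seteqP; split=> y H.
      by move=> i; have := H (lift ord0 i); rewrite sconsS.
    move=> i; case: (unliftP ord0 i) => [j ->|->]; rewrite ?sconsS ?scons0//.
  rewrite /= mule0 (_ : slice _ x = set0) ?volume0// -subset0 => y /(_ ord0).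
  by rewrite scons0 => x0s; apply: xD; rewrite inE /D /= in_itv.
have h1 x : setT x -> (0 <= (\1_D x : R)%:E)%E by rewrite lee_fin.
have h2 : measurable_fun setT (fun x => (\1_D x : R)%:E).
  by apply/measurable_EFinP; exact: measurable_indic.
rewrite (ge0_integralZl_EFin mu measurableT h1 h2) ?exprn_ge0//.
rewrite integral_indic//.
rewrite setIT.
transitivity ((s ^+ n)%:E * mu (`[0%R, s]%classic : set R))%E => //.
rewrite lebesgue_measure_itv /= lte_fin.
by case: ltP => [_|/(conj s0)/andP/le_anti <-]; rewrite ?subr0 -?EFinB -?EFinM ?subr0 exprSr ?mulr0 ?mule0.
Qed.

Lemma vol_cube n s : 0 <= s -> vol (@cube n s) = s ^+ n.
Proof. by move=> s0; rewrite /vol volume_cube. Qed.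

End CompactVolume.

(** * Translation-invariant contents *)

Section Contents.
Variable R : realType.
Implicit Types n : nat.

(** The properties of volume on compact sets that determine it up to a factor, as [content_vol]
    shows. The instance of interest is the volume of the image under an invertible matrix. *)
Record content n (phi : set 'rV[R]_n -> R) : Prop := Content {
  content_ge0 : forall A, 0 <= phi A;
  content0 : phi set0 = 0;
  content_le : forall A B, compact A -> compact B -> A `<=` B -> phi A <= phi B;
  content_modular : forall A B, compact A -> compact B ->
    phi A + phi B = phi (A `|` B) + phi (A `&` B);
  content_shift : forall a A, compact A -> phi (shift a A) = phi A;
  content_cvg : forall A : nat -> set 'rV[R]_n, (forall k, compact (A k)) ->
    nonincr A -> phi (A k) @[k --> \oo] --> phi (\bigcap_k A k) }.

Lemma vol_content n : content (@vol R n).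
Proof.
split; [exact: vol_ge0|exact: vol0|exact: vol_le|exact: vol_modular|
  exact: vol_shift|exact: vol_cvg].
Qed.

(** Thickening by a box rather than a ball: a grid cell of side [e] that meets [A] lies in
    [thicken A e]. *)
Definition thicken n (A : set 'rV[R]_n) (e : R) : set 'rV[R]_n :=
  [set x + y | x in A & y in [set y : 'rV[R]_n | forall i, - e <= y 0 i <= e]].

(** The corners have coordinates from -L/N to (L-1)/N, so the cells tile [-L/N, L/N]^n; subtracting
    [L] lets ordinals index both signs. *)
Definition cell n (N L : nat) (z : {ffun 'I_n -> 'I_(2 * L)}) : set 'rV[R]_n :=
  shift (\row_i (((z i)%:R - L%:R) / N%:R)) (cube N%:R^-1).

Lemma compact_add n (A B : set 'rV[R]_n) : compact A -> compact B ->
  compact [set x + y | x in A & y in B].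
Proof.
move=> cA cB.
rewrite (_ : [set _ + _ | _ in _ & _ in _] =
    (fun p : 'rV[R]_n * 'rV[R]_n => p.1 + p.2) @` (A `*` B)); last first.
  apply/seteqP; split => [_ [x Ax [y By <-]]|_ [[x y] [/= Ax By] <-]].
    by exists (x, y).
  by exists x => //; exists y.
apply: compact_image; last exact: compact_setX.
apply: mx_continuous => i j; under eq_fun do rewrite mxE.
have c1 : continuous (fun p : 'rV[R]_n * 'rV[R]_n => p.1 i j : R).
  move=> p; apply: (@continuous_comp _ _ _ fst (fun x : 'rV[R]_n => x i j)).
    exact: cvg_fst.
  exact: coord_continuous.
have c2 : continuous (fun p : 'rV[R]_n * 'rV[R]_n => p.2 i j : R).
  move=> p; apply: (@continuous_comp _ _ _ snd (fun x : 'rV[R]_n => x i j)).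
    exact: cvg_snd.
  exact: coord_continuous.
by move=> p; exact: (cvgD (c1 p) (c2 p)).
Qed.

Lemma box_cube n e : [set y : 'rV[R]_n | forall i, - e <= y 0 i <= e] =
  shift (\row__ (- e)) (cube (2 * e)).
Proof.
apply/seteqP; split => y H i; have := H i;
  rewrite /= ?rowB mxE /= opprK => /andP[h1 h2]; apply/andP; split; lra.
Qed.

Lemma compact_thicken n (A : set 'rV[R]_n) e : compact A -> compact (thicken A e).
Proof.
move=> cA; apply: compact_add => //; rewrite box_cube.
by apply: compact_shift; exact: compact_cube.
Qed.

Lemma bigcap_thicken n (A : set 'rV[R]_n) : compact A ->
  \bigcap_k thicken A k.+1%:R^-1 = A.
Proof.
move=> cA; apply/seteqP; split => [x Ax|x Ax k _]; last first.
  exists x => //; exists 0; last by rewrite addr0.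
  by move=> i; rewrite mxE oppr_le0 invr_ge0 ler0n.
apply: (compact_row_closed cA) => B /nbhs_ballP[e /= e0 eB].
have [k kP] : exists k : nat, k.+1%:R^-1 < e.
  have [k _ /(_ k (leqnn k)) /= kP] := near_infty_natSinv_lt (PosNum e0).
  by exists k.
have [a Aa [y yP ay]] := Ax k I.
exists a; split => //; apply: eB; rewrite -ay; split => // i j.
rewrite (ord1 i) rowD /ball /= addrAC subrr add0r.
by apply: le_lt_trans kP; rewrite ler_norml.
Qed.

Lemma nonincr_thicken n (A : set 'rV[R]_n) :
  nonincr (fun k => thicken A k.+1%:R^-1).
Proof.
move=> k _ [x Ax [y yP <-]]; exists x => //; exists y => // i.
have := yP i.
have : (k.+2%:R^-1 : R) <= k.+1%:R^-1 by rewrite lef_pV2 ?posrE// ler_nat.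
move: (k.+2%:R^-1) (k.+1%:R^-1) => a b.
by move=> h /andP[h1 h2]; apply/andP; split; lra.
Qed.

Section OneContent.
Variables (n : nat) (phi : set 'rV[R]_n -> R).
Hypothesis cphi : content phi.

Lemma content_subadd A B : compact A -> compact B -> phi (A `|` B) <= phi A + phi B.
Proof. by move=> cA cB; rewrite (content_modular cphi)// lerDl (content_ge0 cphi). Qed.

(* Infinitely many disjoint translates of a compact piece of a hyperplane fit
   in a bounded set. *)
Lemma content_face (i : 'I_n) (c r : R) (F : set 'rV[R]_n) : compact F ->
  0 <= r -> (forall x, F x -> forall j, `|x 0 j| <= r) ->
  (forall x, F x -> x 0 i = c) -> phi F = 0.
Proof.
move=> cF r0 Fr Fc.
pose B : set 'rV[R]_n := [set y | forall j, - (r + 1) <= y 0 j <= r + 1].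
have BE : B = shift (\row__ (- (r + 1))) (cube (2 * (r + 1))) by exact: box_cube.
have cB : compact B by rewrite BE; apply: compact_shift; exact: compact_cube.
suff H (N : nat) : N%:R * phi F <= phi B.
  apply/le_anti; rewrite (content_ge0 cphi) andbT leNgt; apply/negP => F0.
  have := H (Num.truncn (phi B / phi F)).+1.
  rewrite -ler_pdivlMr// leNgt truncnS_gt//.
pose e : 'rV[R]_n := \row_j (j == i)%:R.
pose F' (k : nat) := shift ((k%:R / N%:R) *: e) F.
have cF' k : compact (F' k) by exact: compact_shift.
pose G (m : nat) := [set x | exists2 k : nat, (k < m)%N & F' k x].
have GS m : G m.+1 = F' m `|` G m.
  apply/seteqP; split => [x [k]|x [Fx|[k km Fk]]].
  - by rewrite ltnS leq_eqVlt => /orP[/eqP ->|km] Fk; [left|right; exists k].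
  - by exists m.
  - by exists k => //; rewrite ltnS ltnW.
have G0 : G 0 = set0 by rewrite -subset0 => x [].
have cG m : compact (G m).
  elim: m => [|m IH]; first by rewrite G0; exact: compact0.
  by rewrite GS; exact: compactU_row.
have F'i k x : F' k x -> x 0 i = c + k%:R / N%:R.
  by move=> /Fc; rewrite rowB rowZ mxE eqxx mulr1 => /eqP; rewrite subr_eq => /eqP.
have phiG m : (m <= N)%N -> phi (G m) = m%:R * phi F.
  elim: m => [|m IH mN]; first by rewrite G0 (content0 cphi) mul0r.
  have N0 : (0 < N%:R :> R) by rewrite ltr0n (leq_trans _ mN).
  have := content_modular cphi (cF' m) (cG m).
  rewrite -GS (_ : _ `&` _ = set0); last first.
    rewrite -subset0 => x [/F'i xm [k km /F'i]]; rewrite xm => /addrI.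
    move=> /(mulIf (invr_neq0 (lt0r_neq0 N0))) /eqP; rewrite eqr_nat => /eqP mk.
    by rewrite mk ltnn in km.
  rewrite (content0 cphi) addr0 => <-; rewrite IH 1?ltnW// (content_shift cphi)//.
  by rewrite -natr1 mulrDl mul1r addrC.
rewrite -phiG//; apply: (content_le cphi) => // x [k kN Fk] j.
have N0 : (0 < N%:R :> R) by rewrite ltr0n (leq_trans _ kN).
have := Fr _ Fk j; rewrite rowB rowZ mxE ler_norml.
have k0 : 0 <= k%:R / N%:R :> R by rewrite divr_ge0.
have k1 : k%:R / N%:R <= 1 :> R by rewrite ler_pdivrMr// mul1r ler_nat ltnW.
by case: (j == i) => /=; rewrite ?mulr1 ?mulr0 => /andP[h1 h2]; apply/andP; split; lra.
Qed.

Variables (N L : nat).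
Hypothesis N0 : (0 < N)%N.
Local Notation cell := (@cell n N L).

Lemma compact_cell z : compact (cell z).
Proof. by apply: compact_shift; exact: compact_cube. Qed.

Lemma cellP z x : cell z x <-> forall i,
  (z i)%:R - L%:R <= N%:R * x 0 i <= (z i)%:R - L%:R + 1.
Proof.
have N0' : 0 < N%:R :> R by rewrite ltr0n.
have Ni : N%:R * N%:R^-1 = 1 :> R by rewrite mulfV// gt_eqF.
have wN i : N%:R * (((z i)%:R - L%:R) / N%:R) = (z i)%:R - L%:R :> R.
  by rewrite mulrCA Ni mulr1.
split => H i; have := H i.
  rewrite rowB mxE => /andP[]; rewrite -(ler_pM2l N0') mulr0 mulrBr wN => h1.
  rewrite -(ler_pM2l N0') Ni mulrBr wN => h2.
  by apply/andP; split; lra.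
move=> /andP[h1 h2]; rewrite rowB mxE; apply/andP; split;
  rewrite -(ler_pM2l N0') ?mulr0 ?Ni mulrBr wN; lra.
Qed.

Lemma cell_bounded z x : cell z x -> forall i, `|x 0 i| <= (2 * L + 1)%:R.
Proof.
have N0' : 1 <= N%:R :> R by rewrite ler1n.
move=> /cellP zx i; have /andP[h1 h2] := zx i.
have zL : (z i)%:R <= (2 * L)%:R :> R by rewrite ler_nat ltnW.
have z0 : 0 <= (z i)%:R :> R by [].
have Nx : `|N%:R * x 0 i| <= (2 * L + 1)%:R.
  rewrite ler_norml natrD natrM; rewrite natrM in zL.
  have L0 : 0 <= L%:R :> R by [].
  by apply/andP; split; lra.
apply: le_trans Nx; rewrite normrM ger0_norm ?ler0n//.
by rewrite ler_peMl.
Qed.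

(** Cells whose indices differ in coordinate [i] can meet only in the hyperplane bounding the higher
    one from below, so [content_face] applies. *)
Lemma content_cellI z z' : z != z' -> phi (cell z `&` cell z') = 0.
Proof.
move=> zz'.
have cI : compact (cell z `&` cell z') by apply: compactI; exact: compact_cell.
have [i zi] : exists i, z i != z' i.
  apply/existsP; rewrite -[X in is_true X]negbK negb_exists; apply: contra zz'.
  by move=> /forallP H; apply/eqP/ffunP => i; have := H i; rewrite negbK => /eqP.
have N0' : 0 < N%:R :> R by rewrite ltr0n.
wlog lt : z z' zz' cI zi / (z i < z' i)%N.
  move=> H; have : (z i < z' i)%N || (z' i < z i)%N by rewrite -neq_ltn.
  move=> /orP[lt|lt]; first exact: H.
  by rewrite setIC; apply: H => //; rewrite 1?eq_sym// setIC.
apply: (@content_face i (((z' i)%:R - L%:R) / N%:R) (2 * L + 1)%:R) => //.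
  by move=> x [/cell_bounded].
move=> x [/cellP/(_ i)/andP[_ h1] /cellP/(_ i)/andP[h2 _]].
apply: (mulfI (lt0r_neq0 N0')); rewrite mulrCA mulfV ?gt_eqF// mulr1.
apply/le_anti; rewrite h2 andbT; apply: (le_trans h1).
have : (z i)%:R + 1 <= (z' i)%:R :> R by rewrite natr1 ler_nat.
by move=> h; lra.
Qed.

Definition cells (s : seq {ffun 'I_n -> 'I_(2 * L)}) : set 'rV[R]_n :=
  [set x | exists2 z, z \in s & cell z x].

Lemma cells_cons z s : cells (z :: s) = cell z `|` cells s.
Proof.
apply/seteqP; split => [x [y]|x [zx|[y ys yx]]].
- by rewrite inE => /orP[/eqP ->|ys] yx; [left|right; exists y].
- by exists z => //; rewrite inE eqxx.
- by exists y => //; rewrite inE ys orbT.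
Qed.

Lemma cells_nil : cells [::] = set0.
Proof. by rewrite -subset0 => x []. Qed.

Lemma compact_cells s : compact (cells s).
Proof.
elim: s => [|z s IH]; first by rewrite cells_nil; exact: compact0.
by rewrite cells_cons; apply: compactU_row => //; exact: compact_cell.
Qed.

Lemma content_cells s : uniq s -> phi (cells s) = (size s)%:R * phi (cube N%:R^-1).
Proof.
elim: s => [|z s IH] /=; first by rewrite cells_nil (content0 cphi) mul0r.
move=> /andP[zs us].
have cz : compact (cell z) by exact: compact_cell.
have cs : compact (cells s) by exact: compact_cells.
have := content_modular cphi cz cs; rewrite -cells_cons.
rewrite (content_shift cphi); last exact: compact_cube.
rewrite IH// (_ : phi (cell z `&` cells s) = 0).
  by rewrite addr0 => <-; rewrite -natr1 mulrDl mul1r addrC.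
move: zs {us IH cs}; elim: s => [_|y s IH].
  by rewrite cells_nil setI0 (content0 cphi).
rewrite inE negb_or => /andP[zy zs]; rewrite cells_cons setIUr.
have c1 : compact (cell z `&` cell y) by apply: compactI => //; exact: compact_cell.
have c2 : compact (cell z `&` cells s) by apply: compactI => //; exact: compact_cells.
apply/le_anti; rewrite (content_ge0 cphi) andbT.
apply: le_trans (content_subadd c1 c2) _.
by rewrite IH// content_cellI// addr0.
Qed.

End OneContent.

Section TwoContents.
Variables (n : nat) (phi psi : set 'rV[R]_n -> R).
Hypotheses (cphi : content phi) (cpsi : content psi).

(** Count the cells that meet [A]: they cover [A] and lie in its thickening. Eliminating the count
    compares the two contents. *)
Lemma content_grid (A : set 'rV[R]_n) (k : nat) : compact A ->
  phi A * psi (cube k.+1%:R^-1) <= psi (thicken A k.+1%:R^-1) * phi (cube k.+1%:R^-1).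
Proof.
move=> cA; have [_ [r r0 Ar]] := (compact_rowP A).1 cA.
pose N := k.+1; pose L := (Num.truncn (N%:R * r)).+1.
have NrL : N%:R * r < L%:R by rewrite truncnS_gt.
have N0 : 0 < N%:R :> R by rewrite ltr0n.
pose s := [seq z <- enum {ffun 'I_n -> 'I_(2 * L)} |
  `[< exists2 x, A x & @cell n N L z x >] ].
have us : uniq s by rewrite filter_uniq// enum_uniq.
have As : A `<=` @cells n N L s.
  move=> x Ax.
  have b i : - L%:R < N%:R * x 0 i < L%:R.
    rewrite -ltr_norml; apply: le_lt_trans NrL.
    by rewrite normrM gtr0_norm// ler_pM2l// Ar.
  have bL i : (Num.truncn (N%:R * x ord0 i + L%:R)%R < 2 * L)%N.
    have /andP[b1 b2] := b i.
    have t0 : 0 <= N%:R * x 0 i + L%:R by lra.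
    rewrite -(ltr_nat R); have /andP[h _] := truncn_itv t0; apply: (le_lt_trans h).
    by rewrite natrM; lra.
  pose z := [ffun i => Ordinal (bL i)].
  have zx : @cell n N L z x.
    apply/cellP => // i; rewrite ffunE /=.
    have /andP[b1 b2] := b i.
    have t0 : 0 <= N%:R * x 0 i + L%:R by lra.
    have := truncn_itv t0; rewrite -natr1 => /andP[h1 h2]; apply/andP; split; lra.
  exists z => //; rewrite mem_filter mem_enum andbT; apply/asboolP.
  by exists x.
have sA : @cells n N L s `<=` thicken A N%:R^-1.
  move=> y [z]; rewrite mem_filter => /andP[/asboolP[x Ax xz] _] yz.
  exists x => //; exists (y - x); last by rewrite addrC subrK.
  move=> i; rewrite rowB.
  have N1 : (0 < N)%N by [].
  have /(cellP N1)/(_ i)/andP[h1 h2] := xz; have /(cellP N1)/(_ i)/andP[h3 h4] := yz.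
  have Ni : N%:R * N%:R^-1 = 1 :> R by rewrite mulfV// gt_eqF.
  apply/andP; split; rewrite -(ler_pM2l N0) ?mulrN mulrBr Ni; lra.
have cs : compact (@cells n N L s) by exact: compact_cells.
have ct : compact (thicken A N%:R^-1) by exact: compact_thicken.
have h1 : phi A <= (size s)%:R * phi (cube N%:R^-1).
  by rewrite -(content_cells cphi (N := N) (L := L))//; exact: (content_le cphi).
have h2 : (size s)%:R * psi (cube N%:R^-1) <= psi (thicken A N%:R^-1).
  by rewrite -(content_cells cpsi (N := N) (L := L))//; exact: (content_le cpsi).
apply: le_trans (ler_wpM2r (content_ge0 cpsi _) h1) _.
by rewrite mulrAC ler_wpM2r// (content_ge0 cphi).
Qed.

End TwoContents.

(* The comparison on a fine grid of cubes determines the ratio to the volume. *)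
Lemma content_vol n (phi : set 'rV[R]_n -> R) A : content phi -> compact A ->
  phi A = phi (cube 1) * vol A.
Proof.
move=> cphi cA; have cpsi := @vol_content n.
have cQ := @compact_cube R n 1.
pose Ak k := thicken A k.+1%:R^-1; pose Qk k := thicken (@cube R n 1) k.+1%:R^-1.
pose c k := @cube R n k.+1%:R^-1.
have vQ : vol (@cube R n 1) = 1 by rewrite vol_cube// expr1n.
have cvg (psi : set 'rV[R]_n -> R) (B : set 'rV[R]_n) : content psi -> compact B ->
    psi (thicken B k.+1%:R^-1) @[k --> \oo] --> (psi B : R).
  move=> H cB; have := content_cvg H (fun k => @compact_thicken _ B k.+1%:R^-1 cB)
    (@nonincr_thicken _ B).
  by rewrite bigcap_thicken.
have vc k : 0 < vol (c k) by rewrite vol_cube ?invr_ge0// exprn_gt0// invr_gt0.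
apply/le_anti/andP; split.
- have C : vol (Ak k) * phi (Qk k) @[k --> \oo] --> vol A * phi (cube 1).
    by apply: cvgM; exact: cvg.
  rewrite mulrC -(cvg_lim (@Rhausdorff R) C); apply: limr_ge; first by apply: cvgP C.
  apply: nearW => k.
  (* The grid inequality for [A] is chained with the one for the unit cube, with the contents
     exchanged; the positive volume of a cell then cancels. *)
  have h1 := content_grid cphi cpsi k cA.
  have h2 := content_grid cpsi cphi k cQ; rewrite vQ mul1r in h2.
  rewrite -(ler_pM2r (vc k)); apply: (le_trans h1).
  by rewrite -mulrA ler_wpM2l ?vol_ge0.
- have C : vol (Qk k) * phi (Ak k) @[k --> \oo] --> vol (@cube R n 1) * phi A.
    by apply: cvgM; exact: cvg.
  have -> : phi A = vol (@cube R n 1) * phi A by rewrite vQ mul1r.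
  rewrite -(cvg_lim (@Rhausdorff R) C).
  apply: limr_ge; first by apply: cvgP C.
  apply: nearW => k.
  have h1 := content_grid cpsi cphi k cA.
  have h2 := content_grid cphi cpsi k cQ.
  rewrite -(ler_pM2r (vc k)) mulrAC.
  apply: le_trans (ler_wpM2r (vol_ge0 _) h2) _.
  by rewrite -!mulrA ler_wpM2l ?vol_ge0// mulrC.
Qed.

End Contents.

(** * Euclidean geometry *)

Section Euclid.
Variable R : realType.
Implicit Types n : nat.

Lemma dotC n (x y : 'rV[R]_n) : dot x y = dot y x.
Proof. by apply: eq_bigr => i _; rewrite mulrC. Qed.

Lemma dotDl n (x y z : 'rV[R]_n) : dot (x + y) z = dot x z + dot y z.
Proof. by rewrite -big_split; apply: eq_bigr => i _; rewrite rowD mulrDl. Qed.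

Lemma dotZl n c (x z : 'rV[R]_n) : dot (c *: x) z = c * dot x z.
Proof. by rewrite mulr_sumr; apply: eq_bigr => i _; rewrite rowZ mulrA. Qed.

Lemma dotDr n (x y z : 'rV[R]_n) : dot z (x + y) = dot z x + dot z y.
Proof. by rewrite ![dot z _]dotC dotDl. Qed.

Lemma dotZr n c (x z : 'rV[R]_n) : dot z (c *: x) = c * dot z x.
Proof. by rewrite ![dot z _]dotC dotZl. Qed.

Lemma dotNl n (x z : 'rV[R]_n) : dot (- x) z = - dot x z.
Proof. by rewrite -scaleN1r dotZl mulN1r. Qed.

Lemma dotNr n (x z : 'rV[R]_n) : dot z (- x) = - dot z x.
Proof. by rewrite ![dot z _]dotC dotNl. Qed.

Lemma dot0l n (z : 'rV[R]_n) : dot 0 z = 0.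
Proof. by rewrite -(scale0r (0 : 'rV[R]_n)) dotZl mul0r. Qed.

Lemma dot0r n (z : 'rV[R]_n) : dot z 0 = 0.
Proof. by rewrite dotC dot0l. Qed.

Lemma dot_ge0 n (x : 'rV[R]_n) : 0 <= dot x x.
Proof. by apply: sumr_ge0 => i _; rewrite -expr2 sqr_ge0. Qed.

Lemma coord_dot n (x : 'rV[R]_n) i : x 0 i ^+ 2 <= dot x x.
Proof.
rewrite /dot (bigD1 i)//= -expr2 lerDl; apply: sumr_ge0 => j _.
by rewrite -expr2 sqr_ge0.
Qed.

Lemma dot_eq0 n (x : 'rV[R]_n) : (dot x x == 0) = (x == 0).
Proof.
apply/eqP/eqP => [x0|->]; last by rewrite dot0l.
apply/rowP => i; rewrite mxE; apply/eqP; rewrite -sqrf_eq0 eq_le sqr_ge0 andbT.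
by rewrite -x0 coord_dot.
Qed.

Lemma dot_gt0 n (x : 'rV[R]_n) : (0 < dot x x) = (x != 0).
Proof. by rewrite lt0r dot_ge0 andbT dot_eq0. Qed.

Lemma sum_continuous (T : topologicalType) n (f : 'I_n -> T -> R) :
  (forall i, continuous (f i)) -> continuous (fun x => \sum_(i < n) f i x).
Proof.
move=> cf; elim: (index_enum _) => [|i s IH].
  by under eq_fun do rewrite big_nil; exact: cst_continuous.
under eq_fun do rewrite big_cons.
by move=> x; exact: (cvgD (cf i x) (IH x)).
Qed.

Lemma dot_continuous n (w : 'rV[R]_n) : continuous (fun x => dot w x).
Proof.
apply: sum_continuous => i x.
exact: (cvgM (cvg_cst (w 0 i)) (@coord_cts _ _ i x)).
Qed.

Lemma dotxx_continuous n : continuous (fun x : 'rV[R]_n => dot x x).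
Proof.
apply: sum_continuous => i x.
exact: (cvgM (@coord_cts _ _ i x) (@coord_cts _ _ i x)).
Qed.

Lemma compact_unit_ball n : compact (@unit_ball R n).
Proof.
apply/compact_rowP; split.
  have clI : closed [set y : R | y <= 1] by exact: closed_le.
  exact: preimage_closedT (@dotxx_continuous n) clI.
exists 1 => // x; rewrite /unit_ball /= => x1 i.
by rewrite -(@expr_le1 _ 2)// real_normK ?num_real// (le_trans (coord_dot _ i)).
Qed.

Lemma scaler_continuous n (s : R) : continuous (fun x : 'rV[R]_n => s *: x).
Proof.
apply: mx_continuous => i j; under eq_fun do rewrite mxE.
have c1 : continuous (fun x : 'rV[R]_n => x i j : R) by exact: coord_continuous.
by move=> x; exact: (cvgM (cvg_cst s) (c1 x)).
Qed.

Lemma compact_scale n (s : R) (A : set 'rV[R]_n) : compact A ->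
  compact [set s *: x | x in A].
Proof. by apply: compact_image; exact: scaler_continuous. Qed.

Lemma parallel_bodyE n (K : set 'rV[R]_n) eps :
  parallel_body K eps = [set x + y | x in K & y in [set eps *: b | b in @unit_ball R n]].
Proof.
apply/seteqP; split => [_ [x Kx [b Bb <-]]|_ [x Kx [_ [b Bb <-] <-]]].
  by exists x => //; exists (eps *: b) => //; exists b.
by exists x => //; exists b.
Qed.

Lemma kappaE n : kappa R n = vol (@unit_ball R n).
Proof. by []. Qed.

Lemma kappa_gt0 n : 0 < kappa R n.
Proof.
rewrite kappaE; pose s : R := n.+1%:R^-1.
have s0 : 0 < s by rewrite invr_gt0.
apply: (@lt_le_trans _ _ (vol (@cube R n s))).
  by rewrite vol_cube ?exprn_gt0// ltW.
apply: vol_le; [exact: compact_cube|exact: compact_unit_ball|move=> x xs].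
rewrite /unit_ball /=.
have : dot x x <= \sum_(i < n) s.
  apply: ler_sum => i _; have /andP[h1 h2] := xs i.
  rewrite -[leRHS]mulr1; apply: ler_pM => //.
  by rewrite (le_trans h2)// invf_le1// ler1n.
move=> /le_trans -> //; rewrite sumr_const card_ord -mulr_natl.
by rewrite ler_pdivrMr// mul1r ler_nat.
Qed.

(** * Linear images, scaling and isometries *)

Definition lin_image n (M : 'M[R]_n) (A : set 'rV[R]_n) := [set x *m M | x in A].

Lemma mulmx_continuous n (M : 'M[R]_n) : continuous (fun x : 'rV[R]_n => x *m M).
Proof.
apply: mx_continuous => i j; under eq_fun do rewrite mxE.
apply: sum_continuous => k.
have c1 : continuous (fun x : 'rV[R]_n => x i k : R) by exact: coord_continuous.
by move=> x; exact: (cvgM (c1 x) (cvg_cst (M k j))).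
Qed.

Lemma compact_lin_image n (M : 'M[R]_n) A : compact A -> compact (lin_image M A).
Proof. by apply: compact_image; exact: mulmx_continuous. Qed.

(** Invertibility makes images commute with intersections, as modularity and continuity from above
    require. *)
Lemma lin_image_content n (M : 'M[R]_n) : M \in unitmx ->
  content (fun A => vol (lin_image M A)).
Proof.
move=> uM.
have inj (x y : 'rV[R]_n) : x *m M = y *m M -> x = y.
  by move=> /(congr1 (mulmx^~ (invmx M))); rewrite /= !mulmxK.
have linI (A B : set 'rV[R]_n) : lin_image M (A `&` B) = lin_image M A `&` lin_image M B.
  apply/seteqP; split => [_ [x [Ax Bx] <-]|_ [[x Ax <-] [y By /inj yx]]].
    by split; exists x.
  by exists x => //; split=> //; rewrite -yx.
split => [A||A B cA cB AB|A B cA cB|a A cA|A cA ndA].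
- exact: vol_ge0.
- by rewrite /lin_image image_set0 vol0.
- apply: vol_le; [exact: compact_lin_image..|].
  by move=> _ [x /AB Bx <-]; exists x.
- rewrite vol_modular; [|exact: compact_lin_image..].
  by rewrite -linI /lin_image image_setU.
- rewrite -(vol_shift (a *m M) (@compact_lin_image n M A cA)); congr vol.
  rewrite !shift_image; apply/seteqP; split.
    move=> _ [_ [x Ax <-] <-]; exists (x *m M); first by exists x.
    by rewrite mulmxDl.
  move=> _ [_ [x Ax <-] <-]; exists (x + a); first by exists x.
  by rewrite mulmxDl.
- have -> : lin_image M (\bigcap_k A k) = \bigcap_k lin_image M (A k).
    apply/seteqP; split => [_ [x Ax <-] k _|y Ay]; first by exists x => //; exact: Ax.
    have [x Ax xy] := Ay 0 I; exists x => // k _.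
    by have [x' Ax' x'y] := Ay k I; rewrite (inj x x') // xy.
  apply: vol_cvg => [k|k]; first exact: compact_lin_image.
  by move=> _ [x /ndA Ax <-]; exists x.
Qed.

Lemma vol_scale n (s : R) (A : set 'rV[R]_n) : 0 < s -> compact A ->
  vol [set s *: x | x in A] = s ^+ n * vol A.
Proof.
move=> s0 cA.
have uM : (s%:M : 'M[R]_n) \in unitmx.
  by rewrite unitmxE det_scalar unitrX// unitfE gt_eqF.
have E (B : set 'rV[R]_n) : lin_image s%:M B = [set s *: x | x in B].
  by apply/seteqP; split => [_ [x Bx <-]|_ [x Bx <-]]; exists x => //; rewrite mul_mx_scalar.
have := content_vol (lin_image_content uM) cA; rewrite !E => ->; congr (_ * _).
rewrite -(vol_cube n (ltW s0)); congr vol; apply/seteqP; split.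
  move=> _ [x xQ <-] i; have := xQ i; rewrite rowZ => /andP[h1 h2].
  by rewrite mulr_ge0 ?(ltW s0)//= ler_piMr// ltW.
move=> x xs; exists (s^-1 *: x); last by rewrite scalerA mulfV ?gt_eqF// scale1r.
move=> i; have := xs i; rewrite rowZ => /andP[h1 h2].
by rewrite mulr_ge0 ?invr_ge0 ?(ltW s0)//= mulrC ler_pdivrMr// mul1r.
Qed.

Definition isometry n (M : 'M[R]_n) :=
  M \in unitmx /\ forall x y : 'rV[R]_n, dot (x *m M) (y *m M) = dot x y.

Lemma lin_image_unit_ball n (M : 'M[R]_n) : isometry M -> lin_image M (@unit_ball R n) = @unit_ball R n.
Proof.
move=> [uM iM]; apply/seteqP; split => [_ [x Bx <-]|x Bx].
  by rewrite /unit_ball /= iM.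
by exists (x *m invmx M); rewrite ?mulmxKV// /unit_ball /= -iM mulmxKV.
Qed.

(** By [content_vol] the volume of the image is a constant times the volume. The unit ball is fixed
    and has positive volume, so the constant is 1. *)
Lemma vol_isometry n (M : 'M[R]_n) A : isometry M -> compact A ->
  vol (lin_image M A) = vol A.
Proof.
move=> iM cA; have [uM _] := iM.
have c := content_vol (lin_image_content uM).
rewrite (c _ cA) -[RHS]mul1r; congr (_ * _).
have := c _ (@compact_unit_ball n); rewrite lin_image_unit_ball// -kappaE.
by move=> h; apply: (mulIf (lt0r_neq0 (kappa_gt0 n))); rewrite mul1r -h.
Qed.

Lemma parallel_lin_image n (M : 'M[R]_n) K eps : isometry M ->
  parallel_body (lin_image M K) eps = lin_image M (parallel_body K eps).
Proof.
move=> iM; have BM := lin_image_unit_ball iM; apply/seteqP; split.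
  move=> _ [_ [x Kx <-] [b Bb <-]].
  move: Bb; rewrite -BM => -[b' Bb' <-].
  exists (x + eps *: b'); first by exists x => //; exists b'.
  by rewrite mulmxDl scalemxAl.
move=> _ [_ [x Kx [b Bb <-]] <-]; exists (x *m M); first by exists x.
exists (b *m M); first by rewrite -BM; exists b.
by rewrite mulmxDl scalemxAl.
Qed.

Lemma parallel_shift n a (K : set 'rV[R]_n) eps :
  parallel_body (shift a K) eps = shift a (parallel_body K eps).
Proof.
apply/seteqP; split => [_ [x Kx [b Bb <-]]|x [y Ky [b Bb yb]]].
  by exists (x - a) => //; exists b => //; rewrite addrAC.
exists (y + a); first by rewrite /shift /= addrK.
by exists b => //; rewrite addrAC yb subrK.
Qed.

Lemma parallel_scale n (s : R) (K : set 'rV[R]_n) eps :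
  parallel_body [set s *: x | x in K] (s * eps) = [set s *: x | x in parallel_body K eps].
Proof.
apply/seteqP; split => [_ [_ [x Kx <-] [b Bb <-]]|_ [_ [x Kx [b Bb <-]] <-]].
  exists (x + eps *: b); first by exists x => //; exists b.
  by rewrite scalerDr scalerA.
exists (s *: x); first by exists x.
by exists b => //; rewrite scalerDr scalerA.
Qed.

(** The reflection in the hyperplane orthogonal to [w]. For [w = 0] it is the identity, so
    [householder_swap] also covers equal vectors. *)
Definition householder n (w : 'rV[R]_n) : 'M[R]_n := 1%:M - (2 / dot w w) *: (w^T *m w).

Lemma mul_householder n (w x : 'rV[R]_n) : x *m householder w = x - (2 * dot x w / dot w w) *: w.
Proof.
rewrite /householder mulmxBr mulmx1 -scalemxAr mulmxA; congr (_ - _).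
have -> : x *m w^T = (dot x w)%:M.
  apply/matrixP => i j; rewrite !ord1 mxE [RHS]mxE eqxx mulr1n.
  by apply: eq_bigr => k _; rewrite [in RHS]mulrC mxE mulrC.
by rewrite mul_scalar_mx scalerA mulrAC.
Qed.

Lemma householderK n (w x : 'rV[R]_n) : x *m householder w *m householder w = x.
Proof.
have [->|w0] := eqVneq w 0; first by rewrite !mul_householder !scaler0 !subr0.
rewrite !mul_householder dotDl dotNl dotZl -addrA -opprD -scalerDl -[RHS]subr0; congr (_ - _).
rewrite [X in X *: w](_ : _ = 0) ?scale0r//.
have : dot w w != 0 by rewrite dot_eq0.
by move=> h; field.
Qed.

Lemma isometry_householder n (w : 'rV[R]_n) : isometry (householder w).
Proof.
split.
  have HH : householder w *m householder w = 1%:M.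
    by apply/row_matrixP => i; rewrite rowE mulmxA householderK row1.
  by case/mulmx1_unit: HH.
move=> x y; have [->|w0] := eqVneq w 0; first by rewrite !mul_householder !scaler0 !subr0.
rewrite !mul_householder !(dotDl, dotDr, dotNl, dotNr, dotZl, dotZr) (dotC w y).
have : dot w w != 0 by rewrite dot_eq0.
by move=> h; field.
Qed.

Lemma householder_swap n (x y : 'rV[R]_n) : dot x x = dot y y -> x *m householder (x - y) = y.
Proof.
move=> xy; have [->|nxy] := eqVneq x y.
  by rewrite mul_householder subrr scaler0 subr0.
have h : dot (x - y) (x - y) != 0 by rewrite dot_eq0 subr_eq0.
have E : 2 * dot x (x - y) = dot (x - y) (x - y).
  rewrite !(dotDl, dotDr, dotNl, dotNr) -xy (dotC y x); ring.
by rewrite mul_householder E mulfV// scale1r opprB addrC subrK.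
Qed.

Lemma householder_adj n (w x y : 'rV[R]_n) : dot (x *m householder w) y = dot x (y *m householder w).
Proof.
rewrite !mul_householder !(dotDl, dotDr, dotNl, dotNr, dotZl, dotZr) (dotC w y).
by congr (_ - _); rewrite mulrAC [in RHS]mulrAC; congr (_ * _); ring.
Qed.

End Euclid.

(** * Convex bodies and sums with segments *)

Section Segments.
Variable R : realType.
Implicit Types n : nat.

Definition cvx n (K : set 'rV[R]_n) := forall x y (t : R), K x -> K y ->
  0 <= t <= 1 -> K ((1 - t) *: x + t *: y).

Definition convex_body n (K : set 'rV[R]_n) := compact K /\ cvx K.

(* K + [-t s, t s] *)
Definition add_segment n (K : set 'rV[R]_n) (s : 'rV[R]_n) (t : R) : set 'rV[R]_n :=
  [set x + r *: s | x in K & r in [set r : R | `|r| <= t]].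

Lemma cvx_add n (A B : set 'rV[R]_n) : cvx A -> cvx B ->
  cvx [set x + y | x in A & y in B].
Proof.
move=> cA cB _ _ t [x Ax [y By <-]] [x' Ax' [y' By' <-]] t01.
exists ((1 - t) *: x + t *: x'); first exact: cA.
exists ((1 - t) *: y + t *: y'); first exact: cB.
by rewrite !scalerDr addrACA.
Qed.

Lemma add_segmentE n (K : set 'rV[R]_n) s t :
  add_segment K s t = [set x + y | x in K & y in [set r *: s | r in [set r : R | `|r| <= t]]].
Proof.
apply/seteqP; split => [_ [x Kx [r rt <-]]|_ [x Kx [_ [r rt <-] <-]]].
  by exists x => //; exists (r *: s) => //; exists r.
by exists x => //; exists r.
Qed.

Lemma convex_body_add n (A B : set 'rV[R]_n) : convex_body A -> convex_body B ->
  convex_body [set x + y | x in A & y in B].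
Proof. by move=> [? ?] [? ?]; split; [exact: compact_add|exact: cvx_add]. Qed.

Lemma convex_body_segment n (s : 'rV[R]_n) t : convex_body [set r *: s | r in [set r : R | `|r| <= t]].
Proof.
split.
  apply: compact_image.
    apply: mx_continuous => i j; under eq_fun do rewrite mxE.
    by move=> x; exact: (cvgM (@cvg_id _ _) (cvg_cst (s i j))).
  have := @segment_compact R (- t) t; congr compact.
  by apply/funext => r /=; rewrite in_itv /= ler_norml.
move=> _ _ a [r /= rt <-] [r' /= rt' <-] /andP[a0 a1].
exists ((1 - a) * r + a * r'); last by apply/rowP => i; rewrite !mxE; ring.
move: rt rt'; rewrite /= !ler_norml => /andP[h1 h2] /andP[h3 h4].
by apply/andP; split; nra.
Qed.

Lemma convex_body_add_segment n (K : set 'rV[R]_n) s t : convex_body K -> convex_body (add_segment K s t).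
Proof. by move=> bK; rewrite add_segmentE; apply: convex_body_add => //; exact: convex_body_segment. Qed.

Lemma sub_add_segment n (K : set 'rV[R]_n) s t : 0 <= t -> K `<=` add_segment K s t.
Proof. by move=> t0 x Kx; exists x => //; exists 0; rewrite /= ?normr0// scale0r addr0. Qed.

Lemma add_segment_mono n (K L : set 'rV[R]_n) s t : K `<=` L -> add_segment K s t `<=` add_segment L s t.
Proof. by move=> KL _ [x /KL Lx [r rt <-]]; exists x => //; exists r. Qed.

Lemma add_segment_le n (K : set 'rV[R]_n) s t t' : t <= t' -> add_segment K s t `<=` add_segment K s t'.
Proof.
move=> tt' _ [x Kx [r /= rt <-]]; exists x => //; exists r => //=.
exact: le_trans rt tt'.
Qed.

Lemma add_segmentC n (K : set 'rV[R]_n) s t s' t' :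
  add_segment (add_segment K s t) s' t' = add_segment (add_segment K s' t') s t.
Proof.
suff H s1 t1 s2 t2 : add_segment (add_segment K s1 t1) s2 t2 `<=` add_segment (add_segment K s2 t2) s1 t1.
  by apply/seteqP; split; exact: H.
move=> _ [_ [x Kx [r rt <-]] [r' rt' <-]].
exists (x + r' *: s2); first by exists x => //; exists r'.
by exists r => //; rewrite addrAC.
Qed.

Lemma cvx_shift n a (K : set 'rV[R]_n) : cvx K -> cvx (shift a K).
Proof.
move=> cK x y t Kx Ky t01; have := cK _ _ t Kx Ky t01; rewrite /shift /=.
by congr K; rewrite !scalerBr addrACA -opprD -scalerDl subrK scale1r.
Qed.

Lemma convex_body_shift n a (K : set 'rV[R]_n) : convex_body K -> convex_body (shift a K).
Proof. by move=> [? ?]; split; [exact: compact_shift|exact: cvx_shift]. Qed.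

Lemma convex_bodyI n (A B : set 'rV[R]_n) : convex_body A -> convex_body B -> convex_body (A `&` B).
Proof.
move=> [cA vA] [cB vB]; split; first exact: compactI.
by move=> x y t [Ax Bx] [Ay By] t01; split; [exact: vA|exact: vB].
Qed.

(** Modularity is stated for convex unions, because convexity of the union is what makes parallel
    bodies commute with intersection in [parallelI]. *)
Record valuation n (phi : set 'rV[R]_n -> R) : Prop := Valuation {
  val_ge0 : forall A, convex_body A -> 0 <= phi A;
  val_le : forall A B, convex_body A -> convex_body B -> A `<=` B -> phi A <= phi B;
  val_modular : forall A B, convex_body A -> convex_body B -> cvx (A `|` B) ->
    phi A + phi B = phi (A `|` B) + phi (A `&` B);
  val_shift : forall a A, convex_body A -> phi (shift a A) = phi A }.

Lemma vol_valuation n : valuation (@vol R n).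
Proof.
split => [A _|A B [cA _] [cB _]|A B [cA _] [cB _] _|a A [cA _]].
- exact: vol_ge0.
- exact: vol_le.
- exact: vol_modular.
- exact: vol_shift.
Qed.

(** Additivity settles rational arguments; monotonicity then confines [G t] between consecutive
    multiples of 1/N, with an error of at most [G 1 / N]. *)
Lemma additive_linear (G : R -> R) :
  (forall t r, 0 <= t -> 0 <= r -> G (t + r) = G t + G r) ->
  (forall t r, 0 <= t -> t <= r -> G t <= G r) ->
  forall t, 0 <= t -> G t = t * G 1.
Proof.
move=> Gadd Gle t t0.
have G0 : G 0 = 0 by have := Gadd 0 0 (lexx _) (lexx _); rewrite addr0; lra.
have G1 : 0 <= G 1 by rewrite -G0 Gle.
have Gn (k : nat) u : 0 <= u -> G (k%:R * u) = k%:R * G u.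
  move=> u0; elim: k => [|k IH]; first by rewrite !mul0r.
  by rewrite -natr1 !mulrDl !mul1r Gadd ?IH// mulr_ge0.
have Gq (k N : nat) : (0 < N)%N -> G (k%:R / N%:R) = k%:R / N%:R * G 1.
  move=> N0; have N0' : N%:R != 0 :> R by rewrite pnatr_eq0 -lt0n.
  have i0 : 0 <= N%:R^-1 :> R by rewrite invr_ge0.
  rewrite Gn// -mulrA; congr (_ * _); apply: (mulfI N0').
  by rewrite -Gn// mulfV// mulrA mulfV// mul1r.
have B (N : nat) : (0 < N)%N -> `|G t - t * G 1| <= N%:R^-1 * G 1.
  move=> N0; have N0' : 0 < N%:R :> R by rewrite ltr0n.
  have Nt0 : 0 <= N%:R * t by rewrite mulr_ge0.
  have /andP[k1 k2] := truncn_itv Nt0; set k := Num.truncn _ in k1 k2.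
  have k1' : k%:R / N%:R <= t by rewrite ler_pdivrMr// mulrC.
  have k2' : t <= k.+1%:R / N%:R by rewrite ler_pdivlMr// mulrC ltW.
  have l1 : k%:R / N%:R * G 1 <= G t by rewrite -Gq// Gle// divr_ge0.
  have l2 : G t <= k.+1%:R / N%:R * G 1 by rewrite -Gq// Gle.
  have e : k.+1%:R / N%:R = k%:R / N%:R + N%:R^-1 :> R by rewrite -natr1 mulrDl mul1r.
  rewrite e in k2' l2; move: k1' k2' l1 l2; move: (N%:R^-1) (k%:R / N%:R) => b a.
  by move=> h1 h2 h3 h4; rewrite ler_norml; apply/andP; split; nra.
apply/eqP; rewrite -subr_eq0 -normr_le0 leNgt; apply/negP => pos.
have := B (Num.truncn (G 1 / `|G t - t * G 1|)).+1 isT.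
by rewrite ler_pdivlMl// -ler_pdivlMr// leNgt truncnS_gt.
Qed.

(* K + [-t s, t s] and K + [-r s, r s], translated so that they just overlap, have
   union K + [-(t + r) s, (t + r) s] and intersection a translate of K. *)
Lemma add_segment_affine n (phi : set 'rV[R]_n -> R) K s t : valuation phi -> convex_body K ->
  0 <= t -> phi (add_segment K s t) = phi K + t * (phi (add_segment K s 1) - phi K).
Proof.
move=> vphi bK t0; pose G t := phi (add_segment K s t) - phi K.
suff /(_ t t0) : forall t, 0 <= t -> G t = t * G 1.
  by rewrite /G => <-; rewrite addrC subrK.
apply: additive_linear => [{t0}t r t0 r0|{t0}t r t0 tr]; last first.
  rewrite lerB//; apply: (val_le vphi); [exact: convex_body_add_segment..|exact: add_segment_le].
pose A := shift (r *: s) (add_segment K s t); pose B := shift (- (t *: s)) (add_segment K s r).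
have bA : convex_body A by apply: convex_body_shift; exact: convex_body_add_segment.
have bB : convex_body B by apply: convex_body_shift; exact: convex_body_add_segment.
have AB : A `|` B = add_segment K s (t + r).
  apply/seteqP; split => [x [[k Kk [q /= qt E]]|[k Kk [q /= qt E]]]|_ [k Kk [q /= qtr <-]]].
  - exists k => //; exists (q + r).
      by move: qt; rewrite /= !ler_norml => /andP[h1 h2]; apply/andP; split; lra.
    by rewrite scalerDl addrA E subrK.
  - exists k => //; exists (q - t).
      by move: qt; rewrite /= !ler_norml => /andP[h1 h2]; apply/andP; split; lra.
    by rewrite scalerBl addrA E opprK addrK.
  - have [h|h] := leP (r - t) q.
      left; exists k => //; exists (q - r); last by rewrite scalerBl addrA.
      by move: qtr; rewrite /= !ler_norml => /andP[h1 h2]; apply/andP; split; lra.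
    right; exists k => //; exists (q + t); last by rewrite scalerDl addrA opprK.
    by move: qtr; rewrite /= !ler_norml => /andP[h1 h2]; apply/andP; split; lra.
have IAB : A `&` B = shift ((r - t) *: s) K.
  apply/seteqP; split => [x [[k Kk [q /= qt E]] [k' Kk' [q' /= qt' E']]]|x Kx]; last first.
    split.
      exists (x - (r - t) *: s) => //; exists (- t); first by rewrite /= normrN ger0_norm.
      by apply/rowP => i; rewrite !mxE; ring.
    exists (x - (r - t) *: s) => //; exists r; first by rewrite /= ger0_norm.
    by apply/rowP => i; rewrite !mxE; ring.
  rewrite /shift /=.
  move: qt qt'; rewrite !ler_norml => /andP[h1 h2] /andP[h3 h4].
  (* The translated point is both [k + a s] and [k' - b s] with [a] and [b] nonnegative. It
     therefore divides the segment from [k] to [k'] in the ratio a : b, or equals [k] when both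
     vanish, and lies in [K] by convexity. *)
  have [a aE] : exists a, a = q + t by exists (q + t).
  have [b bE] : exists b, b = r - q' by exists (r - q').
  have a0 : 0 <= a by lra.
  have b0 : 0 <= b by lra.
  have e1 : x - (r - t) *: s = k + a *: s.
    apply/rowP => i; have := congr1 (fun v : 'rV[R]_n => v 0 i) E.
    by rewrite aE !mxE => h; nra.
  have e2 : x - (r - t) *: s = k' - b *: s.
    apply/rowP => i; have := congr1 (fun v : 'rV[R]_n => v 0 i) E'.
    by rewrite bE !mxE => h; nra.
  have [ab0|ab0] := eqVneq (a + b) 0.
    have a00 : a = 0 by lra.
    by rewrite e1 a00 scale0r addr0.
  have [_ cK] := bK.
  have -> : x - (r - t) *: s = (1 - a / (a + b)) *: k + (a / (a + b)) *: k'.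
    have e3 : k' = k + (a + b) *: s.
      move: e2; rewrite e1 => /eqP; rewrite eq_sym subr_eq => /eqP ->.
      by rewrite scalerDl addrA.
    rewrite e1 e3 scalerDr addrA -scalerDl subrK scale1r; congr (_ + _).
    by rewrite scalerA divfK.
  apply: cK => //; apply/andP; split; first by rewrite divr_ge0// addr_ge0.
  by rewrite ler_pdivrMr ?mul1r ?lerDl// lt0r ab0 addr_ge0.
have := val_modular vphi bA bB; rewrite AB IAB.
move=> /(_ (proj2 (convex_body_add_segment _ _ bK))).
rewrite !(val_shift vphi)//; [|exact: convex_body_add_segment|exact: convex_body_add_segment].
by rewrite /G => h; lra.
Qed.

(* The class of the coefficients of [zcoef]: it contains the volume and is closed
   under taking the slope in the direction of a segment, which is monotone because
   it is the limit of a (K + [-t s, t s]) / t. *)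
Record segment_affine n (a : set 'rV[R]_n -> R) : Prop := SegmentAffine {
  segment_affine_ge0 : forall K, convex_body K -> 0 <= a K;
  segment_affine_le : forall K L, convex_body K -> convex_body L -> K `<=` L -> a K <= a L;
  segment_affine_eq : forall K s t, convex_body K -> 0 <= t ->
    a (add_segment K s t) = a K + t * (a (add_segment K s 1) - a K) }.

Lemma slope_le (x y z w : R) : (forall t, 0 <= t -> x + t * y <= z + t * w) -> y <= w.
Proof.
move=> H; rewrite leNgt; apply/negP => wy.
have yw : 0 < y - w by rewrite subr_gt0.
have t0 : 0 <= (`|z - x| + 1) / (y - w) by apply: divr_ge0; [exact: addr_ge0|exact: ltW].
have := H _ t0; set t := (_ / _) in t0 *.
have e : t * (y - w) = `|z - x| + 1 by rewrite /t divfK// gt_eqF.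
by have := ler_norm (z - x); nra.
Qed.

Lemma segment_affine_slope n (a : set 'rV[R]_n -> R) s : segment_affine a ->
  segment_affine (fun K => a (add_segment K s 1) - a K).
Proof.
move=> ga; split => [K bK|K L bK bL KL|K r t bK t0].
- rewrite subr_ge0; apply: (segment_affine_le ga) => //; first exact: convex_body_add_segment.
  exact: sub_add_segment.
- apply: (@slope_le (a K) _ (a L)) => t t0.
  rewrite -!(segment_affine_eq ga)//; apply: (segment_affine_le ga); [exact: convex_body_add_segment..|exact: add_segment_mono].
- rewrite [add_segment (add_segment _ _ _) _ _]add_segmentC (segment_affine_eq ga r (convex_body_add_segment s 1 bK) t0).
  rewrite (segment_affine_eq ga r bK t0) [add_segment (add_segment K r 1) _ _]add_segmentC; ring.
Qed.

Lemma segment_affineD n (a b : set 'rV[R]_n -> R) : segment_affine a -> segment_affine b ->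
  segment_affine (fun K => a K + b K).
Proof.
move=> ga gb; split => [K bK|K L bK bL KL|K s t bK t0].
- by rewrite addr_ge0// ?(segment_affine_ge0 ga)// (segment_affine_ge0 gb).
- by rewrite lerD// ?(segment_affine_le ga)// (segment_affine_le gb).
- rewrite (segment_affine_eq ga s bK t0) (segment_affine_eq gb s bK t0); ring.
Qed.

Lemma segment_affine_cst0 n : segment_affine (fun _ : set 'rV[R]_n => 0).
Proof. by split => // *; rewrite subrr mulr0 addr0. Qed.

Lemma segment_affine_vol n : segment_affine (@vol R n).
Proof.
have v := @vol_valuation n; split; [exact: val_ge0|exact: val_le|].
by move=> K s t bK t0; exact: add_segment_affine.
Qed.

(** The coefficient of e^m in the volume of [zsum l K e]. Each coefficient is affine in the length
    of a new segment, so the segment adds the slope of coefficient m-1 to coefficient m. *)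
Fixpoint zcoef n (l : seq 'rV[R]_n) (K : set 'rV[R]_n) (m : nat) : R :=
  if l is s :: l' then
    zcoef l' K m +
    (if m is m'.+1 then zcoef l' (add_segment K s 1) m' - zcoef l' K m' else 0)
  else if m is 0 then vol K else 0.

Fixpoint zsum n (l : seq 'rV[R]_n) (K : set 'rV[R]_n) (e : R) : set 'rV[R]_n :=
  if l is s :: l' then zsum l' (add_segment K s e) e else K.

Lemma segment_affine_zcoef n (l : seq 'rV[R]_n) m : segment_affine (zcoef l ^~ m).
Proof.
elim: l m => [|s l IH] [|m] /=.
- exact: segment_affine_vol.
- exact: segment_affine_cst0.
- apply: segment_affineD; [exact: IH|exact: segment_affine_cst0].
- apply: segment_affineD; first exact: IH.
  exact: (segment_affine_slope s (IH m)).
Qed.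

Lemma zcoef_size n (l : seq 'rV[R]_n) K m : (size l < m)%N -> zcoef l K m = 0.
Proof.
elim: l K m => [|s l IH] K [|m]//= lm.
by rewrite IH 1?ltnW// add0r !IH// subrr.
Qed.

Lemma vol_zsum_size n (l : seq 'rV[R]_n) K e : convex_body K -> 0 <= e ->
  vol (zsum l K e) = \sum_(m < (size l).+1) zcoef l K m * e ^+ m.
Proof.
elim: l K => [|s l IH] K bK e0 /=.
  by rewrite big_ord_recl big_ord0 expr0 mulr1 addr0.
rewrite IH//; last exact: convex_body_add_segment.
have zA m : zcoef l (add_segment K s e) m =
    zcoef l K m + e * (zcoef l (add_segment K s 1) m - zcoef l K m).
  exact: (segment_affine_eq (segment_affine_zcoef l m) s bK e0).
rewrite (eq_bigr (fun m : 'I_(size l).+1 => zcoef l K m * e ^+ m +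
    e * (zcoef l (add_segment K s 1) m - zcoef l K m) * e ^+ m)); last first.
  by move=> m _; rewrite -mulrDl -zA.
rewrite big_split /=.
under [in RHS]eq_bigr do rewrite mulrDl.
rewrite [in RHS]big_split /=; congr (_ + _).
  by rewrite [in RHS]big_ord_recr /= zcoef_size// mul0r addr0.
rewrite [in RHS]big_ord_recl /= mul0r add0r; apply: eq_bigr => i _.
by rewrite exprS; ring.
Qed.

Lemma convex_body_zsum n (l : seq 'rV[R]_n) K e : convex_body K -> convex_body (zsum l K e).
Proof. by elim: l K => //= s l IH K bK; apply: IH; exact: convex_body_add_segment. Qed.

Lemma zsum_bound n (l : seq 'rV[R]_n) K e (r : R) : 0 <= e ->
  (forall x : 'rV[R]_n, K x -> forall i, `|x 0 i| <= r) ->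
  forall x, zsum l K e x -> forall i, `|x 0 i| <= r + e * \sum_(s <- l) `|s|.
Proof.
move=> e0; elim: l K r => [|s l IH] K r Kr x /=.
  by rewrite big_nil mulr0 addr0; exact: Kr.
move=> /(IH (add_segment K s e) (r + e * `|s|)); rewrite big_cons mulrDr addrA; apply.
move=> _ [y Ky [q /= qe <-]] i; rewrite rowD rowZ.
apply: le_trans (ler_normD _ _) _; apply: lerD; first exact: Kr.
rewrite normrM; apply: ler_pM => //.
rewrite [leRHS](mx_normrE _); apply/bigmax_geP; right => /=.
by exists (0, i).
Qed.

(** [zsum l K e] lies in a box whose side is linear in [e], so its volume is O(e^n); the
    coefficients being nonnegative, no single term grows faster. A degree bound independent of [l]
    permits interpolation at fixed nodes in the limit. *)
Lemma zcoef_deg n (l : seq 'rV[R]_n) K m : convex_body K -> (n < m)%N -> zcoef l K m = 0.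
Proof.
move=> bK nm; have [cK _] := bK; have [_ [r r0 Kr]] := (compact_rowP K).1 cK.
have [lm|ml] := ltnP (size l) m; first exact: zcoef_size.
have z0 i : 0 <= zcoef l K i by exact: (segment_affine_ge0 (segment_affine_zcoef l i)).
apply/le_anti; rewrite z0 andbT.
pose c := \sum_(s <- l) `|s|; have c0 : 0 <= c by apply: sumr_ge0.
pose C := (2 * (r + c)) ^+ n.
have C0 : 0 <= C by rewrite exprn_ge0// mulr_ge0// addr_ge0.
have H e : 1 <= e -> zcoef l K m * e <= C.
  move=> e1; have e0 : 0 < e by rewrite (lt_le_trans _ e1).
  have en : 0 < e ^+ n by rewrite exprn_gt0.
  rewrite -(ler_pM2r en).
  have h1 : zcoef l K m * e ^+ m <= vol (zsum l K e).
    rewrite vol_zsum_size ?(ltW e0)// -ltnS in ml *.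
    rewrite (bigD1 (Ordinal ml))//= lerDl; apply: sumr_ge0 => i _.
    by rewrite mulr_ge0// exprn_ge0// ltW.
  have h2 : vol (zsum l K e) <= C * e ^+ n.
    have re : 0 <= r + e * c by rewrite addr_ge0// mulr_ge0// ltW.
    have cz : compact (zsum l K e) by have [] := convex_body_zsum l e bK.
    apply: le_trans (vol_bound cz re (zsum_bound (ltW e0) Kr)) _.
    have ec0 : 0 <= e * c by rewrite mulr_ge0// ltW.
    rewrite /C -exprMn; apply: lerXn2r.
    - by rewrite nnegrE mulr_ge0// addr_ge0.
    - by rewrite nnegrE !mulr_ge0 ?addr_ge0 ?(ltW e0).
    by rewrite -mulrA ler_pM2l// mulrDl (mulrC c) lerD2r ler_peMr.
  apply: le_trans (le_trans h1 h2); rewrite -mulrA -exprS ler_wpM2l//.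
  by rewrite ler_weXn2l.
rewrite leNgt; apply/negP => zp.
have := H (C / zcoef l K m + 1).
rewrite lerDr divr_ge0// => /(_ isT).
by rewrite mulrDr mulr1 mulrC divfK ?gt_eqF//; lra.
Qed.

Lemma vol_zsum n (l : seq 'rV[R]_n) K e : convex_body K -> 0 <= e ->
  vol (zsum l K e) = \sum_(m < n.+1) zcoef l K m * e ^+ m.
Proof.
move=> bK e0; rewrite vol_zsum_size//.
pose N := maxn (size l).+1 n.+1; pose F m := zcoef l K m * e ^+ m.
have H k : (k <= N)%N -> (forall m, (k <= m)%N -> F m = 0) ->
    \sum_(m < k) F m = \sum_(m < N) F m.
  move=> kN F0; rewrite (big_ord_widen N F kN) [RHS](bigID (fun i : 'I_N => (i < k)%N))/=.
  by rewrite [X in _ = _ + X]big1 ?addr0// => i; rewrite -leqNgt => /F0.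
rewrite (H (size l).+1) ?leq_maxl ?(H n.+1) ?leq_maxr// => m mk; rewrite /F.
  by rewrite zcoef_deg// mul0r.
by rewrite zcoef_size// mul0r.
Qed.

End Segments.

(** * Zonotopes approximating the ball *)

Section Zonotopes.
Variable R : realType.
Implicit Types n : nat.

Fixpoint zono n (l : seq 'rV[R]_n) : set 'rV[R]_n :=
  if l is s :: l' then add_segment (zono l') s 1 else [set 0].

(** The support function of [zono l], by [supp_ge] and [supp_max]; inclusions between zonotopes and
    balls are tested on it. *)
Definition supp n (l : seq 'rV[R]_n) (x : 'rV[R]_n) : R := \sum_(s <- l) `|dot x s|.

Definition enorm n (x : 'rV[R]_n) : R := Num.sqrt (dot x x).

Lemma convex_body_set1 n (a : 'rV[R]_n) : convex_body [set a].
Proof.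
split; first exact: compact_set1.
by move=> x y t -> -> _; rewrite -scalerDl subrK scale1r.
Qed.

Lemma convex_body_zono n (l : seq 'rV[R]_n) : convex_body (zono l).
Proof. by elim: l => [|s l IH] /=; [exact: convex_body_set1|exact: convex_body_add_segment]. Qed.

Lemma zsumE n (l : seq 'rV[R]_n) K e : 0 <= e ->
  zsum l K e = [set x + e *: z | x in K & z in zono l].
Proof.
move=> e0; elim: l K => [|s l IH] K /=.
  apply/seteqP; split => [x Kx|_ [x Kx [_ -> <-]]].
    by exists x => //; exists 0 => //; rewrite scaler0 addr0.
  by rewrite scaler0 addr0.
rewrite IH; apply/seteqP; split.
  move=> _ [_ [x Kx [r /= re <-]] [z lz <-]]; exists x => //.
  have [r' r'1 ->] : exists2 r', `|r'| <= 1 & r = e * r'.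
    have [e00|en0] := eqVneq e 0.
      exists 0; first by rewrite normr0.
      by move: re; rewrite e00 mul0r normr_le0 => /eqP.
    exists (r / e); last by rewrite mulrC divfK.
    by rewrite normrM normfV (ger0_norm e0) ler_pdivrMr ?mul1r// lt0r en0.
  exists (z + r' *: s); first by exists z => //; exists r'.
  by apply/rowP => i; rewrite !mxE; ring.
move=> _ [x Kx [_ [z lz [r /= r1 <-]] <-]].
exists (x + (e * r) *: s).
  by exists x => //; exists (e * r) => //=; rewrite normrM (ger0_norm e0) ler_piMr.
by exists z => //; apply/rowP => i; rewrite !mxE; ring.
Qed.

Lemma supp_ge n (l : seq 'rV[R]_n) x z : zono l z -> dot x z <= supp l x.
Proof.
rewrite /supp; elim: l z => [|s l IH] z /=; first by move=> ->; rewrite big_nil dot0r.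
move=> [y ly [r /= r1 <-]]; rewrite big_cons dotDr dotZr addrC.
apply: lerD; last exact: IH.
by apply: le_trans (ler_norm _) _; rewrite normrM ler_piMl.
Qed.

Lemma supp_max n (l : seq 'rV[R]_n) x : exists2 z, zono l z & dot x z = supp l x.
Proof.
rewrite /supp; elim: l => [|s l [z lz E]] /=.
  by exists 0 => //; rewrite big_nil dot0r.
exists (z + Num.sg (dot x s) *: s).
  exists z => //; exists (Num.sg (dot x s)) => //=; rewrite normr_sg.
  by case: (_ != 0).
by rewrite big_cons dotDr dotZr E addrC -normrEsg.
Qed.

Lemma supp_cat n (l l' : seq 'rV[R]_n) x : supp (l ++ l') x = supp l x + supp l' x.
Proof. by rewrite /supp big_cat. Qed.

Lemma suppD n (l : seq 'rV[R]_n) x y : supp l (x + y) <= supp l x + supp l y.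
Proof. by rewrite /supp -big_split; apply: ler_sum => s _; rewrite dotDl ler_normD. Qed.

Lemma suppZ n (l : seq 'rV[R]_n) c x : supp l (c *: x) = `|c| * supp l x.
Proof. by rewrite /supp mulr_sumr; apply: eq_bigr => s _; rewrite dotZl normrM. Qed.

Lemma supp_map_scale n (l : seq 'rV[R]_n) c x :
  supp [seq c *: s | s <- l] x = `|c| * supp l x.
Proof.
by rewrite /supp big_map mulr_sumr; apply: eq_bigr => s _; rewrite dotZr normrM.
Qed.

Lemma supp_map_householder n (l : seq 'rV[R]_n) w x :
  supp [seq s *m householder w | s <- l] x = supp l (x *m householder w).
Proof. by rewrite /supp big_map; apply: eq_bigr => s _; rewrite householder_adj. Qed.

Lemma enorm_ge0 n (x : 'rV[R]_n) : 0 <= enorm x.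
Proof. exact: sqrtr_ge0. Qed.

Lemma enorm_sqr n (x : 'rV[R]_n) : enorm x ^+ 2 = dot x x.
Proof. by rewrite sqr_sqrtr// dot_ge0. Qed.

Lemma enormZ n c (x : 'rV[R]_n) : enorm (c *: x) = `|c| * enorm x.
Proof.
by rewrite /enorm dotZl dotZr mulrA -expr2 sqrtrM ?sqr_ge0// sqrtr_sqr.
Qed.

Lemma enormN n (x : 'rV[R]_n) : enorm (- x) = enorm x.
Proof. by rewrite -scaleN1r enormZ normrN1 mul1r. Qed.

Lemma enorm_householder n (w x : 'rV[R]_n) : enorm (x *m householder w) = enorm x.
Proof. by have [_ H] := isometry_householder w; rewrite /enorm H. Qed.

Lemma enorm_eq0 n (x : 'rV[R]_n) : (enorm x == 0) = (x == 0).
Proof. by rewrite -(sqrf_eq0 (enorm x)) enorm_sqr dot_eq0. Qed.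

Lemma abs_le_enorm n (x : 'rV[R]_n) i : `|x 0 i| <= enorm x.
Proof.
rewrite -(@ler_pXn2r _ 2)// ?nnegrE ?enorm_ge0//.
by rewrite real_normK ?num_real// enorm_sqr coord_dot.
Qed.

Lemma cauchy_schwarz n (x y : 'rV[R]_n) : dot x y <= enorm x * enorm y.
Proof.
have [->|x0] := eqVneq x 0; first by rewrite dot0l mulr_ge0 ?enorm_ge0.
have [->|y0] := eqVneq y 0; first by rewrite dot0r mulr_ge0 ?enorm_ge0.
have a0 : 0 < enorm x by rewrite lt0r enorm_eq0 x0 enorm_ge0.
have b0 : 0 < enorm y by rewrite lt0r enorm_eq0 y0 enorm_ge0.
have := dot_ge0 (enorm y *: x - enorm x *: y).
rewrite !(dotDl, dotDr, dotNl, dotNr, dotZl, dotZr) -!enorm_sqr (dotC y x).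
move: a0 b0; move: (enorm x) (enorm y) (dot x y) => a b c a0 b0 h.
have ab : 0 < a * b by exact: mulr_gt0.
rewrite -(ler_pM2l ab); nra.
Qed.

(** Test the support function at the point [z] itself: |z|^2 <= [supp l z] <= |z|. *)
Lemma zono_sub_ball n (l : seq 'rV[R]_n) : (forall x, supp l x <= enorm x) ->
  zono l `<=` @unit_ball R n.
Proof.
move=> H z lz; rewrite /unit_ball /= -enorm_sqr.
have := le_trans (supp_ge z lz) (H z); rewrite -enorm_sqr.
by have := enorm_ge0 z; move: (enorm z) => a; nra.
Qed.

(** [z] is the point of [Z] nearest to [x], and [y = x - z]. Moving from [z] towards [z'] cannot
    shorten the distance, and the first-order term of the squared distance is the inequality. *)
Lemma separation n (Z : set 'rV[R]_n) x : convex_body Z -> Z !=set0 -> ~ Z x ->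
  exists2 y, y != 0 & exists2 z, Z z & forall z', Z z' -> dot y z' <= dot y z /\
    dot y z = dot y x - dot y y.
Proof.
move=> [cZ vZ] Z0 Zx.
have cd : {within Z, continuous (fun z => dot (x - z) (x - z))}.
  apply: continuous_subspaceT.
  have c1 : continuous (fun z : 'rV[R]_n => x - z).
    apply: mx_continuous => i j; under eq_fun do rewrite !mxE.
    have c2 : continuous (fun z : 'rV[R]_n => z i j : R) by exact: coord_continuous.
    by move=> z; exact: (cvgB (cvg_cst (x i j)) (c2 z)).
  move=> z; apply: (@continuous_comp _ _ _ (fun z : 'rV[R]_n => x - z) (fun w => dot w w)).
    exact: c1.
  exact: dotxx_continuous.
have [z /set_mem Zz zmin] := compact_EVT_min Z0 cZ cd.
exists (x - z); first by apply/negP; rewrite subr_eq0 => /eqP xz; apply: Zx; rewrite xz.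
exists z => // z' Zz'; split; last first.
  by rewrite -dotNr -dotDr; congr dot; rewrite opprB addrC subrK.
have H t : 0 <= t <= 1 -> 2 * t * dot (x - z) (z' - z) <= t ^+ 2 * dot (z' - z) (z' - z).
  move=> t01; have Zt : Z ((1 - t) *: z + t *: z') by exact: vZ.
  have := zmin _ (mem_set Zt).
  have -> : x - ((1 - t) *: z + t *: z') = (x - z) - t *: (z' - z).
    by apply/rowP => i; rewrite !mxE; ring.
  move: (x - z) (z' - z) => a b.
  rewrite !(dotDl, dotDr, dotNl, dotNr, dotZl, dotZr) (dotC b a).
  by move=> h; lra.
rewrite -subr_le0 -dotNr -dotDr.
move: H; move: (dot (x - z) (z' - z)) (dot_ge0 (z' - z)) => a; move: (dot _ _) => b b0 H.
rewrite leNgt; apply/negP => a0.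
have ab : 0 < a + b by lra.
(* At t = a/(a+b) the product t b is less than [a], against 2 a <= t b. *)
have ab1 : 0 <= a / (a + b) <= 1.
  by rewrite divr_ge0 ?(ltW a0) ?(ltW ab)//= ler_pdivrMr// mul1r lerDl.
have := H _ ab1; have : a / (a + b) * (a + b) = a by rewrite divfK// gt_eqF.
have t0 : 0 < a / (a + b) by rewrite divr_gt0.
move: (a / (a + b)) t0 {ab1} => t t0 E h.
have : 2 * a <= t * b by rewrite -(ler_pM2l t0); lra.
by nra.
Qed.

(** If [c *: b] were outside, the separating direction [y] would satisfy [supp l y] < c |y|. *)
Lemma ball_sub_zono n (l : seq 'rV[R]_n) c : 0 <= c ->
  (forall x, c * enorm x <= supp l x) ->
  forall b, @unit_ball R n b -> zono l (c *: b).
Proof.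
move=> c0 H b b1; apply: contrapT => nz.
have [z0 lz0 _] := supp_max l 0.
have [y y0 [z lz zP]] := separation (convex_body_zono l) (ex_intro _ z0 lz0) nz.
have [z' lz' E] := supp_max l y; have [h1 h2] := zP _ lz'.
have := H y; rewrite -E => h3.
have := cauchy_schwarz y b.
have eb : enorm b <= 1.
  rewrite -(@expr_le1 _ 2)// ?enorm_ge0// enorm_sqr; exact: b1.
have := enorm_ge0 y.
have : 0 < dot y y by rewrite dot_gt0.
rewrite dotZr in h2; move: h1 h2 h3 eb (enorm_ge0 b).
move: (dot y z) (dot y z') (dot y b) (dot y y) (enorm y) (enorm b) => a1 a2 a3 a4 a5 a6.
move=> h1 h2 h3 h4 h5 h6 h7 h8.
have : a3 <= a5 by nra.
by move=> h9; nra.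
Qed.

(** For [m >= 0], the zonotope lies between the balls of radius [m] and 1 about 0, expressed through
    support functions. *)
Definition supp_approx n (l : seq 'rV[R]_n) (m : R) :=
  forall x, m * enorm x <= supp l x <= enorm x.

(** One representative for each cell of a grid of mesh 1/M that meets the sphere: points of one cell
    differ by at most 1/M in every coordinate, hence by at most (n+1)/M <= e in norm. *)
Lemma sphere_net n (e : R) : 0 < e -> exists ys : seq 'rV[R]_n.+1,
  (forall y, y \in ys -> dot y y = 1) /\
  forall x, dot x x = 1 -> exists2 y, y \in ys & enorm (x - y) <= e.
Proof.
move=> e0; pose d : R := n.+1%:R.
pose M := (Num.truncn (d / e)).+1.
have M0 : 0 < M%:R :> R by rewrite ltr0n.
have dM : d / M%:R <= e.
  by rewrite ler_pdivrMr// mulrC -ler_pdivrMr// ltW// truncnS_gt.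
pose c (x : 'rV[R]_n.+1) : {ffun 'I_n.+1 -> 'I_(2 * M).+1} :=
  [ffun i => inord (Num.truncn (M%:R * (x ord0 i + 1)))].
pose e0v : 'rV[R]_n.+1 := \row_j (j == ord0)%:R.
have e0v1 : dot e0v e0v = 1.
  rewrite /dot (bigD1 ord0)//= !mxE eqxx mulr1 big1 ?addr0// => i /negPf i0.
  by rewrite !mxE i0 mul0r.
(* The default [e0v] keeps [rep f] on the sphere when no unit vector has code [f]. *)
pose rep f := xget e0v [set x | dot x x = 1 /\ c x = f].
have rep1 f : dot (rep f) (rep f) = 1.
  by rewrite /rep; case: xgetP => // x _ [].
exists [seq rep f | f <- enum {ffun 'I_n.+1 -> 'I_(2 * M).+1}].
split=> [y /mapP[f _ ->]//|x x1].
exists (rep (c x)); first by apply/mapP; exists (c x) => //; rewrite mem_enum.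
have cE : c (rep (c x)) = c x.
  by rewrite /rep; case: xgetP => [? _ []//|/(_ x)]; case.
move: (rep (c x)) (rep1 (c x)) cE => y y1 cE.
have b (z : 'rV[R]_n.+1) i : dot z z = 1 ->
    (c z i)%:R <= M%:R * (z 0 i + 1) < (c z i)%:R + 1.
  move=> z1; have : `|z 0 i| <= 1 by rewrite (le_trans (abs_le_enorm z i))// /enorm z1 sqrtr1.
  rewrite ler_norml => /andP[h1 h2].
  have t0 : 0 <= M%:R * (z 0 i + 1) by rewrite mulr_ge0//; lra.
  have := truncn_itv t0; rewrite ffunE inordK; first by rewrite -natr1.
  rewrite ltnS -(ler_nat R); have /andP[h3 _] := truncn_itv t0; apply: (le_trans h3).
  by rewrite natrM mulrC ler_pM2r//; lra.
have xy i : `|(x - y) 0 i| <= M%:R^-1.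
  have := b x i x1; have := b y i y1; rewrite cE => /andP[h1 h2] /andP[h3 h4].
  rewrite -(ler_pM2l M0) mulfV ?gt_eqF//.
  rewrite -{1}(gtr0_norm M0) -normrM rowB ler_norml; apply/andP; split; lra.
apply: le_trans dM; rewrite -(@ler_pXn2r _ 2)// ?nnegrE ?enorm_ge0 ?divr_ge0//.
rewrite enorm_sqr; apply: (@le_trans _ _ (\sum_(i < n.+1) M%:R^-1 ^+ 2)).
  apply: ler_sum => i _; rewrite -expr2 -real_normK ?num_real//.
  by rewrite ler_pXn2r// ?nnegrE// invr_ge0.
rewrite sumr_const card_ord -[leLHS]mulr_natl exprMn ler_wpM2r// ?sqr_ge0//.
by rewrite expr2 ler_peMr// ler1n.
Qed.

Lemma sum_ge_one (T : eqType) (s : seq T) (f : T -> R) (m e : R) x : x \in s ->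
  (forall y, y \in s -> m <= f y) -> m + e <= f x ->
  (size s)%:R * m + e <= \sum_(y <- s) f y.
Proof.
move=> xs fm fx; rewrite (perm_big _ (perm_to_rem xs)) big_cons /=.
have aux (s' : seq T) : (forall y, y \in s' -> m <= f y) ->
    (size s')%:R * m <= \sum_(y <- s') f y.
  elim: s' => [_|y s' IH H]; first by rewrite big_nil mul0r.
  rewrite big_cons /= -natr1 mulrDl mul1r addrC lerD//; first by apply: H; rewrite mem_head.
  by apply: IH => z zs; apply: H; rewrite inE zs orbT.
have : (size s).-1%:R * m <= \sum_(y <- rem x s) f y.
  by rewrite -(size_rem xs); apply: aux => y /mem_rem; exact: fm.
have : (0 < size s)%N by case: s xs {fm}.
case: (size s) => // k _ /=; rewrite -natr1 mulrDl mul1r => h; lra.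
Qed.

(* Averaging the reflections that move a point of large support to each point
   of a finite net raises the minimum of the support function. *)
Lemma supp_approx_improve n (e : R) : 0 < e -> exists2 h : R, 0 < h &
  forall (l : seq 'rV[R]_n.+1) (m : R) y, supp_approx l m -> dot y y = 1 -> m + e < supp l y ->
  exists l' : seq 'rV[R]_n.+1, supp_approx l' (m + h).
Proof.
move=> e0; have e20 : 0 < e / 2 by rewrite divr_gt0.
have [ys [ys1 ysP]] := sphere_net n e20.
pose N : R := (size ys).+1%:R.
have N0 : 0 < N by rewrite ltr0n.
(* The gain depends on the net alone and not on [l]; [supp_approx_exists] relies on this
   uniformity. *)
exists (e / 2 / N); first exact: divr_gt0.
move=> l m y tl y1 ly.
pose yss := y :: ys.
pose l' := flatten [seq [seq N^-1 *: s | s <- [seq s *m householder (k - y) | s <- l]] | k <- yss].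
have l'E x : supp l' x = N^-1 * \sum_(k <- yss) supp l (x *m householder (k - y)).
  rewrite /l' => {l'}; elim: (yss) => [|k s IH] /=; first by rewrite /supp !big_nil mulr0.
  rewrite supp_cat IH big_cons mulrDr supp_map_scale supp_map_householder.
  by rewrite gtr0_norm// invr_gt0.
have yss1 k : k \in yss -> dot k k = 1 by rewrite inE => /orP[/eqP ->|/ys1].
have lower x : dot x x = 1 -> m + e / 2 / N <= supp l' x.
  move=> x1; rewrite l'E ler_pdivlMl//.
  (* The reflection taking the net point [k] to [y] takes [x] to within e/2 of [y], where the
     support is still at least m + e/2; every other summand is at least m. *)
  have [k kys xk] := ysP x x1.
  have kyss : k \in yss by rewrite inE kys orbT.
  have H : (size yss)%:R * m + e / 2 <= \sum_(k <- yss) supp l (x *m householder (k - y)).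
    apply: (sum_ge_one kyss) => [k' _|].
      have /andP[+ _] := tl (x *m householder (k' - y)).
      by rewrite enorm_householder /enorm x1 sqrtr1 mulr1.
    have yk : k *m householder (k - y) = y by apply: householder_swap; rewrite yss1.
    have E : y = x *m householder (k - y) + (k - x) *m householder (k - y).
      by rewrite -mulmxDl addrC subrK yk.
    have := suppD l (x *m householder (k - y)) ((k - x) *m householder (k - y)); rewrite -E.
    have /andP[_ +] := tl ((k - x) *m householder (k - y)).
    rewrite enorm_householder -opprB enormN => h1 h2; lra.
  apply: le_trans H; rewrite mulrC mulrDl divfK ?gt_eqF// lerD2r mulrC.
  by [].
exists l' => x; apply/andP; split.
  have [->|x0] := eqVneq x 0.
    by rewrite -(scale0r (0 : 'rV[R]_n.+1)) enormZ suppZ normr0 !mul0r mulr0.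
  have a0 : 0 < enorm x by rewrite lt0r enorm_eq0 x0 enorm_ge0.
  have u1 : dot ((enorm x)^-1 *: x) ((enorm x)^-1 *: x) = 1.
    by rewrite dotZl dotZr -enorm_sqr expr2 mulKf ?gt_eqF// mulVf// gt_eqF.
  have := lower _ u1; rewrite suppZ gtr0_norm ?invr_gt0//.
  by rewrite ler_pdivlMl// mulrC.
rewrite l'E mulrC ler_pdivrMr//.
apply: (@le_trans _ _ (\sum_(k <- yss) enorm x)).
  apply: ler_sum => k _; have /andP[_ +] := tl (x *m householder (k - y)).
  by rewrite enorm_householder.
by rewrite big_const_seq count_predT iter_addr_0 /= mulr_natr.
Qed.

(** The cube [-m, m]^(n+1) with m = 1/(n+1): its support function is m times the l1 norm, and the l1
    norm lies between |x| and (n+1) |x|. *)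
Lemma supp_approx_start n : exists2 m : R, 0 < m & exists l : seq 'rV[R]_n.+1, supp_approx l m.
Proof.
pose m : R := n.+1%:R^-1; have m0 : 0 < m by rewrite invr_gt0.
exists m => //; exists [seq m *: (\row_j (j == i)%:R) | i <- enum 'I_n.+1] => x.
have E : supp [seq m *: (\row_j (j == i)%:R) | i <- enum 'I_n.+1] x =
    m * \sum_(i < n.+1) `|x 0 i|.
  rewrite /supp big_map big_enum mulr_sumr; apply: eq_bigr => i _.
  rewrite dotZr normrM gtr0_norm//; congr (_ * `|_|).
  rewrite /dot (bigD1 i)//= mxE eqxx mulr1 big1 ?addr0// => j /negPf ji.
  by rewrite mxE ji mulr0.
rewrite E; apply/andP; split.
  rewrite ler_pM2l//; rewrite -(@ler_pXn2r _ 2)// ?nnegrE ?enorm_ge0 ?sumr_ge0//.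
  rewrite enorm_sqr expr2 mulr_suml; apply: ler_sum => i _.
  rewrite -expr2 -real_normK ?num_real// expr2 ler_wpM2l//.
  by rewrite (bigD1 i)//= lerDl sumr_ge0.
rewrite mulrC ler_pdivrMr ?ltr0n//.
apply: (@le_trans _ _ (\sum_(i < n.+1) enorm x)).
  by apply: ler_sum => i _; exact: abs_le_enorm.
by rewrite sumr_const card_ord mulr_natr.
Qed.

Lemma supp_approx_le1 n (l : seq 'rV[R]_n.+1) m : supp_approx l m -> m <= 1.
Proof.
pose x : 'rV[R]_n.+1 := \row_j 1.
have x0 : 0 < enorm x.
  rewrite lt0r enorm_ge0 andbT enorm_eq0; apply/eqP => /rowP/(_ ord0).
  by rewrite !mxE => /eqP; rewrite oner_eq0.
move=> /(_ x)/andP[h1 h2]; have := le_trans h1 h2.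
by rewrite -{2}(mul1r (enorm x)) ler_pM2r.
Qed.

(** Take [l] with [m] within the uniform gain [h] of the supremum of attainable values. Its support
    on the sphere cannot exceed m + e', or an improvement would pass the supremum. Rescaling by 1/(m
    + e') gives m/(m + e') >= 1 - e, since e' = e m0/2 and m >= m0/2. *)
Lemma supp_approx_exists n (e : R) : 0 < e -> exists l : seq 'rV[R]_n, supp_approx l (1 - e).
Proof.
move=> e0; case: n => [|n].
  exists [::] => x; rewrite [x]thinmx0 /supp big_nil /enorm dot0l sqrtr0 mulr0.
  by rewrite lexx.
have [e1|e1] := leP 1 e.
  exists [::] => x; rewrite /supp big_nil enorm_ge0 andbT.
  by rewrite mulr_le0_ge0 ?enorm_ge0// subr_le0.
have [m0 m00 [l0 tl0]] := supp_approx_start n.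
pose E : set R := [set m | exists l : seq 'rV[R]_n.+1, supp_approx l m].
have supE : has_sup E.
  by split; [exists m0, l0|exists 1 => m [l /supp_approx_le1]].
pose e' := e * m0 / 2; have e'0 : 0 < e' by rewrite divr_gt0// mulr_gt0.
have [h h0 hP] := supp_approx_improve n e'0.
pose d := Num.min h (m0 / 2).
have d0 : 0 < d by rewrite lt_min h0 divr_gt0.
have [m [l tl] md] := sup_adherent d0 supE.
have m0s : m0 <= sup E by apply: ub_le_sup => //; [case: supE|exists l0].
have mm0 : m0 / 2 <= m.
  have : d <= m0 / 2 by rewrite ge_min lexx orbT.
  by lra.
have dh : d <= h by rewrite ge_min lexx.
have up y : dot y y = 1 -> supp l y <= m + e'.
  move=> y1; rewrite leNgt; apply/negP => /(hP _ _ _ tl y1) El'.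
  have : m + h <= sup E by apply: ub_le_sup => //; case: supE.
  by lra.
have me0 : 0 < m + e' by lra.
exists [seq (m + e')^-1 *: s | s <- l] => x; rewrite supp_map_scale gtr0_norm ?invr_gt0//.
apply/andP; split.
  rewrite mulrC [leRHS]mulrC ler_pdivlMr//.
  have /andP[h1 _] := tl x; apply: le_trans h1.
  rewrite mulrAC -mulrA mulrC ler_wpM2r ?enorm_ge0//.
  rewrite /e' in me0 *; nra.
have [->|x0] := eqVneq x 0.
  by rewrite -(scale0r (0 : 'rV[R]_n.+1)) enormZ suppZ normr0 !mul0r mulr0.
have a0 : 0 < enorm x by rewrite lt0r enorm_eq0 x0 enorm_ge0.
have u1 : dot ((enorm x)^-1 *: x) ((enorm x)^-1 *: x) = 1.
  by rewrite dotZl dotZr -enorm_sqr expr2 mulKf ?gt_eqF// mulVf// gt_eqF.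
have := up _ u1; rewrite suppZ gtr0_norm ?invr_gt0//.
by rewrite !ler_pdivrMl// mulrC.
Qed.

End Zonotopes.

(** * Steiner polynomials *)

Section Steiner.
Variable R : realType.
Implicit Types n : nat.

Lemma sum_cvg n (u : 'I_n -> nat -> R) (a : 'I_n -> R) :
  (forall i, u i k @[k --> \oo] --> a i) ->
  \sum_(i < n) u i k @[k --> \oo] --> \sum_(i < n) a i.
Proof.
move=> H; elim: (index_enum _) => [|i s IH].
  by under eq_fun do rewrite big_nil; rewrite big_nil; exact: cvg_cst.
under eq_fun do rewrite big_cons; rewrite big_cons.
exact: (cvgD (H i) IH).
Qed.

Definition interp n : 'M[R]_n.+1 := invmx (\matrix_(i, m) (i%:R ^+ m)).

Lemma interpE n (c p : 'I_n.+1 -> R) :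
  (forall i : 'I_n.+1, p i = \sum_(m < n.+1) c m * i%:R ^+ m) ->
  forall m, c m = \sum_i interp n m i * p i.
Proof.
move=> H m.
pose V : 'M[R]_n.+1 := \matrix_(i, m) (i%:R ^+ m).
have uV : V \in unitmx.
  have -> : V = (Vandermonde n.+1 (\row_(i < n.+1) (i%:R : R)))^T.
    by apply/matrixP => i j; rewrite !mxE.
  rewrite unitmx_tr unitmxE det_Vandermonde unitfE.
  apply/prodf_neq0 => i _; apply/prodf_neq0 => j ij.
  by rewrite !mxE subr_eq0 eqr_nat gtn_eqF.
pose C : 'cV[R]_n.+1 := \col_m c m.
have E : V *m C = \col_i p i.
  by apply/colP => i; rewrite !mxE H; apply: eq_bigr => k _; rewrite !mxE mulrC.
have := congr1 (mulmx (invmx V)) E; rewrite mulKmx// => /colP/(_ m).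
by rewrite !mxE => ->; apply: eq_bigr => i _; rewrite mxE.
Qed.

Section Body.
Variables (n : nat).
Implicit Types K L A B : set 'rV[R]_n.

Lemma cvx_unit_ball : cvx (@unit_ball R n).
Proof.
move=> x y t; rewrite /unit_ball /= => x1 y1 /andP[t0 t1].
rewrite !(dotDl, dotDr, dotZl, dotZr) (dotC y x).
have := dot_ge0 (x - y); rewrite !(dotDl, dotDr, dotNl, dotNr) (dotC y x).
move: x1 y1; move: (dot x x) (dot y y) (dot x y) => a b c a1 b1 h.
have h1 : 0 <= t * (1 - t) by rewrite mulr_ge0// subr_ge0.
have h2 : t * (1 - t) * (2 * c) <= t * (1 - t) * (a + b) by rewrite ler_wpM2l//; lra.
have h3 : (1 - t) * a <= (1 - t) * 1 by rewrite ler_wpM2l// subr_ge0.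
have h4 : t * b <= t * 1 by rewrite ler_wpM2l.
nra.
Qed.

Lemma convex_body_parallel K e : convex_body K -> convex_body (parallel_body K e).
Proof.
move=> bK; rewrite parallel_bodyE; apply: convex_body_add => //; split.
  by apply: compact_scale; exact: compact_unit_ball.
move=> _ _ t [x Bx <-] [y By <-] t01.
exists ((1 - t) *: x + t *: y); first exact: cvx_unit_ball.
by apply/rowP => i; rewrite !mxE; ring.
Qed.

Lemma vol_zsum_scale l K c e : convex_body K -> 1 <= c -> 0 <= e ->
  vol (zsum l K (c * e)) <= c ^+ n * vol (zsum l K e).
Proof.
move=> bK c1 e0; have c0 : 0 <= c by rewrite (le_trans _ c1).
rewrite !vol_zsum ?mulr_ge0// mulr_sumr; apply: ler_sum => m _.
rewrite exprMn mulrCA ler_wpM2r//.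
  by rewrite mulr_ge0 ?exprn_ge0// (segment_affine_ge0 (segment_affine_zcoef l m)).
by rewrite ler_weXn2l// -ltnS.
Qed.

(** Write Z for the zonotope and B for the ball. Z inside B gives the upper bound. Conversely, m B
    inside Z puts K + e B inside K + (e/m) Z, and passing from e/m to e costs at most m^(-n),
    because the polynomial has nonnegative coefficients and degree at most n. *)
Lemma supp_approx_sandwich l K (m e : R) : supp_approx l m -> convex_body K -> 0 < m <= 1 -> 0 <= e ->
  m ^+ n * vol (parallel_body K e) <= vol (zsum l K e) <= vol (parallel_body K e).
Proof.
move=> tl bK /andP[m0 m1] e0.
have cz e' : compact (zsum l K e') by have [] := convex_body_zsum l e' bK.
have cp : compact (parallel_body K e) by have [] := convex_body_parallel e bK.
apply/andP; split; last first.
  apply: vol_le => //; rewrite zsumE// => _ [x Kx [z lz <-]].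
  exists x => //; exists z => //; apply: zono_sub_ball lz => y.
  by have /andP[] := tl y.
have h1 : vol (parallel_body K e) <= vol (zsum l K (m^-1 * e)).
  have me0 : 0 <= m^-1 * e by rewrite mulr_ge0// invr_ge0 ltW.
  apply: vol_le => //; rewrite zsumE// => _ [x Kx [b Bb <-]].
  exists x => //; exists (m *: b).
    by apply: ball_sub_zono Bb; [exact: ltW|move=> y; have /andP[] := tl y].
  by rewrite scalerA mulrAC mulVf ?mul1r// gt_eqF.
have h2 : vol (zsum l K (m^-1 * e)) <= m^-1 ^+ n * vol (zsum l K e).
  by apply: vol_zsum_scale => //; rewrite invf_ge1.
have := le_trans h1 h2.
by rewrite exprVn mulrC ler_pdivlMr ?exprn_gt0// mulrC.
Qed.

Definition fvol K (e : R) := vol (parallel_body K e).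

(* Limits of the coefficients of the polynomials [vol_zsum]. *)
Definition scoef K (m : 'I_n.+1) : R := \sum_i interp n m i * fvol K i%:R.

(** The values at each [e] converge by the sandwich, and each coefficient is a fixed linear
    combination of the values at 0, ..., n, however long [l k] is. *)
Lemma zcoef_cvg : exists l : nat -> seq 'rV[R]_n,
  (forall K e, convex_body K -> 0 <= e -> vol (zsum (l k) K e) @[k --> \oo] --> fvol K e) /\
  (forall K (m : 'I_n.+1), convex_body K -> zcoef (l k) K m @[k --> \oo] --> scoef K m).
Proof.
have H k : exists l : seq 'rV[R]_n, supp_approx l (1 - k.+2%:R^-1).
  by apply: supp_approx_exists; rewrite invr_gt0.
have [l lP] := choice H; exists l.
have C K e : convex_body K -> 0 <= e -> vol (zsum (l k) K e) @[k --> \oo] --> fvol K e.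
  move=> bK e0.
  apply: (@squeeze_cvgr _ _ _ _ (fun k => (1 - k.+2%:R^-1) ^+ n * fvol K e) (fun=> fvol K e)).
  - apply: nearW => k; apply: supp_approx_sandwich => //.
    have : (k.+2%:R^-1 : R) < 1 by rewrite invf_lt1 ?ltr1n.
    have : 0 < (k.+2%:R^-1 : R) by rewrite invr_gt0.
    by move: (k.+2%:R^-1) => a h1 h2; apply/andP; split; lra.
  - have c0 : (k.+2%:R^-1 : R) @[k --> \oo] --> (0 : R).
      apply/cvgrPdist_lt => d d0; have := near_infty_natSinv_lt (PosNum d0).
      apply: filterS => k /= h; rewrite sub0r normrN gtr0_norm ?invr_gt0//.
      by apply: le_lt_trans h; rewrite lef_pV2 ?posrE// ler_nat.
    have c1 : 1 - (k.+2%:R^-1 : R) @[k --> \oo] --> (1 - 0 : R).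
      by apply: cvgB c0; exact: cvg_cst.
    have c2 : (1 - (k.+2%:R^-1 : R)) ^+ n @[k --> \oo] --> ((1 - 0) ^+ n : R).
      exact: (cvg_comp _ _ c1 (@exprn_continuous R n (1 - 0))).
    rewrite subr0 expr1n in c2; rewrite -[X in _ --> X]mul1r.
    by apply: cvgM => //; exact: cvg_cst.
  - exact: cvg_cst.
split=> // K m bK.
have E k : zcoef (l k) K m = \sum_i interp n m i * vol (zsum (l k) K i%:R).
  by apply: (@interpE n (zcoef (l k) K)) => i; rewrite vol_zsum.
rewrite (_ : (fun _ => _) = fun k => \sum_i interp n m i * vol (zsum (l k) K i%:R)); last first.
  exact/funext.
apply: (@sum_cvg _ (fun i k => interp n m i * vol (zsum (l k) K i%:R))) => i.
by apply: cvgMr; exact: C.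
Qed.

Lemma fvolE K e : convex_body K -> 0 <= e -> fvol K e = \sum_(m < n.+1) scoef K m * e ^+ m.
Proof.
move=> bK e0; have [l [C1 C2]] := zcoef_cvg.
have h1 := C1 K e bK e0.
have h2 : vol (zsum (l k) K e) @[k --> \oo] --> \sum_(m < n.+1) scoef K m * e ^+ m.
  rewrite (_ : (fun _ => _) = fun k => \sum_(m < n.+1) zcoef (l k) K m * e ^+ m); last first.
    by apply/funext => k; rewrite vol_zsum.
  apply: (@sum_cvg _ (fun m k => zcoef (l k) K m * e ^+ m)) => m.
  by apply: cvgMl; exact: C2.
exact: (@cvg_unique _ (@Rhausdorff R) _ _ _ _ h1 h2).
Qed.

Lemma scoef_ge0 K m : convex_body K -> 0 <= scoef K m.
Proof.
move=> bK; have [l [_ C2]] := zcoef_cvg.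
rewrite -(cvg_lim (@Rhausdorff R) (C2 K m bK)).
apply: limr_ge; first by apply: cvgP (C2 K m bK).
by apply: nearW => k; exact: (segment_affine_ge0 (segment_affine_zcoef (l k) m)).
Qed.

(** Not visible in the definition of [scoef], an interpolation formula; inherited in the limit from
    the coefficients [zcoef]. *)
Lemma scoef_le K L m : convex_body K -> convex_body L -> K `<=` L -> scoef K m <= scoef L m.
Proof.
move=> bK bL KL; have [l [_ C2]] := zcoef_cvg.
rewrite -(cvg_lim (@Rhausdorff R) (C2 K m bK)) -(cvg_lim (@Rhausdorff R) (C2 L m bL)).
apply: ler_lim; [by apply: cvgP (C2 K m bK)|by apply: cvgP (C2 L m bL)|].
by apply: nearW => k; exact: (segment_affine_le (segment_affine_zcoef (l k) m)).
Qed.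

Lemma rev_sum (F : nat -> R) : \sum_(j < n.+1) F (n - j)%N = \sum_(m < n.+1) F m.
Proof.
rewrite [RHS](reindex_inj rev_ord_inj) /=; apply: eq_bigr => j _.
by rewrite subSS.
Qed.

Lemma steiner_scoef K V : convex_body K -> steiner_coefficients K V ->
  forall j, (j <= n)%N -> V j = scoef K (inord (n - j)) / kappa R (n - j).
Proof.
move=> bK SV j jn.
pose c (m : 'I_n.+1) := kappa R m * V (n - m)%N.
have H : forall i : 'I_n.+1, fvol K i%:R = \sum_(m < n.+1) c m * i%:R ^+ m.
  move=> i; have := SV i%:R (ler0n _ _).
  rewrite volE; last by have [] := convex_body_parallel i%:R bK.
  move=> [] E; rewrite /fvol E -(rev_sum (fun m => kappa R m * V (n - m)%N * i%:R ^+ m)).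
  by apply: eq_bigr => k _; rewrite subKn// -ltnS.
have := interpE H (inord (n - j)).
rewrite -/(scoef K _) => <-; rewrite /c inordK ?ltnS ?leq_subr// subKn//.
by rewrite mulrAC mulfV ?mul1r// gt_eqF// kappa_gt0.
Qed.

Lemma steiner_exists K : convex_body K -> steiner_coefficients K
  (fun j => scoef K (inord (n - j)) / kappa R (n - j)).
Proof.
move=> bK e e0; rewrite volE; last by have [] := convex_body_parallel e bK.
congr EFin; rewrite -/(fvol K e) fvolE//.
pose F m := scoef K (inord m) * e ^+ m.
transitivity (\sum_(m < n.+1) F m); first by apply: eq_bigr => m _; rewrite /F inord_val.
rewrite -rev_sum; apply: eq_bigr => j _; rewrite /F.
by rewrite mulrCA mulfV ?mulr1// gt_eqF// kappa_gt0.
Qed.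

(** [xget] may pick any [V] satisfying Steiner's formula. All of them agree for j <= n, since values
    determine a polynomial and [kappa] is positive. *)
Lemma intrinsic_volumeE K j : convex_body K -> (j <= n)%N ->
  intrinsic_volume j K = scoef K (inord (n - j)) / kappa R (n - j).
Proof.
move=> bK jn; rewrite /intrinsic_volume; case: xgetP => [V _ SV|].
  exact: steiner_scoef.
by move=> /(_ _ (steiner_exists bK)).
Qed.

(** * Intrinsic volumes as monotone valuations *)

Local Notation iv := (@intrinsic_volume R n).

Lemma iv_steiner K e : convex_body K -> 0 <= e ->
  fvol K e = \sum_(j < n.+1) kappa R (n - j) * iv j K * e ^+ (n - j).
Proof.
move=> bK e0; have := steiner_exists bK e0.
rewrite volE; last by have [] := convex_body_parallel e bK.
move=> [] E; rewrite /fvol E; apply: eq_bigr => j _.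
by rewrite -intrinsic_volumeE// -ltnS.
Qed.

Lemma iv_unique K (V : nat -> R) : convex_body K -> (forall e, 0 <= e ->
    fvol K e = \sum_(j < n.+1) kappa R (n - j) * V j * e ^+ (n - j)) ->
  forall j, (j <= n)%N -> iv j K = V j.
Proof.
move=> bK H j jn; rewrite intrinsic_volumeE//; apply/esym; apply: steiner_scoef => //.
move=> e e0; rewrite volE; last by have [] := convex_body_parallel e bK.
by congr EFin; exact: H.
Qed.

Lemma iv_interp K j : convex_body K -> (j <= n)%N ->
  iv j K = \sum_i interp n (inord (n - j)) i / kappa R (n - j) * fvol K i%:R.
Proof.
move=> bK jn; rewrite intrinsic_volumeE// /scoef mulr_suml.
by apply: eq_bigr => i _; rewrite mulrAC.
Qed.

Lemma closed_line (A : set 'rV[R]_n) x y : compact A ->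
  closed [set t : R | A ((1 - t) *: x + t *: y)].
Proof.
move=> cA.
apply: (@preimage_closedT _ _ (fun t : R => (1 - t) *: x + t *: y) A _ (compact_row_closed cA)).
apply: mx_continuous => i j; under eq_fun do rewrite !mxE.
move=> t; apply: cvgD; apply: cvgMl; last exact: cvg_id.
by apply: cvgB; [exact: cvg_cst|exact: cvg_id].
Qed.

(** Take the last parameter at which the segment is in [A]. Its point is in [A] by closedness, and
    in [B] either as the endpoint [y] or as a limit of later points, which convexity of the union
    places in [B]. *)
Lemma segment_crossing A B x y : compact A -> compact B -> cvx (A `|` B) -> A x -> B y ->
  exists2 t, 0 <= t <= 1 & (A `&` B) ((1 - t) *: x + t *: y).
Proof.
move=> cA cB vU Ax By; pose g t := (1 - t) *: x + t *: y.
pose T := [set t | 0 <= t <= 1 /\ A (g t)].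
have T0 : T 0 by split; [rewrite lexx ler01|rewrite /g subr0 scale1r scale0r addr0].
have Tub : ubound T 1 by move=> t [/andP[]].
have sT : has_sup T by split; [exists 0|exists 1].
pose s := sup T.
have s0 : 0 <= s by apply: ub_le_sup => //; exists 1.
have s1 : s <= 1 by apply: ge_sup => //; exists 0.
have As : A (g s).
  apply: (@closed_line A x y cA) => U /nbhs_ballP[e /= e0 eU].
  have [t Tt st] := sup_adherent e0 sT.
  exists t; split; first by case: Tt.
  apply: eU; rewrite /ball /=.
  have ts : t <= s by apply: ub_le_sup => //; exists 1.
  by rewrite ger0_norm ?subr_ge0// ltrBlDr -ltrBlDl.
exists s; first by rewrite s0.
split => //; have [<-|s1'] := eqVneq 1 s; first by rewrite subrr scale0r scale1r add0r.
have {}s1' : s < 1 by rewrite lt_neqAle eq_sym s1'.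
apply: (@closed_line B x y cB) => U /nbhs_ballP[e /= e0 eU].
pose d := Num.min (e / 2) (1 - s).
have d0 : 0 < d by rewrite lt_min divr_gt0// subr_gt0.
have d1 : d <= 1 - s by rewrite ge_min lexx orbT.
have de : d <= e / 2 by rewrite ge_min lexx.
exists (s + d); split; last first.
  by apply: eU; rewrite /ball /= opprD addNKr normrN gtr0_norm//; lra.
have sd : 0 <= s + d <= 1 by apply/andP; split; lra.
have [AA|//] := vU x y _ (or_introl Ax) (or_intror By) sd.
have : s + d <= s by apply: ub_le_sup => //; exists 1.
by lra.
Qed.

Lemma parallelU A B e : parallel_body (A `|` B) e = parallel_body A e `|` parallel_body B e.
Proof.
apply/seteqP; split => [_ [x [Ax|Bx] [b Bb <-]]|_ [[x Ax [b Bb <-]]|[x Bx [b Bb <-]]]].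
- by left; exists x => //; exists b.
- by right; exists x => //; exists b.
- by exists x; [left|exists b].
- by exists x; [right|exists b].
Qed.

(** A common point is x + e b = y + e b'. If (1-t) x + t y lies in both sets, the same combination
    of the two representations places the point in the parallel body of the intersection. *)
Lemma parallelI A B e : compact A -> compact B -> cvx (A `|` B) ->
  parallel_body (A `&` B) e = parallel_body A e `&` parallel_body B e.
Proof.
move=> cA cB vU; apply/seteqP; split => [_ [x [Ax Bx] [b Bb <-]]|].
  by split; exists x => //; exists b.
move=> _ [[x Ax [b Bb <-]] [y By [b' Bb' E]]].
have [t t01 ABt] := segment_crossing cA cB vU Ax By.
exists ((1 - t) *: x + t *: y) => //; exists ((1 - t) *: b + t *: b').
  exact: cvx_unit_ball.
have -> : x + e *: b = (1 - t) *: (x + e *: b) + t *: (y + e *: b').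
  by rewrite E -scalerDl subrK scale1r.
by apply/rowP => i; rewrite !mxE; ring.
Qed.

Lemma fvol_valuation e : valuation (fvol ^~ e).
Proof.
split => [A bA|A B bA bB AB|A B bA bB vU|a A bA]; rewrite /fvol.
- exact: vol_ge0.
- apply: vol_le; [by have [] := convex_body_parallel e bA|by have [] := convex_body_parallel e bB|].
  by move=> _ [x /AB Bx [b Bb <-]]; exists x => //; exists b.
- have [cA _] := bA; have [cB _] := bB.
  rewrite parallelU parallelI//; apply: vol_modular.
    by have [] := convex_body_parallel e bA.
  by have [] := convex_body_parallel e bB.
- by rewrite parallel_shift vol_shift//; have [] := convex_body_parallel e bA.
Qed.

Lemma iv_valuation j : (j <= n)%N -> valuation (iv j).
Proof.
move=> jn.
have k0 : 0 <= (kappa R (n - j))^-1 by rewrite invr_ge0 ltW// kappa_gt0.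
split => [A bA|A B bA bB AB|A B bA bB vU|a A bA].
- by rewrite intrinsic_volumeE// mulr_ge0// scoef_ge0.
- by rewrite !intrinsic_volumeE// ler_wpM2r// scoef_le.
- have bU : convex_body (A `|` B).
    by have [cA _] := bA; have [cB _] := bB; split=> //; exact: compactU_row.
  have bI := convex_bodyI bA bB.
  rewrite !iv_interp// -!big_split /=; apply: eq_bigr => i _.
  by rewrite -!mulrDr (val_modular (fvol_valuation i%:R) bA bB vU).
- have bs := convex_body_shift a bA.
  rewrite !iv_interp//; apply: eq_bigr => i _.
  by rewrite (val_shift (fvol_valuation i%:R)).
Qed.

Lemma convex_body_lin_image (M : 'M[R]_n) A : convex_body A -> convex_body (lin_image M A).
Proof.
move=> [cA vA]; split; first exact: compact_lin_image.
move=> _ _ t [x Ax <-] [y Ay <-] t01.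
by exists ((1 - t) *: x + t *: y); [exact: vA|rewrite mulmxDl !scalemxAl].
Qed.

Lemma iv_isometry (M : 'M[R]_n) A j : isometry M -> convex_body A -> (j <= n)%N ->
  iv j (lin_image M A) = iv j A.
Proof.
move=> iM bA jn; have bM := convex_body_lin_image M bA.
rewrite !iv_interp//; apply: eq_bigr => i _; rewrite /fvol parallel_lin_image//.
by rewrite vol_isometry//; have [] := convex_body_parallel i%:R bA.
Qed.

Lemma convex_body_scale (s : R) A : convex_body A -> convex_body [set s *: x | x in A].
Proof.
move=> [cA vA]; split; first exact: compact_scale.
move=> _ _ t [x Ax <-] [y Ay <-] t01.
exists ((1 - t) *: x + t *: y); first exact: vA.
by apply/rowP => i; rewrite !mxE; ring.
Qed.

Lemma iv_scale s A j : 0 < s -> convex_body A -> (j <= n)%N ->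
  iv j [set s *: x | x in A] = s ^+ j * iv j A.
Proof.
move=> s0 bA jn; have bs := convex_body_scale s bA.
apply: (@iv_unique _ (fun j => s ^+ j * iv j A)) => // e e0.
have es0 : 0 <= e / s by rewrite divr_ge0// ltW.
have -> : fvol [set s *: x | x in A] e = s ^+ n * fvol A (e / s).
  rewrite /fvol -{1}(divfK (lt0r_neq0 s0) e) mulrC parallel_scale vol_scale//.
  by have [] := convex_body_parallel (e / s) bA.
rewrite iv_steiner// mulr_sumr; apply: eq_bigr => i _.
have -> : s ^+ n = s ^+ i * s ^+ (n - i) by rewrite -exprD subnKC// -ltnS.
rewrite expr_div_n; have : s ^+ (n - i) != 0 by rewrite expf_neq0// gt_eqF.
by move=> h; field.
Qed.

Lemma convex_body0 : convex_body (set0 : set 'rV[R]_n).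
Proof. by split; [exact: compact0|move=> x y t []]. Qed.

Lemma iv0 j : (j <= n)%N -> iv j set0 = 0.
Proof.
move=> jn; apply: (@iv_unique _ (fun=> 0)) => //; first exact: convex_body0.
move=> e e0; rewrite big1; last by move=> i _; rewrite mulr0 mul0r.
rewrite /fvol (_ : parallel_body _ _ = set0) ?vol0//.
by rewrite -subset0 => _ [x []].
Qed.

Lemma vol_ball e : 0 <= e -> vol [set e *: b | b in @unit_ball R n] = e ^+ n * kappa R n.
Proof.
rewrite le_eqVlt => /orP[/eqP <-|e0]; last by rewrite vol_scale//; exact: compact_unit_ball.
have -> : [set 0 *: b | b in @unit_ball R n] = cube 0.
  apply/seteqP; split => [_ [b _ <-] i|x x0].
    by rewrite scale0r mxE lexx.
  exists 0; first by rewrite /unit_ball /= dot0l.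
  by rewrite scale0r; apply/rowP => i; have := x0 i; rewrite mxE => /le_anti.
rewrite vol_cube//; case: n => [|k]; last by rewrite expr0n mul0r.
rewrite !expr0 mul1r kappaE -(expr0 1) -(@vol_cube R 0 1)//; congr vol.
by apply/seteqP; split => // x _; [rewrite /unit_ball /= /dot big_ord0|case].
Qed.

Lemma iv_point a j : (j <= n)%N -> iv j [set a] = (j == 0)%:R.
Proof.
move=> jn; apply: (@iv_unique _ (fun j => (j == 0)%:R)) => //; first exact: convex_body_set1.
move=> e e0; rewrite big_ord_recl subn0 mulr1 big1 ?addr0; last first.
  by move=> i _; rewrite mulr0 mul0r.
rewrite mulrC -vol_ball// /fvol.
rewrite -(@vol_shift _ n a [set e *: b | b in @unit_ball R n]); last first.
  by apply: compact_scale; exact: compact_unit_ball.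
congr vol; rewrite shift_image; apply/seteqP; split.
  by move=> _ [_ -> [b Bb <-]]; exists (e *: b); [exists b|rewrite addrC].
by move=> _ [_ [b Bb <-] <-]; exists a => //; exists b => //; rewrite addrC.
Qed.

End Body.
End Steiner.

(** * Cylinders and cones *)

Section Cylinder.
Variable R : realType.
Local Notation mu := (@lebesgue_measure R).
Local Notation iv := (@intrinsic_volume R _).
Implicit Types n : nat.

Definition embed n (K : set 'rV[R]_n) : set 'rV[R]_n.+1 := [set scons 0 y | y in K].

Definition axis n : 'rV[R]_n.+1 := scons 1 0.

Definition prodset n (a : R) (Q : set 'rV[R]_n) : set 'rV[R]_n.+1 :=
  [set z : 'rV[R]_n.+1 | - a <= z 0 ord0 <= a /\ Q (sbehead z)].

Lemma sbeheadD n (x y : 'rV[R]_n.+1) : sbehead (x + y) = sbehead x + sbehead y.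
Proof. by apply/rowP => i; rewrite !mxE. Qed.

Lemma sbeheadZ n c (x : 'rV[R]_n.+1) : sbehead (c *: x) = c *: sbehead x.
Proof. by apply/rowP => i; rewrite !mxE. Qed.

Lemma dot_behead n (x y : 'rV[R]_n.+1) :
  dot x y = x 0 ord0 * y 0 ord0 + dot (sbehead x) (sbehead y).
Proof.
rewrite /dot big_ord_recl; congr (_ + _).
by apply: eq_bigr => i _; rewrite !sbeheadE.
Qed.

Lemma compact_prodset n a (Q : set 'rV[R]_n) : compact Q -> compact (prodset a Q).
Proof.
move=> cQ; have [clQ [r r0 Qr]] := (compact_rowP Q).1 cQ.
apply/compact_rowP; split.
  have clI : closed (`[- a, a] : set R) by exact: itv_closed.
  have c1 : closed ((fun z : 'rV[R]_n.+1 => z 0 ord0) @^-1` `[- a, a]).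
    exact: preimage_closedT (@coord_cts _ _ _) clI.
  have c2 : closed (@sbehead R n @^-1` Q).
    exact: preimage_closedT (@sbehead_continuous _ _) clQ.
  by have := closedI c1 c2; congr closed.
exists (`|a| + r); first by rewrite addr_ge0.
move=> z [z0 Qz] i; case: (unliftP ord0 i) => [j ->|->].
  by rewrite -sbeheadE (le_trans (Qr _ Qz j))// lerDr.
rewrite -ler_norml in z0; rewrite (le_trans z0)// (le_trans (ler_norm a))//.
by rewrite lerDl.
Qed.

Lemma vol_prodset n a (Q : set 'rV[R]_n) : compact Q -> 0 <= a ->
  vol (prodset a Q) = 2 * a * vol Q.
Proof.
move=> cQ a0; pose D : set (measurableTypeR R) := `[- a, a]%classic.
have mD : measurable D by exact: measurable_itv.
suff E : volume (prodset a Q) = (2 * a * vol Q)%:E by rewrite /vol E.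
rewrite volumeS (eq_integral (fun x => (vol Q)%:E * (\1_D x)%:E)%E); last first.
  move=> x _; rewrite indicE; case: (boolP (x \in D)) => [|/negP] xD.
    rewrite mule1 -volE//; congr volume.
    move: xD; rewrite inE /D /= in_itv /= => xD.
    apply/seteqP; split=> y; first by rewrite /slice /prodset /= sconsK => -[].
    by rewrite /slice /prodset /= sconsK scons0.
  rewrite /= mule0 (_ : slice _ x = set0) ?volume0// -subset0 => y [].
  by rewrite scons0 => xa _; apply: xD; rewrite inE /D /= in_itv.
have h1 x : setT x -> (0 <= (\1_D x : R)%:E)%E by rewrite lee_fin.
have h2 : measurable_fun setT (fun x => (\1_D x : R)%:E).
  by apply/measurable_EFinP; exact: measurable_indic.
rewrite (ge0_integralZl_EFin mu measurableT h1 h2) ?vol_ge0//.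
rewrite integral_indic// setIT.
transitivity ((vol Q)%:E * mu (`[(- a)%R, a]%classic : set R))%E => //.
rewrite lebesgue_measure_itv /= lte_fin.
case: ltP => [_|h]; first by rewrite -EFinB -EFinM; congr EFin; ring.
have -> : a = 0 by lra.
by rewrite mule0 mulr0 mul0r.
Qed.

Lemma convex_body_embed n (K : set 'rV[R]_n) : convex_body K -> convex_body (embed K).
Proof.
move=> [cK vK]; split.
  by apply: compact_image cK; exact: scons_continuous_r.
move=> _ _ t [x Kx <-] [y Ky <-] t01; exists ((1 - t) *: x + t *: y); first exact: vK.
apply/rowP => i; case: (unliftP ord0 i) => [j ->|->].
  by rewrite rowD !rowZ !sconsS rowD !rowZ.
by rewrite rowD !rowZ !scons0 !mulr0 addr0.
Qed.

Lemma ballE n (r : R) : 0 <= r ->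
  [set r *: b | b in @unit_ball R n] = [set w | dot w w <= r ^+ 2].
Proof.
move=> r0; apply/seteqP; split => [_ [b Bb <-]|w /= wr].
  by rewrite /= dotZl dotZr mulrA -expr2 ler_piMr ?sqr_ge0.
have [r00|rn0] := eqVneq r 0.
  exists 0; first by rewrite /unit_ball /= dot0l ler01.
  rewrite scaler0; apply/esym/eqP; rewrite -dot_eq0 eq_le dot_ge0 andbT.
  by rewrite (le_trans wr)// r00 expr0n.
have {}r0 : 0 < r by rewrite lt0r rn0.
exists (r^-1 *: w); last by rewrite scalerA mulfV// scale1r.
rewrite /unit_ball /= dotZl dotZr mulrA -expr2 exprVn mulrC.
by rewrite ler_pdivrMr ?mul1r// exprn_gt0.
Qed.

Lemma slice_ball n e x : 0 <= e -> slice [set e *: b | b in @unit_ball R n.+1] x =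
  if `|x| <= e then [set Num.sqrt (e ^+ 2 - x ^+ 2) *: b | b in @unit_ball R n] else set0.
Proof.
move=> e0; rewrite ballE// /slice; apply/seteqP; split => [w|].
  rewrite /= dot_behead scons0 sconsK -expr2 => xw.
  have xe : x ^+ 2 <= e ^+ 2 by rewrite (le_trans _ xw)// lerDl dot_ge0.
  have -> : `|x| <= e.
    by rewrite -(@ler_pXn2r _ 2)// ?nnegrE// real_normK ?num_real.
  rewrite ballE ?sqrtr_ge0//= sqr_sqrtr ?subr_ge0//.
  by rewrite lerBrDl.
case: ifPn => xe; last exact: sub0set.
rewrite ballE ?sqrtr_ge0// => w /=.
have xe2 : x ^+ 2 <= e ^+ 2.
  by rewrite -[x ^+ 2]real_normK ?num_real// ler_pXn2r// nnegrE.
by rewrite sqr_sqrtr ?subr_ge0// lerBrDl dot_behead scons0 sconsK -expr2.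
Qed.

Lemma slice_parallel n (K : set 'rV[R]_n) e x : slice (parallel_body (embed K) e) x =
  [set y + w | y in K & w in slice [set e *: b | b in @unit_ball R n.+1] x].
Proof.
rewrite parallel_bodyE; apply/seteqP; split.
  move=> t [_ [y Ky <-] [z Bz E]].
  exists y => //; exists (sbehead z); last first.
    by rewrite -(sconsK x t) -E sbeheadD sconsK.
  rewrite /slice /=; have -> : scons x (sbehead z) = z; last exact: Bz.
  rewrite -[RHS]sconsE; congr scons.
  by rewrite -(scons0 x t) -E rowD scons0 add0r.
move=> _ [y Ky [w Bw <-]]; exists (scons 0 y); first by exists y.
exists (scons x w) => //; apply/rowP => i; case: (unliftP ord0 i) => [j ->|->].
  by rewrite rowD !sconsS rowD.
by rewrite rowD !scons0 add0r.
Qed.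

(** The section at height x is the parallel body of [K] of radius sqrt(e^2 - x^2). Its Steiner
    polynomial combines volumes of balls of that radius in dimensions n-j, and these are the
    sections of balls of radius [e] in dimensions n-j+1. Integrating them back gives [kappa] one
    dimension higher without evaluating an integral. *)
Lemma fvol_embed n (K : set 'rV[R]_n) e : convex_body K -> 0 <= e ->
  fvol (embed K) e = \sum_(j < n.+1) kappa R (n - j).+1 * iv j K * e ^+ (n - j).+1.
Proof.
move=> bK e0; have bE := convex_body_embed bK.
have iv_ge0 (j : 'I_n.+1) : 0 <= iv j K.
  have jn : (j <= n)%N by rewrite -ltnS.
  exact: (val_ge0 (iv_valuation R jn)).
have cB m : compact [set e *: b | b in @unit_ball R m].
  by apply: compact_scale; exact: compact_unit_ball.
apply: EFin_inj; rewrite /fvol -volE; last by have [] := convex_body_parallel e bE.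
rewrite volumeS.
pose G (x : measurableTypeR R) : \bar R := (\sum_(j < n.+1) (iv j K)%:E *
    volume (slice [set e *: b | b in @unit_ball R (n - j).+1] x))%E.
rewrite (eq_integral G); last first.
  move=> x _; rewrite /G; rewrite slice_parallel slice_ball//.
  under eq_bigr do rewrite slice_ball//.
  case: ifPn => xe; last first.
    rewrite (_ : [set _ | _ in _ & _ in _] = set0) ?volume0; last first.
      by rewrite -subset0 => _ [y _ [w []]].
    by rewrite big1// => j _; rewrite volume0 mule0.
  rewrite -parallel_bodyE volE; last by have [] := convex_body_parallel (Num.sqrt (e ^+ 2 - x ^+ 2)) bK.
  rewrite -/(fvol K _) iv_steiner ?sqrtr_ge0// -sumEFin; apply: eq_bigr => j _.
  rewrite volE; last by apply: compact_scale; exact: compact_unit_ball.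
  by rewrite vol_ball ?sqrtr_ge0// -EFinM; congr EFin; ring.
rewrite /G ge0_integral_sum//; last 2 first.
- move=> j; apply: measurable_funeM; exact: measurable_volume_slice.
- by move=> j x _; rewrite mule_ge0 ?lee_fin ?volume_ge0.
rewrite -sumEFin; apply: eq_bigr => j _.
rewrite ge0_integralZl_EFin//; last 2 first.
- by move=> x _; exact: volume_ge0.
- exact: measurable_volume_slice.
rewrite -volumeS volE// vol_ball// -EFinM; congr EFin; ring.
Qed.

Lemma iv_embed n (K : set 'rV[R]_n) j : convex_body K -> (j <= n)%N -> iv j (embed K) = iv j K.
Proof.
move=> bK jn; have bE := convex_body_embed bK.
rewrite (@iv_unique _ _ (embed K) (fun j => if (j <= n)%N then iv j K else 0))//.
- by rewrite jn.
- move=> e e0; rewrite fvol_embed// [RHS]big_ord_recr /= ltnn mulr0 mul0r addr0.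
  by apply: eq_bigr => i _; rewrite /= -ltnS ltn_ord subSn// -ltnS.
- exact: leqW.
Qed.

(** The left side is affine in [t], so only its slope is sought. The parallel body of the cylinder
    contains a prism of height 2 t over the parallel body of [K] and is contained in one of height 2
    (t + e); a bounded discrepancy leaves one possible slope. *)
Lemma fvol_cylinder n (K : set 'rV[R]_n) e t : convex_body K -> 0 <= e -> 0 <= t ->
  fvol (add_segment (embed K) (axis n) t) e = fvol (embed K) e + 2 * t * fvol K e.
Proof.
move=> bK e0; have bE := convex_body_embed bK.
pose M := add_segment (embed K) (axis n).
have cQ : compact (parallel_body K e) by have [] := convex_body_parallel e bK.
have cM t' : compact (parallel_body (M t') e).
  by have [] := convex_body_parallel e (convex_body_add_segment (axis n) t' bE).
have A t' : 0 <= t' -> fvol (M t') e = fvol (embed K) e + t' * (fvol (M 1) e - fvol (embed K) e).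
  by move=> t'0; exact: (add_segment_affine (axis n) (@fvol_valuation R n.+1 e) bE t'0).
have lo t' : 0 <= t' -> 2 * t' * fvol K e <= fvol (M t') e.
  move=> t'0; rewrite -vol_prodset//; apply: vol_le => //; first exact: compact_prodset.
  move=> z [z0 [y Ky [b Bb E]]].
  exists (scons 0 y + z 0 ord0 *: axis n).
    exists (scons 0 y); first by exists y.
    by exists (z 0 ord0) => //=; rewrite ler_norml.
  exists (scons 0 b); first by rewrite /unit_ball /= dot_behead scons0 mul0r add0r sconsK.
  apply/rowP => i; rewrite !rowD !rowZ; case: (unliftP ord0 i) => [j ->|->].
    by rewrite !sconsS mxE mulr0 addr0 -sbeheadE -E rowD rowZ.
  by rewrite !scons0 add0r mulr1 mulr0 addr0.
have up t' : 0 <= t' -> fvol (M t') e <= 2 * (t' + e) * fvol K e.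
  move=> t'0; rewrite -vol_prodset ?addr_ge0//.
  apply: vol_le => //; first exact: compact_prodset.
  move=> _ [_ [_ [y Ky <-] [r /= rt <-]] [b Bb <-]].
  have : dot b b <= 1 := Bb; rewrite dot_behead -expr2 => b1.
  split.
    rewrite !rowD !rowZ !scons0 add0r mulr1 -ler_norml.
    apply: le_trans (ler_normD _ _) _; apply: lerD => //.
    rewrite normrM (ger0_norm e0) ler_piMr//.
    rewrite -(@expr_le1 _ 2)// real_normK ?num_real// (le_trans _ b1)//.
    by rewrite lerDl dot_ge0.
  exists y => //; exists (sbehead b).
    by rewrite /unit_ball /= (le_trans _ b1)// lerDr sqr_ge0.
  by rewrite !sbeheadD !sbeheadZ !sconsK scaler0 addr0.
move=> t0; rewrite -/(M t) A//.
suff -> : fvol (M 1) e - fvol (embed K) e = 2 * fvol K e by ring.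
apply/le_anti/andP; split.
- apply: (@slope_le _ (fvol (embed K) e) _ (2 * e * fvol K e)) => t' t'0.
  by rewrite -A//; have := up t' t'0; rewrite mulrDr mulrDl; lra.
- apply: (@slope_le _ 0 _ (fvol (embed K) e)) => t' t'0.
  by rewrite -A// add0r; have := lo t' t'0; lra.
Qed.

Lemma iv_cylinder0 n (K : set 'rV[R]_n) t j : convex_body K -> 0 <= t -> (j <= n.+1)%N ->
  iv j (add_segment (embed K) (axis n) t) =
  iv j (embed K) + 2 * t * (if j is j'.+1 then iv j' K else 0).
Proof.
move=> bK t0 jn; have bE := convex_body_embed bK.
apply: (@iv_unique _ _ _ (fun j => iv j (embed K) +
  2 * t * (if j is j'.+1 then iv j' K else 0))) => //; first exact: convex_body_add_segment.
move=> e e0; rewrite fvol_cylinder// iv_steiner// [X in _ + _ * X]iv_steiner//.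
under [RHS]eq_bigr do rewrite mulrDr mulrDl.
rewrite [RHS]big_split /=; congr (_ + _).
rewrite [RHS]big_ord_recl /= !mulr0 mul0r add0r mulr_sumr.
by apply: eq_bigr => i _; rewrite subSS; ring.
Qed.

Lemma add_segment_shift n a (K : set 'rV[R]_n) s t : add_segment (shift a K) s t = shift a (add_segment K s t).
Proof.
apply/seteqP; split => [_ [x Kx [r rt <-]]|x [y Ky [r rt E]]].
  by exists (x - a) => //; exists r => //; rewrite addrAC.
exists (y + a); first by rewrite /shift /= addrK.
by exists r => //; rewrite addrAC E subrK.
Qed.

Lemma add_segment_lin_image n (M : 'M[R]_n) K s t : add_segment (lin_image M K) (s *m M) t = lin_image M (add_segment K s t).
Proof.
apply/seteqP; split => [_ [_ [x Kx <-] [r rt <-]]|_ [_ [x Kx [r rt <-]] <-]].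
  by exists (x + r *: s); [exists x => //; exists r|rewrite mulmxDl scalemxAl].
by exists (x *m M); [exists x|exists r => //; rewrite mulmxDl scalemxAl].
Qed.

Lemma dot_axis n (x : 'rV[R]_n.+1) : dot (axis n) x = x 0 ord0.
Proof. by rewrite dot_behead scons0 sconsK dot0l mul1r addr0. Qed.

(** A translation into the hyperplane through 0 and a reflection taking [u] to the first axis reduce
    this to [iv_cylinder0]; [iv_embed] removes the change of dimension. *)
Lemma iv_cylinder n (M : set 'rV[R]_n.+1) u c t j : convex_body M -> dot u u = 1 ->
  (forall x, M x -> dot u x = c) -> 0 <= t -> (j <= n.+1)%N ->
  iv j (add_segment M u t) = iv j M + 2 * t * (if j is j'.+1 then iv j' M else 0).
Proof.
move=> bM u1 Mc t0 jn.
pose M1 := shift (- (c *: u)) M; have bM1 : convex_body M1 by exact: convex_body_shift.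
pose H := householder (u - axis n); have iH : isometry H by exact: isometry_householder.
have uH : u *m H = axis n by apply: householder_swap; rewrite dot_axis scons0 u1.
pose M2 := lin_image H M1; have bM2 : convex_body M2 by exact: convex_body_lin_image.
have M20 x : M2 x -> x 0 ord0 = 0.
  move=> [y M1y <-]; rewrite -dot_axis -uH; have [_ ->] := iH.
  by have := Mc _ M1y; rewrite opprK dotDr dotZr u1 mulr1 => /eqP; rewrite -subr_eq0 addrK => /eqP.
pose K := @sbehead R n @` M2.
have bK : convex_body K.
  split; first by apply: compact_image; [exact: sbehead_continuous|case: bM2].
  move=> _ _ s [x Mx <-] [y My <-] s01; exists ((1 - s) *: x + s *: y).
    by case: bM2 => _; exact.
  by rewrite sbeheadD !sbeheadZ.
have EK : embed K = M2.
  apply/seteqP; split => [_ [_ [x Mx <-] <-]|x Mx].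
    by rewrite -(M20 x Mx) sconsE.
  by exists (sbehead x); [exists x|rewrite -(M20 x Mx) sconsE].
have iM i : (i <= n.+1)%N -> iv i M2 = iv i M.
  by move=> i_n; rewrite /M2 iv_isometry// (val_shift (iv_valuation R i_n)).
have <- : iv j (add_segment M2 (axis n) t) = iv j (add_segment M u t).
  rewrite -uH add_segment_lin_image iv_isometry//; last exact: convex_body_add_segment.
  by rewrite add_segment_shift (val_shift (iv_valuation R jn))//; exact: convex_body_add_segment.
rewrite -EK iv_cylinder0// EK iM//; congr (_ + _ * _).
case: j jn => // j jn; rewrite -(@iM j) 1?ltnW// -EK iv_embed//.
Qed.

Lemma le0_of_small (x q : R) : (forall t, 0 < t -> t < 1 -> x <= t * q) -> x <= 0.
Proof.
move=> H; rewrite leNgt; apply/negP => x0.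
have q0 : 0 < q.
  have h : x <= 1 / 2 * q by apply: H; lra.
  by lra.
pose t := x / (2 * (x + q)).
have xq : 0 < 2 * (x + q) by lra.
have t0 : 0 < t by rewrite divr_gt0.
have tE : t * (2 * (x + q)) = x by rewrite /t divfK// gt_eqF.
have t1 : t < 1 by rewrite ltr_pdivrMr// mul1r; lra.
have := H t t0 t1; nra.
Qed.

Lemma add_segmentN n (K : set 'rV[R]_n) s t : add_segment K (- s) t = add_segment K s t.
Proof.
apply/seteqP; split => _ [x Kx [r /= rt <-]]; exists x => //;
  (exists (- r); first by rewrite /= normrN); apply/rowP => i; rewrite !mxE; ring.
Qed.

(* The reflection in the hyperplane carries [-a, a] to [-b, b] where [a + b] is
   normal, so the slopes along a and b agree and dominate half of that along
   the normal. *)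
Lemma iv_oblique n (M : set 'rV[R]_n.+1) u c a j : convex_body M -> dot u u = 1 ->
  (forall x, M x -> dot u x = c) -> (j <= n)%N ->
  iv j.+1 M + 2 * `|dot u a| * iv j M <= iv j.+1 (add_segment M a 1).
Proof.
move=> bM u1 Mc jn.
have jn1 : (j.+1 <= n.+1)%N by [].
have vj := iv_valuation R jn1.
wlog c0 : c M bM Mc / c = 0.
  move=> WH; pose M1 := shift (- (c *: u)) M; have bM1 : convex_body M1 by exact: convex_body_shift.
  have := WH 0 M1 bM1 _ erefl.
  rewrite /M1 add_segment_shift !(val_shift vj)//; last exact: convex_body_add_segment.
  rewrite (val_shift (iv_valuation R (leqW jn)))//; apply=> x /Mc.
  by rewrite opprK dotDr dotZr u1 mulr1 => /eqP; rewrite -subr_eq0 addrK => /eqP.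
pose h := dot u a; pose b := (2 * h) *: u - a.
pose phi := fun K : set 'rV[R]_n.+1 => iv j.+1 K.
have ref : phi (add_segment M b 1) = phi (add_segment M a 1).
  have iH : isometry (householder u) by exact: isometry_householder.
  have -> : b = - (a *m householder u) by rewrite mul_householder u1 divr1 opprB (dotC a).
  have HM : lin_image (householder u) M = M.
    have fixM x : M x -> x *m householder u = x.
      by move=> /Mc; rewrite mul_householder dotC c0 => ->; rewrite mulr0 mul0r scale0r subr0.
    apply/seteqP; split => [_ [x Mx <-]|x Mx]; first by rewrite fixM.
    by exists x => //; exact: fixM.
  rewrite add_segmentN -{1}HM add_segment_lin_image /phi iv_isometry//; exact: convex_body_add_segment.
pose D := phi (add_segment M a 1) - phi M.
pose C := phi (add_segment (add_segment M a 1) b 1).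
have G t : 0 <= t -> phi (add_segment (add_segment M a t) b t) =
    phi M + 2 * t * D + t ^+ 2 * (C - phi M - 2 * D).
  move=> t0; rewrite /phi (add_segment_affine b vj (convex_body_add_segment a t bM) t0).
  rewrite (add_segment_affine a vj bM t0) (add_segmentC M a t b 1).
  rewrite (add_segment_affine a vj (convex_body_add_segment b 1 bM) t0) (add_segmentC M b 1 a 1).
  rewrite /phi in ref; rewrite ref /C /D /phi.
  by move: (iv j.+1 M) (iv j.+1 (add_segment M a 1)) (iv j.+1 (add_segment (add_segment M a 1) b 1)) => ? ? ?; ring.
(* As a + b = 2 h u, the two segments of parameter [t] together contain [-2 t h u, 2 t h u], the
   segment of a right cylinder. Comparison with [G] to first order in [t] then bounds [D]. *)
have lo t : 0 <= t -> phi M + 2 * (2 * `|h| * t) * iv j M <= phi (add_segment (add_segment M a t) b t).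
  move=> t0; have ht0 : 0 <= 2 * `|h| * t by rewrite !mulr_ge0.
  have := iv_cylinder bM u1 Mc ht0 jn1; rewrite /= => <-.
  apply: (val_le vj); [exact: convex_body_add_segment|by apply: convex_body_add_segment; exact: convex_body_add_segment|].
  move=> _ [x Mx [r /= rh <-]].
  have [q qt rq] : exists2 q, `|q| <= t & r = q * (2 * h).
    have [h0|h0] := eqVneq h 0.
      exists 0; first by rewrite normr0.
      by move: rh; rewrite h0 normr0 mulr0 !mul0r normr_le0 => /eqP.
    have h20 : 2 * h != 0 by rewrite mulf_neq0.
    exists (r / (2 * h)); last by rewrite divfK.
    rewrite normrM normfV ler_pdivrMr ?normr_gt0//.
    by move: rh; rewrite [`|2 * h|]normrM normr_nat (mulrC t).
  exists (x + q *: a); first by exists x => //; exists q.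
  exists q => //; rewrite rq /b; apply/rowP => i; rewrite !mxE; ring.
suff H : 4 * `|h| * iv j M - 2 * D <= 0.
  move: H; rewrite /D -/h -/(phi M) -/(phi (add_segment M a 1)).
  by move: (phi M) (phi (add_segment M a 1)) (iv j M) => m1 m2 m3; clear; lra.
apply: (@le0_of_small _ (C - phi M - 2 * D)) => t t0 _.
have := lo t (ltW t0); rewrite (G t (ltW t0)) => H.
rewrite -(ler_pM2l t0); move: H; rewrite expr2.
by move: (phi M) (iv j M) => m1 m2; clear; lra.
Qed.

(** The part of the cone with apex 0 over [K] between the scales [lo] and [hi]: scales 0 and 1 give
    the cone, [s] and 1 the frustum. *)
Definition coneset n (K : set 'rV[R]_n) (lo hi : R) : set 'rV[R]_n :=
  [set z | exists s x, [/\ lo <= s <= hi, K x & z = s *: x]].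

Lemma convex_body_coneset n (K : set 'rV[R]_n) lo hi : 0 <= lo -> convex_body K -> convex_body (coneset K lo hi).
Proof.
move=> lo0 [cK vK]; split.
  rewrite (_ : coneset K lo hi =
      (fun p : R * 'rV[R]_n => p.1 *: p.2) @` (`[lo, hi]%classic `*` K)); last first.
    apply/seteqP; split => [_ [s [x [sl Kx ->]]]|_ [[s x] [/= sl Kx] <-]].
      by exists (s, x) => //=; split => //=; rewrite in_itv.
    by exists s, x; split => //; move: sl; rewrite in_itv.
  apply: compact_image; last by apply: compact_setX => //; exact: segment_compact.
  apply: mx_continuous => i j; under eq_fun do rewrite mxE.
  have c1 : continuous (fun p : R * 'rV[R]_n => p.1 : R) by move=> p; exact: cvg_fst.
  have c2 : continuous (fun p : R * 'rV[R]_n => p.2 i j : R).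
    move=> p; apply: (@continuous_comp _ _ _ snd (fun x : 'rV[R]_n => x i j)).
      exact: cvg_snd.
    exact: coord_continuous.
  by move=> p; exact: (cvgM (c1 p) (c2 p)).
move=> _ _ t [s [x [/andP[s0 s1] Kx ->]]] [s' [x' [/andP[s'0 s'1] Kx' ->]]] /andP[t0 t1].
pose q := (1 - t) * s + t * s'.
have sp : 0 <= s := le_trans lo0 s0.
have s'p : 0 <= s' := le_trans lo0 s'0.
have t1' : 0 <= 1 - t by lra.
have qlh : lo <= q <= hi by rewrite /q; apply/andP; split; nra.
have p1 : 0 <= (1 - t) * s by exact: mulr_ge0.
have p2 : 0 <= t * s' by exact: mulr_ge0.
have [q0|q0] := eqVneq q 0.
  exists q, x; split => //; rewrite q0 scale0r !scalerA.
  have -> : (1 - t) * s = 0 by move: q0; rewrite /q; lra.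
  have -> : t * s' = 0 by move: q0; rewrite /q; lra.
  by rewrite !scale0r addr0.
have qp : 0 < q by rewrite lt0r q0 /q addr_ge0.
exists q, ((1 - t * s' / q) *: x + (t * s' / q) *: x'); split => //.
  apply: vK => //; rewrite divr_ge0 ?(ltW qp)//= ler_pdivrMr// mul1r.
  by rewrite /q lerDr.
have e : q * (t * s' / q) = t * s' by rewrite mulrC divfK.
rewrite scalerDr !scalerA e mulrBr mulr1 e; congr (_ *: _ + _ *: _).
by rewrite /q addrK.
Qed.

Lemma bernoulli_le (s : R) k : 0 <= s <= 1 -> 1 - k%:R * (1 - s) <= s ^+ k.
Proof.
move=> /andP[s0 s1]; elim: k => [|k IH]; first by rewrite mul0r subr0 expr0.
rewrite exprS -natr1.
have k0 : 0 <= k%:R :> R by [].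
have : s * (1 - k%:R * (1 - s)) <= s * s ^+ k by rewrite ler_wpM2l.
have : 0 <= k%:R * (1 - s) * (1 - s) by rewrite !mulr_ge0// subr_ge0.
move: (s ^+ k) (k%:R) => p q h1 h2; nra.
Qed.

(* The cone C over K with apex 0 is the union of s C and of a frustum which contains
   a translate of the oblique cylinder s K + [0, (1 - s) k]; let s tend to 1. *)
Lemma iv_cone0 n (K : set 'rV[R]_n.+1) u c j : convex_body K -> dot u u = 1 ->
  (forall x, K x -> dot u x = c) -> (j <= n)%N ->
  `|c| * iv j K <= j.+1%:R * iv j.+1 (coneset K 0 1).
Proof.
move=> bK u1 Kc jn; have jn1 : (j.+1 <= n.+1)%N by [].
have vj := iv_valuation R jn1; have vj0 := iv_valuation R (leqW jn).
pose C := coneset K 0 1; have bC : convex_body C by exact: convex_body_coneset.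
have C0 : 0 <= iv j.+1 C := val_ge0 vj bC.
have K0 : 0 <= iv j K := val_ge0 vj0 bK.
have [c0|c0] := eqVneq c 0; first by rewrite c0 normr0 mul0r mulr_ge0.
have [[k0 Kk0]|nK] := pselect (exists x, K x); last first.
  have -> : K = set0 by rewrite -subset0 => x Kx; apply: nK; exists x.
  by rewrite iv0 ?leqW// mulr0 mulr_ge0//; apply: (val_ge0 vj); apply: convex_body_coneset => //; exact: convex_body0.
suff H s : 0 < s -> s < 1 -> s ^+ j * (`|c| * iv j K) <= j.+1%:R * iv j.+1 C.
  rewrite -subr_le0; apply: (@le0_of_small _ (j%:R * (`|c| * iv j K))) => t t0 t1.
  have s0 : 0 < 1 - t by lra.
  have s1 : 1 - t < 1 by lra.
  have := H _ s0 s1.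
  have s01 : 0 <= 1 - t <= 1 by lra.
  have cK0 : 0 <= `|c| * iv j K by rewrite mulr_ge0.
  have := ler_wpM2r cK0 (bernoulli_le j s01).
  rewrite opprB addrCA subrr addr0 mulrBl mul1r => h1 h2.
  by have := le_trans h1 h2; rewrite (mulrC j%:R t) -[t * _ * _]mulrA; lra.
move=> s0 s1; pose F := coneset K s 1.
have bF : convex_body F by apply: convex_body_coneset => //; exact: ltW.
pose sC := [set s *: x | x in C]; have bsC : convex_body sC by exact: convex_body_scale.
pose sK := [set s *: x | x in K]; have bsK : convex_body sK by exact: convex_body_scale.
have UC : sC `|` F = C.
  apply/seteqP; split => [z [[_ [r [x [/andP[r0 r1] Kx ->]]] <-]|[r [x [/andP[r0 r1] Kx ->]]]]|].
  - exists (s * r), x; split => //; last by rewrite scalerA.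
    by rewrite mulr_ge0 ?(ltW s0)//= mulr_ile1// ltW.
  - by exists r, x; split => //; rewrite r1 andbT (le_trans _ r0)// ltW.
  - move=> z [r [x [/andP[r0 r1] Kx ->]]].
    have [rs|sr] := leP r s.
      left; exists ((r / s) *: x).
        exists (r / s), x; split => //.
        by rewrite divr_ge0 ?(ltW s0)//= ler_pdivrMr// mul1r.
      by rewrite scalerA mulrC divfK// gt_eqF.
    by right; exists r, x; split => //; rewrite r1 andbT ltW.
have IC : sC `&` F = sK.
  apply/seteqP; split => [z [[_ [r [x [/andP[r0 r1] Kx ->]]] <-] [r' [x' [/andP[r'0 r'1] Kx' E]]]]|_ [x Kx <-]].
    have : s * r * c = r' * c by rewrite -{1}(Kc x Kx) -(Kc x' Kx') -!dotZr -scalerA E.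
    move=> /(mulIf c0) srr'.
    have r's : r' = s.
      apply/le_anti; rewrite r'0 andbT -srr' -[leRHS]mulr1 ler_wpM2l// ltW//.
    by exists x' => //; rewrite E r's.
  split; last by exists s, x; split => //; rewrite lexx ltW.
  by exists x => //; exists 1, x; rewrite scale1r ler01 lexx.
have vU : cvx (sC `|` F) by rewrite UC; case: bC.
have := val_modular vj bsC bF vU; rewrite UC IC iv_scale// => mod.
(* The centred segment spanned by ((1 - s)/2) k0, translated by that vector, is [0, (1 - s) k0]; the
   factor 2 in [iv_oblique] restores the full height (1 - s) |c|. *)
have ob := iv_oblique (((1 - s) / 2) *: k0) bsK u1 (c := s * c).
have {}ob : iv j.+1 sK + 2 * `|dot u (((1 - s) / 2) *: k0)| * iv j sK <= iv j.+1 F.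
  have sKc x : sK x -> dot u x = s * c by move=> [y Ky <-]; rewrite dotZr Kc.
  apply: le_trans (ob j sKc jn) _.
  pose a := ((1 - s) / 2) *: k0.
  have bp : convex_body (add_segment sK a 1) by exact: convex_body_add_segment.
  rewrite -(val_shift vj a bp); apply: (val_le vj) => //; first exact: convex_body_shift.
  move=> z [_ [x Kx <-] [r /= r1 E]].
  pose q := (1 + r) * ((1 - s) / 2).
  have q0 : 0 <= q by move: r1; rewrite ler_norml /q => /andP[h1 h2]; nra.
  have q1 : q <= 1 - s by move: r1; rewrite ler_norml /q => /andP[h1 h2]; nra.
  have sq : 0 < s + q by lra.
  exists (s + q), ((1 - q / (s + q)) *: x + (q / (s + q)) *: k0); split.
  - by apply/andP; split; lra.
  - have [_ vK] := bK; apply: vK => //.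
    by rewrite divr_ge0 ?(ltW sq)//= ler_pdivrMr// mul1r lerDr ltW.
  - have e : (s + q) * (q / (s + q)) = q by rewrite mulrC divfK// gt_eqF.
    rewrite scalerDr !scalerA e mulrBr mulr1 e addrK.
    have -> : z = (s *: x + r *: a) + a by rewrite E subrK.
    by apply/rowP => i; rewrite /a /q !mxE; ring.
rewrite dotZr Kc// normrM ger0_norm in ob; last by rewrite divr_ge0// subr_ge0 ltW.
rewrite (iv_scale s0 bK (leqW jn)) in ob.
have s01 : 0 <= s <= 1 by rewrite !ltW.
(* Source of the factor j+1: removing the copy s C leaves (1 - s^(j+1)) V(C), which is at most (j+1)
   (1 - s) V(C). *)
have := bernoulli_le j.+1 s01.
move: mod ob C0; rewrite -/C.
have : 0 < 1 - s by lra.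
set P := s ^+ j.+1; set Q := s ^+ j; set X := iv j.+1 C; set Y := iv j K.
set Z := iv j.+1 sK; set W := iv j.+1 F; set w := `|c|; set m := j.+1%:R.
move=> d0 mod ob X0 bn.
rewrite -(ler_pM2l d0).
have h1 : (1 - s) * (Q * (w * Y)) <= X - P * X by lra.
have h2 : X - P * X <= m * (1 - s) * X by have := ler_wpM2l X0 bn; lra.
apply: (le_trans h1); apply: (le_trans h2); rewrite mulrCA mulrA; lra.
Qed.

(** By convexity [S] contains the cone with apex [a] over [K]; the apex is translated to 0. *)
Lemma iv_cone n (S K : set 'rV[R]_n.+1) a u c j : convex_body S -> convex_body K -> K `<=` S -> S a ->
  dot u u = 1 -> (forall x, K x -> dot u x = c) -> (j <= n)%N ->
  `|dot u a - c| * iv j K <= j.+1%:R * iv j.+1 S.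
Proof.
move=> bS bK KS Sa u1 Kc jn; have jn1 : (j.+1 <= n.+1)%N by [].
have vj := iv_valuation R jn1; have vj0 := iv_valuation R (leqW jn).
pose K' := shift (- a) K; have bK' : convex_body K' by exact: convex_body_shift.
have K'c x : K' x -> dot u x = c - dot u a.
  by move=> /Kc; rewrite opprK dotDr => <-; rewrite addrK.
have := iv_cone0 bK' u1 K'c jn; rewrite (val_shift vj0)// -normrN opprB.
move=> /le_trans; apply; rewrite ler_wpM2l//.
have bC : convex_body (coneset K' 0 1) by exact: convex_body_coneset.
rewrite -(val_shift vj a bC); apply: (val_le vj) => //; first exact: convex_body_shift.
move=> z [s [x [s01 K'x E]]].
have [_ vS] := bS; have := vS a (x + a) s Sa _ s01; rewrite -/(shift (- a) S x).
have -> : (1 - s) *: a + s *: (x + a) = z.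
  have -> : z = s *: x + a by rewrite -E subrK.
  by apply/rowP => i; rewrite !mxE; ring.
by apply; apply: KS; move: K'x; rewrite /K' /shift /= opprK.
Qed.

(** The unit cube in the first [m] coordinates, the others being 0. One more coordinate makes a
    right cylinder of height 1, for which [iv_cylinder] is Pascal's rule. *)
Definition pcube n (m : nat) : set 'rV[R]_n :=
  [set x | forall i : 'I_n, 0 <= x 0 i <= (i < m)%:R].

Lemma pcubeS n (m : 'I_n) : @pcube n m.+1 =
  shift (2^-1 *: \row_j (j == m)%:R) (add_segment (@pcube n m) (\row_j (j == m)%:R) 2^-1).
Proof.
set e := \row_j _.
have em : e 0 m = 1 by rewrite mxE eqxx.
have ei i : i != m -> e 0 i = 0 by move=> /negPf im; rewrite mxE im.
apply/seteqP; split => [x xP|x [y yP [r /= rh E]] i].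
  exists (x - x 0 m *: e).
    move=> i; rewrite rowB rowZ; have [->|im] := eqVneq i m.
      by rewrite em mulr1 subrr ltnn lexx.
    rewrite ei// mulr0 subr0; have := xP i; rewrite ltnS leq_eqVlt.
    by rewrite (_ : (i == m :> nat) = false)//; apply/negbTE; exact: im.
  exists (x 0 m - 2^-1); last by apply/rowP => i; rewrite !mxE; ring.
  have := xP m; rewrite ltnSn (_ : true%:R = 1 :> R)// => /andP[h1 h2] /=.
  by rewrite ler_norml; apply/andP; split; lra.
have xE : x 0 i = y 0 i + (r + 2^-1) * e 0 i.
  have := congr1 (fun v : 'rV[R]_n => v 0 i) E; rewrite rowB rowD !rowZ => h.
  by rewrite mulrDl; lra.
rewrite xE; have := yP i; have [->|im] := eqVneq i m.
  rewrite em mulr1 ltnn ltnSn (_ : true%:R = 1 :> R)// => /le_anti <-; rewrite add0r.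
  by move: rh; rewrite ler_norml => /andP[h1 h2]; apply/andP; split; lra.
rewrite ei// mulr0 addr0 ltnS [(i <= m)%N]leq_eqVlt.
by rewrite (_ : (i == m :> nat) = false)//; apply/negbTE; exact: im.
Qed.

Lemma iv_pcube n (m j : nat) : (m <= n.+1)%N -> (j <= n.+1)%N ->
  convex_body (@pcube n.+1 m) /\ iv j (@pcube n.+1 m) = 'C(m, j)%:R.
Proof.
elim: m j => [|m IH] j mn jn.
  have -> : @pcube n.+1 0 = [set 0].
    apply/seteqP; split => [x xP|_ -> i]; last by rewrite mxE lexx.
    by apply/rowP => i; rewrite mxE; have := xP i; rewrite ltn0 => /le_anti.
  by split; [exact: convex_body_set1|rewrite iv_point// bin0n eq_sym].
pose m' := Ordinal mn; pose e : 'rV[R]_n.+1 := \row_j (j == m')%:R.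
have bm : convex_body (@pcube n.+1 m) by have [] := IH 0%N (ltnW mn) (leq0n _).
have bp : convex_body (add_segment (@pcube n.+1 m) e 2^-1) by exact: convex_body_add_segment.
rewrite (pcubeS m'); split; first exact: convex_body_shift.
rewrite (val_shift (iv_valuation R jn))//.
have de x : dot e x = x 0 m'.
  rewrite /dot (bigD1 m')//= mxE eqxx mul1r big1 ?addr0// => i /negPf im.
  by rewrite mxE im mul0r.
rewrite (@iv_cylinder _ _ e 0)//.
- have -> : 2 * 2^-1 = 1 :> R by rewrite mulfV.
  rewrite mul1r; case: j jn => [|j] jn.
    by have [_ ->] := IH 0%N (ltnW mn) jn; rewrite addr0 !bin0.
  have [_ ->] := IH j.+1 (ltnW mn) jn; have [_ ->] := IH j (ltnW mn) (ltnW jn).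
  by rewrite binS natrD addrC.
- by rewrite de mxE eqxx.
- by move=> x /(_ m'); rewrite de ltnn => /le_anti.
Qed.

Lemma iv_unit_cube n j : (j <= n.+1)%N ->
  convex_body (@unit_cube R n.+1) /\ iv j (@unit_cube R n.+1) = 'C(n.+1, j)%:R.
Proof.
move=> jn; have := @iv_pcube n n.+1 j (leqnn _) jn.
rewrite (_ : @pcube n.+1 n.+1 = unit_cube)//.
by apply/seteqP; split => x H i; have := H i; rewrite ltn_ord.
Qed.

End Cylinder.

(** * The search algorithm *)

Section SymmetricSearch.
Variables (R : realType) (n : nat).
Local Notation d := n.+1.
Local Notation iv := (@intrinsic_volume R d).
Local Notation cc := (cone_const R).
Implicit Types (S : set 'rV[R]_d) (u v w x : 'rV[R]_d).

(* S lies in no hyperplane. *)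
Definition full_width S := S !=set0 /\ forall w, dot w w = 1 ->
  exists x y, [/\ S x, S y & dot w x < dot w y].

Lemma cut_leE S p u : cut_le S p u = cut_ge S (- p) (- u).
Proof.
by apply/seteqP; split=> x [Sx h]; split=> //; move: h; rewrite dotNl lerN2.
Qed.

Lemma cut_eqE S p u : cut_eq S p u = cut_ge S p u `&` cut_le S p u.
Proof.
apply/seteqP; split=> x; first by move=> [Sx xp]; split; split; rewrite ?xp.
by move=> [[Sx h1] [_ h2]]; split => //; apply/le_anti; rewrite h1 h2.
Qed.

Lemma convex_body_cut_ge S p u : convex_body S -> convex_body (cut_ge S p u).
Proof.
move=> [cS vS]; split.
  have cl : closed [set x : 'rV[R]_d | p <= dot u x].
    have clI : closed [set y : R | p <= y] by exact: closed_ge.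
    exact: preimage_closedT (@dot_continuous _ _ u) clI.
  exact: compact_closedI cS cl.
move=> x y t [Sx px] [Sy py] /[dup] t01 /andP[t0 t1]; split; first exact: vS.
by rewrite dotDr !dotZr; nra.
Qed.

Lemma convex_body_cut_le S p u : convex_body S -> convex_body (cut_le S p u).
Proof. by rewrite cut_leE; exact: convex_body_cut_ge. Qed.

Lemma convex_body_cut_eq S p u : convex_body S -> convex_body (cut_eq S p u).
Proof. by move=> bS; rewrite cut_eqE; apply: convex_bodyI; [exact: convex_body_cut_ge|exact: convex_body_cut_le]. Qed.

Lemma iv_cut S p u j : convex_body S -> (j <= d)%N ->
  iv j (cut_ge S p u) + iv j (cut_le S p u) = iv j S + iv j (cut_eq S p u).
Proof.
move=> bS jd; have vj := iv_valuation R jd.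
have E : cut_ge S p u `|` cut_le S p u = S.
  apply/seteqP; split => [x [[]|[]]//|x Sx].
  by have [h|h] := leP p (dot u x); [left|right]; split => //; exact: ltW.
have bg := convex_body_cut_ge p u bS; have bl := convex_body_cut_le p u bS.
rewrite (val_modular vj bg bl); first by rewrite E cut_eqE.
by rewrite E; case: bS.
Qed.

(** [x0] is strictly inside the half-space. A point of [S] where [w] takes another value than at
    [x0] is pulled towards [x0] until it satisfies the cut, and the two values stay different. *)
Lemma full_width_cut_ge S p u x0 : convex_body S -> full_width S -> S x0 -> p < dot u x0 -> full_width (cut_ge S p u).
Proof.
move=> [_ vS] [_ fS] Sx0 px0; split; first by exists x0; split => //; exact: ltW.
move=> w w1; have [x [y [Sx Sy xy]]] := fS w w1.
have [z [Sz zw]] : exists z, S z /\ dot w z != dot w x0.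
  have [xx0|xx0] := eqVneq (dot w x) (dot w x0); last by exists x.
  by exists y; split => //; rewrite -xx0 gt_eqF.
have [m [[Sm pm] mw]] : exists m, cut_ge S p u m /\ dot w m != dot w x0.
  have [h|h] := leP p (dot u z); first by exists z.
  (* The parameter at which the segment from [x0] to [z] meets the cutting hyperplane. *)
  pose t := (dot u x0 - p) / (dot u x0 - dot u z).
  have den : 0 < dot u x0 - dot u z by lra.
  have t0 : 0 < t by rewrite divr_gt0// subr_gt0.
  have t1 : t <= 1 by rewrite ler_pdivrMr// mul1r; lra.
  have tE : t * (dot u x0 - dot u z) = dot u x0 - p by rewrite divfK// gt_eqF.
  exists ((1 - t) *: x0 + t *: z); split.
    split; first by apply: vS => //; rewrite (ltW t0).
    by rewrite dotDr !dotZr; lra.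
  rewrite dotDr !dotZr -subr_eq0.
  have -> : (1 - t) * dot w x0 + t * dot w z - dot w x0 = t * (dot w z - dot w x0) by ring.
  by rewrite mulf_neq0 ?subr_eq0// gt_eqF.
have c0 : cut_ge S p u x0 by split => //; exact: ltW.
have cm : cut_ge S p u m by [].
move: mw; rewrite neq_lt => /orP[lt|lt]; [by exists m, x0|by exists x0, m].
Qed.

Lemma full_width_cut_le S p u x0 : convex_body S -> full_width S -> S x0 -> dot u x0 < p -> full_width (cut_le S p u).
Proof. by move=> bS fS Sx0 h; rewrite cut_leE; apply: (full_width_cut_ge (x0 := x0)) => //; rewrite dotNl ltrN2. Qed.

Lemma widthP S u : convex_body S -> S !=set0 -> exists x y,
  [/\ S x, S y, forall z, S z -> dot u x <= dot u z <= dot u y &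
      width S u = dot u y - dot u x].
Proof.
move=> [cS _] S0.
have cu : {within S, continuous (fun z => dot u z)}.
  by apply: continuous_subspaceT; exact: dot_continuous.
have [y /set_mem Sy ymax] := compact_EVT_max S0 cS cu.
have [x /set_mem Sx xmin] := compact_EVT_min S0 cS cu.
have H z : S z -> dot u x <= dot u z <= dot u y.
  by move=> Sz; rewrite xmin ?ymax ?mem_set.
exists x, y; split => //; rewrite /width; congr (_ - _).
  apply/le_anti/andP; split.
    apply: ge_sup; first by exists (dot u y), y.
    by move=> _ [z /H/andP[_ h] <-].
  apply: ub_le_sup; last by exists y.
  by exists (dot u y) => _ [z /H/andP[_ h] <-].
apply/le_anti/andP; split.
  apply: ge_inf; last by exists x.
  by exists (dot u x) => _ [z /H/andP[h _] <-].
apply: lb_le_inf; first by exists (dot u x), x.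
by move=> _ [z /H/andP[h _] <-].
Qed.

Lemma root_pow (x : R) i : 0 <= x -> (x `^ i.+1%:R^-1) ^+ i.+1 = x.
Proof.
move=> x0; rewrite -powR_mulrn ?powR_ge0// -powRrM mulVf ?pnatr_eq0//.
exact: powRr1.
Qed.

Lemma cc_gt0 i : 0 < cc i.
Proof.
by case: i => [|i]; rewrite /cone_const ?ltr01// invr_gt0 mulr_gt0 ?exprn_gt0// ltr0n fact_gt0.
Qed.

(** The recursion behind [cone_const]: dividing the cone bound by i+2 leaves twice the next
    constant. *)
Lemma ccS i : cc i.+1 = (i.+2)%:R * (2 * cc i.+2).
Proof.
rewrite /cone_const [i.+2.-1]/= [i.+1.-1]/= exprS (factS i.+1) natrM.
have h1 : i.+1`!%:R != 0 :> R by rewrite pnatr_eq0 -lt0n fact_gt0.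
have h2 : (2 : R) ^+ i != 0 by rewrite expf_neq0// pnatr_eq0.
have h3 : i.+2%:R != 0 :> R by rewrite pnatr_eq0.
move: h1 h2 h3; move: (i.+1`!%:R : R) ((2 : R) ^+ i) (i.+2%:R : R) => a b c h1 h2 h3.
by field; rewrite h1 h2 h3.
Qed.

(** Of order i+1. On sections it is the finite value of [section_scale]; on knowledge sets it is a
    term of the potential. *)
Definition level i S : R := (iv i.+1 S / cc i.+1) `^ i.+1%:R^-1.

Lemma iv_ge0 j S : convex_body S -> (j <= d)%N -> 0 <= iv j S.
Proof. by move=> bS jd; exact: (val_ge0 (iv_valuation R jd)). Qed.

Lemma level_pow i S : convex_body S -> (i < d)%N -> level i S ^+ i.+1 = iv i.+1 S / cc i.+1.
Proof.
by move=> bS id; rewrite root_pow// divr_ge0// ?iv_ge0// ltW// cc_gt0.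
Qed.

Lemma level_ge0 i S : 0 <= level i S.
Proof. exact: powR_ge0. Qed.

Lemma le_level i S (a : R) : convex_body S -> (i < d)%N -> 0 <= a ->
  (level i S <= a) = (iv i.+1 S <= cc i.+1 * a ^+ i.+1).
Proof.
move=> bS id a0; rewrite -(@ler_pXn2r _ i.+1)// ?nnegrE ?level_ge0//.
by rewrite level_pow// ler_pdivrMr ?cc_gt0// mulrC.
Qed.

Lemma ge_level i S (a : R) : convex_body S -> (i < d)%N -> 0 <= a ->
  (a <= level i S) = (cc i.+1 * a ^+ i.+1 <= iv i.+1 S).
Proof.
move=> bS id a0; rewrite -(@ler_pXn2r _ i.+1)// ?nnegrE ?level_ge0//.
by rewrite level_pow// ler_pdivlMr ?cc_gt0// mulrC.
Qed.

Lemma iv_le j S S' : convex_body S -> convex_body S' -> (j <= d)%N -> S `<=` S' -> iv j S <= iv j S'.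
Proof. by move=> bS bS' jd SS'; exact: (val_le (iv_valuation R jd)). Qed.

(** Here [j] precedes the chosen index. One of the extreme points of [S] is at distance at least [h]
    from the section, and the cone from it gives the bound through [ccS]. For j = 0 the scale is
    infinite and says nothing; the cone over a minimal point with a maximal one as apex shows that
    V_1 is at least the width 2 h. *)
Lemma iv_lower S u j q (h := width S u / 2) : convex_body S -> S !=set0 -> dot u u = 1 ->
  0 < h -> (j < d)%N -> (h%:E <= section_scale j (cut_eq S q u))%E ->
  2 * cc j.+1 * h ^+ j.+1 <= iv j.+1 S.
Proof.
move=> bS S0 u1 h0 jd hL.
have [x [y [Sx Sy xy wE]]] := widthP u bS S0.
have hw : dot u y - dot u x = 2 * h by rewrite -wE /h; field.
case: j jd hL => [|j] jd hL.
  have Kx : [set x] `<=` S by move=> z ->.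
  have := @iv_cone R n S [set x] y u (dot u x) 0 bS (convex_body_set1 x) Kx Sy u1 _ (leq0n _).
  rewrite iv_point// mulr1 mul1r => H.
  have -> : cc 1 = 1 by rewrite /cone_const expr0 mul1r (_ : 1`! = 1%N)// invr1.
  rewrite mulr1 expr1.
  by rewrite -hw (le_trans (ler_norm _))//; apply: H => z ->.
set K := cut_eq S q u in hL.
have bK : convex_body K by exact: convex_body_cut_eq.
rewrite lee_fin -/(level j K) ge_level ?(ltW h0)// 1?ltnW// in hL.
have ivK : 0 < iv j.+1 K.
  by apply: lt_le_trans hL; rewrite mulr_gt0 ?cc_gt0// exprn_gt0.
have [z [Sz zq]] : exists z, K z.
  apply: contrapT => nK; move: ivK.
  have -> : K = set0 by rewrite -subset0 => z Kz; apply: nK; exists z.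
  by rewrite iv0 ?ltxx// ltnW.
have /andP[zx zy] := xy z Sz.
have [a [Sa ha]] : exists a, S a /\ h <= `|dot u a - q|.
  have [c|c] := leP h (dot u y - q).
    by exists y; split => //; rewrite (le_trans c)// ler_norm.
  exists x; split => //; rewrite distrC (le_trans _ (ler_norm _))//; lra.
have KS : K `<=` S by move=> ? [].
have jn : (j.+1 <= n)%N by [].
have := @iv_cone R n S K a u q j.+1 bS bK KS Sa u1 _ jn.
move=> /(_ (fun x Kx => proj2 Kx)) H.
have p0 : 0 < j.+2%:R :> R by rewrite ltr0n.
have E : j.+2%:R * (2 * cc j.+2 * h ^+ j.+2) = h * (cc j.+1 * h ^+ j.+1).
  by rewrite (ccS j) (exprS h j.+1); ring.
rewrite -(ler_pM2l p0) E; apply: le_trans H; apply: ler_pM => //; first exact: ltW.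
by rewrite mulr_ge0 ?exprn_ge0 ?(ltW h0)// ltW// cc_gt0.
Qed.

(** Each part equals (s + k)/2 with k <= s/2, whence 3/4. *)
Lemma balanced_bound (a b s k c : R) : a + b = s + k -> a = b -> k <= c ->
  2 * c <= s -> a <= 3 / 4 * s /\ b <= 3 / 4 * s.
Proof. by move=> h1 h2 h3 h4; split; lra. Qed.

(** Applied when [S] lies on one side of the cut: balance then equates the values of [S] and of the
    section, against the factor 2 between their bounds. *)
Lemma unbalanced (s k c : R) : s = k -> k <= c -> 2 * c <= s -> c <= 0.
Proof. by move=> h1 h2 h3; lra. Qed.

(** Here [j] is one less than the chosen index. Since balance puts [p] strictly between the extreme
    values of [u] on [S], the loss is at most the width 2 h, and both parts retain full width. *)
Lemma search_step S u p : convex_body S -> full_width S -> dot u u = 1 -> symmetric_search_guess S u p ->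
  exists j, (j < d)%N /\ exists h, [/\ 0 < h, width S u = 2 * h,
    (forall z, S z -> `|dot u z - p| <= 2 * h),
    2 * cc j.+1 * h ^+ j.+1 <= iv j.+1 S &
    [/\ iv j.+1 (cut_ge S p u) <= 3 / 4 * iv j.+1 S,
        iv j.+1 (cut_le S p u) <= 3 / 4 * iv j.+1 S,
        full_width (cut_ge S p u) & full_width (cut_le S p u)]].
Proof.
move=> bS fS u1 [q [j [bal jd hL Lh pq]]].
case: j jd hL Lh pq => [//|j] /= jd hL Lh pq.
have {}bal := bal j.+1 jd; rewrite -pq in bal Lh.
have [S0 fSu] := fS; pose h := width S u / 2.
have [x [y [Sx Sy xy wE]]] := widthP u bS S0.
have hw : dot u y - dot u x = 2 * h by rewrite -wE /h; field.
have h0 : 0 < h.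
  have [z [z' [Sz Sz' zz']]] := fSu u u1.
  by have /andP[h1 _] := xy z Sz; have /andP[_ h2] := xy z' Sz'; lra.
have lower := iv_lower bS S0 u1 h0 jd hL.
have bK : convex_body (cut_eq S p u) by exact: convex_body_cut_eq.
have upper : iv j.+1 (cut_eq S p u) <= cc j.+1 * h ^+ j.+1.
  by move: Lh; rewrite lee_fin -/(level j _) le_level// ltW.
have ch0 : 0 < cc j.+1 * h ^+ j.+1 by rewrite mulr_gt0 ?cc_gt0// exprn_gt0.
have val := iv_cut p u bS jd.
have lower' : 2 * (cc j.+1 * h ^+ j.+1) <= iv j.+1 S by rewrite mulrA.
have pmax : p < dot u y.
  rewrite ltNge; apply/negP => yp.
  have E1 : cut_ge S p u = cut_eq S p u.
    apply/seteqP; split => z [Sz zp]; (split; first exact: Sz); last by rewrite zp.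
    apply/le_anti; rewrite zp andbT; have /andP[_ h2] := xy z Sz.
    exact: le_trans h2 yp.
  have E2 : cut_le S p u = S.
    apply/seteqP; split => [z [Sz _]|z Sz]; first exact: Sz.
    split; first exact: Sz.
    by have /andP[_ h2] := xy z Sz; exact: le_trans h2 yp.
  rewrite E1 E2 in bal.
  by have := unbalanced (esym bal) upper lower'; rewrite leNgt ch0.
have pmin : dot u x < p.
  rewrite ltNge; apply/negP => px.
  have E1 : cut_le S p u = cut_eq S p u.
    apply/seteqP; split => z [Sz zp]; (split; first exact: Sz); last by rewrite zp.
    apply/le_anti; rewrite zp /=; have /andP[h1 _] := xy z Sz.
    exact: le_trans px h1.
  have E2 : cut_ge S p u = S.
    apply/seteqP; split => [z [Sz _]|z Sz]; first exact: Sz.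
    split; first exact: Sz.
    by have /andP[h1 _] := xy z Sz; exact: le_trans px h1.
  rewrite E1 E2 in bal.
  by have := unbalanced bal upper lower'; rewrite leNgt ch0.
exists j; split; first exact: jd.
have [le1 le2] := balanced_bound val bal upper lower'.
have near z : S z -> `|dot u z - p| <= 2 * h.
  move=> Sz; have /andP[h1 h2] := xy z Sz; rewrite -hw ler_norml opprB.
  rewrite lerBrDr lerBlDr; apply/andP; split.
    by rewrite -addrA [- _ + p]addrC; move: (ltW pmax) h1; clear; lra.
  by move: (ltW pmin) h2; clear; lra.
exists h; split; [exact: h0|by rewrite wE|exact: near|exact: lower|].
by split; [exact: le1|exact: le2|exact: (full_width_cut_ge bS fS Sy pmax)|exact: (full_width_cut_le bS fS Sx pmin)].
Qed.

(** * The potential and the total loss *)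

Definition potential S : R := \sum_(i < d) level i S.

Lemma level_le i S S' : convex_body S -> convex_body S' -> (i < d)%N -> S' `<=` S -> level i S' <= level i S.
Proof.
move=> bS bS' id SS'; rewrite le_level// ?level_ge0// level_pow//.
by rewrite mulrCA mulfV ?gt_eqF ?cc_gt0// mulr1; exact: iv_le.
Qed.

Lemma sum_drop m (f g : 'I_m -> R) (j : 'I_m) (e : R) : (forall i, g i <= f i) ->
  g j + e <= f j -> \sum_(i < m) g i + e <= \sum_(i < m) f i.
Proof.
move=> gf gfj; rewrite (bigD1 j)//= [leRHS](bigD1 j)//= addrAC lerD//.
by apply: ler_sum => i _.
Qed.

Lemma potential_drop S S' j h : convex_body S -> convex_body S' -> S' `<=` S -> (j < d)%N -> 0 < h ->
  2 * cc j.+1 * h ^+ j.+1 <= iv j.+1 S -> iv j.+1 S' <= 3 / 4 * iv j.+1 S ->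
  2 * h <= 8 * d%:R * (potential S - potential S').
Proof.
move=> bS bS' SS' jd h0 lo up.
have c0 := cc_gt0 j.+1.
have hl : h <= level j S.
  rewrite ge_level// ?(ltW h0)//; apply: le_trans lo.
  by rewrite -mulrA ler_peMl ?ler1n// mulr_ge0 ?exprn_ge0 ?ltW.
have j0 : 0 < j.+1%:R :> R by rewrite ltr0n.
(* With e = 1/(4 (j+1)), Bernoulli gives (1 - e)^(j+1) >= 3/4, so a factor 3/4 on the intrinsic
   volume lowers the level by at least the fraction [e], and e >= 1/(4 d). *)
have [e eE] : exists e : R, j.+1%:R * e = 4^-1.
  by exists (4^-1 / j.+1%:R); rewrite mulrC divfK// gt_eqF.
have e0 : 0 < e by rewrite -(pmulr_rgt0 _ j0) eE invr_gt0.
have e1 : e <= 1.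
  have : e <= j.+1%:R * e by rewrite ler_peMl ?(ltW e0)// ler1n.
  by rewrite eE; clear; lra.
have s01 : 0 <= 1 - e <= 1 by rewrite subr_ge0 e1 gerBl ltW.
have s34 : 3 / 4 <= (1 - e) ^+ j.+1.
  have := bernoulli_le j.+1 s01; rewrite opprB addrCA subrr addr0 eE => /(le_trans _); apply.
  by clear; lra.
have drop : level j S' <= (1 - e) * level j S.
  have /andP[s0 _] := s01.
  rewrite le_level ?mulr_ge0 ?level_ge0// exprMn level_pow//.
  have -> : cc j.+1 * ((1 - e) ^+ j.+1 * (iv j.+1 S / cc j.+1)) = (1 - e) ^+ j.+1 * iv j.+1 S.
    by rewrite mulrCA; congr (_ * _); rewrite mulrCA mulfV ?mulr1// gt_eqF.
  by apply: (le_trans up); rewrite ler_wpM2r ?iv_ge0.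
have H : potential S' + e * level j S <= potential S.
  apply: (@sum_drop _ (fun i : 'I_d => level i S) (fun i : 'I_d => level i S') (Ordinal jd)).
    by move=> i; exact: level_le (ltn_ord i) SS'.
  by move: drop; rewrite mulrBl mul1r lerBrDr.
have de : 4^-1 <= d%:R * e by rewrite -eE ler_wpM2r ?(ltW e0)// ler_nat.
have : e * h <= potential S - potential S'.
  rewrite lerBrDl; apply: le_trans H; rewrite lerD2l; exact: ler_wpM2l (ltW e0) _ _ hl.
have d0 : 0 <= d%:R :> R by rewrite ler0n.
move: (potential S - potential S') (d%:R : R) d0 de h0 => D m; clear.
move=> m0 me h0 eh.
have h1 : m * (e * h) <= m * D by rewrite ler_wpM2l.
have h2 : 4^-1 * h <= m * e * h by rewrite ler_wpM2r// ltW.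
lra.
Qed.

Lemma ffact_le_exp (m k : nat) : (m ^_ k <= m ^ k)%N.
Proof.
elim: k => [|k IH]; first by rewrite ffactn0 expn0.
by rewrite ffactnSr expnSr leq_mul// leq_subr.
Qed.

(** For order k = i+1, V_k / c_k is 2^(k-1) k! times the binomial of d and k, that is 2^(k-1) times
    a falling factorial, hence at most (2 d)^k. Each of the d levels is thus at most 2 d. *)
Lemma potential_cube : potential (@unit_cube R d) <= 2 * d%:R ^+ 2.
Proof.
have H (i : 'I_d) : level i (@unit_cube R d) <= 2 * d%:R.
  have [bQ ivQ] := iv_unit_cube R (ltn_ord i).
  rewrite le_level// ivQ exprMn -ler_pdivrMl ?cc_gt0// /cone_const invrK /=.
  rewrite -!natrX -!natrM ler_nat -mulnA [(_`! * _)%N]mulnC bin_ffact.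
  apply: leq_mul; first by rewrite leq_pexp2l.
  exact: ffact_le_exp.
apply: le_trans (ler_sum _ (fun i _ => H i)) _.
by rewrite sumr_const card_ord -[leLHS]mulr_natl expr2 mulrCA mulrA.
Qed.

Lemma full_width_unit_cube : full_width (@unit_cube R d).
Proof.
split; first by exists 0 => i; rewrite mxE lexx ler01.
move=> w w1.
have [i wi] : exists i, w 0 i != 0.
  apply: contrapT => nw; have : w = 0.
    apply/rowP => i; rewrite mxE; apply/eqP/negPn/negP => wi.
    by apply: nw; exists i.
  by move=> w0; move: w1; rewrite w0 dot0l => /eqP; rewrite eq_sym oner_eq0.
pose e : 'rV[R]_d := \row_j (j == i)%:R.
have we : dot w e = w 0 i.
  rewrite /dot (bigD1 i)//= mxE eqxx mulr1 big1 ?addr0// => j /negPf ji.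
  by rewrite mxE ji mulr0.
have Q0 : @unit_cube R d 0 by move=> j; rewrite mxE lexx ler01.
have Qe : @unit_cube R d e by move=> j; rewrite mxE; case: (j == i); rewrite /= ?lexx ler01.
move: wi; rewrite neq_lt => /orP[lt|lt].
  by exists e, 0; split => //; rewrite dot0r we.
by exists 0, e; split => //; rewrite dot0r we.
Qed.

Lemma telescope_step (l x K a b c h : R) : l <= K * (a - b) -> 2 * h <= K * (b - c) ->
  x <= 2 * h -> l + x <= K * (a - c).
Proof. by move=> h1 h2 h3; lra. Qed.

Lemma search_invariant v (u : nat -> 'rV[R]_d) (p : nat -> R) T : @unit_cube R d v ->
  symmetric_search_run v u p T ->
  [/\ convex_body (knowledge_set v u p T), full_width (knowledge_set v u p T), knowledge_set v u p T v &
    total_loss v u p T <= 8 * d%:R *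
      (potential (@unit_cube R d) - potential (knowledge_set v u p T))].
Proof.
move=> Qv; elim: T => [|T IH] run.
  split => //=; first by have [] := iv_unit_cube R (leq0n d).
    exact: full_width_unit_cube.
  by rewrite /total_loss big_ord0 subrr mulr0.
have [|bS fS Sv loss] := IH; first by move=> t tT; apply: run; exact: ltnW.
have [u1 guess] := run T (ltnSn T).
have [j [jd [h [h0 wh near lo [upge uple fge fle]]]]] := search_step bS fS u1 guess.
set S := knowledge_set v u p T in bS fS Sv loss guess wh near lo upge uple fge fle *.
set S' := knowledge_set v u p T.+1.
suff [bS' fS' S'v SS' up] : [/\ convex_body S', full_width S', S' v, S' `<=` S &
    iv j.+1 S' <= 3 / 4 * iv j.+1 S].
  split; [exact: bS'|exact: fS'|exact: S'v|].
  have -> : total_loss v u p T.+1 = total_loss v u p T + symmetric_loss (dot (u T) v) (p T).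
    exact: big_ord_recr.
  exact: telescope_step loss (potential_drop bS bS' SS' jd h0 lo up) (near v Sv).
have -> : S' = if p T <= dot (u T) v then cut_ge S (p T) (u T) else cut_le S (p T) (u T) by [].
case: leP => pv.
  by split; [exact: convex_body_cut_ge|exact: fge|split|move=> ? []|exact: upge].
by split; [exact: convex_body_cut_le|exact: fle|split; [exact: Sv|exact: ltW]|move=> ? []|exact: uple].
Qed.

End SymmetricSearch.

Theorem theorem17 (R : realType) :
  exists C : R, forall (d T : nat) (v : 'rV[R]_d)
    (u : nat -> 'rV[R]_d) (p : nat -> R),
    (1 <= d)%N ->
    unit_cube v ->
    symmetric_search_run v u p T ->
    total_loss v u p T <= C * d%:R ^+ 4.
Proof.
(* 16 is 8 times 2, from the drop and the initial potential; they give 16 d^3, and d >= 1 raises the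
   exponent to 4. *)
exists 16 => -[//|n] T v u p _ Qv run.
have [_ _ _ /le_trans] := search_invariant Qv run; apply.
have d1 : 1 <= n.+1%:R :> R by rewrite ler1n.
have d0 : 0 <= 8 * n.+1%:R :> R by [].
have P0 : 0 <= potential (knowledge_set v u p T).
  by apply: sumr_ge0 => i _; exact: level_ge0.
apply: (@le_trans _ _ (8 * n.+1%:R * (2 * n.+1%:R ^+ 2))).
  apply: ler_wpM2l d0 _ _ (le_trans _ (potential_cube R n)).
  by move: (potential _) P0 => P P0; rewrite gerBl.
have -> : 8 * n.+1%:R * (2 * n.+1%:R ^+ 2) = 16 * n.+1%:R ^+ 3 :> R by ring.
by rewrite ler_wpM2l// ler_weXn2l.
Qed.
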